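(* Let $\sigma^2:=16\log 2-10$. There exists a constant $C\in[0,\infty)$ such that for all $t\in(0,\infty)$, \[ \sup_{x\in\mathbb R}\left|\Pr\left(\sqrt{\frac{2t}{\sigma^2}}\left(N_t-\frac{2}{t}\right)\le x\right)-\Phi(x)\right|\le C\sqrt t. \]
   Context: Kakutani's interval-splitting process: let $U_1,U_2,\dots$ be i.i.d. uniform random variables on $[0,1]$. At time $0$ the partition of $[0,1]$ consists of the single interval $[0,1]$. Given the partition at time $n\in\mathbb Z_+$ (which consists of $n+1$ intervals, whose lengths are a.s. distinct), let $[a,b]$ be the interval of maximal length; the partition at time $n+1$ is obtained by replacing $[a,b]$ by the two intervals $[a,a+U_{n+1}(b-a)]$ and $[a+U_{n+1}(b-a),b]$. Write $L_{n,1},\dots,L_{n,n+1}$ for the interval lengths at time $n$ and $M_n:=\max_i L_{n,i}$. For $t\in(0,\infty)$ define the threshold time $N_t:=\inf\{n\in\mathbb Z_+: M_n\le t\}$. $\Phi$ is the standard normal distribution function. *)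

(* Defs.v *)
From HB Require Import structures.
From mathcomp Require Import all_boot all_order all_algebra.
From mathcomp Require Import all_classical all_reals all_analysis.
Set Implicit Arguments. Unset Strict Implicit. Unset Printing Implicit Defensive.
Import Order.TTheory GRing.Theory Num.Theory.
Local Open Scope classical_set_scope.
Local Open Scope ring_scope.

Section kakutani.
Context {R : realType}.

(* maximum of a finite list of (nonnegative) reals; the max over the empty
   list is 0 (never used: the partition is always nonempty) *)
Definition seqmax (s : seq R) : R := \big[Num.max/0]_(x <- s) x.

(* Interval lengths of Kakutani's process, driven by the deterministic
   sequence u, where u n plays the role of U_{n+1} (used to go from time n
   to time n+1).  Only lengths matter: the maximal interval (the first one
   of maximal length, ties having probability 0) of length m is replaced by
   two intervals of lengths u n * m and (1 - u n) * m. *)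
Fixpoint kak_lengths (u : nat -> R) (n : nat) : seq R :=
  match n with
  | 0 => [:: 1]
  | n'.+1 =>
      let s := kak_lengths u n' in
      let m := seqmax s in
      let i := index m s in
      take i s ++ [:: u n' * m; (1 - u n') * m] ++ drop i.+1 s
  end.

Definition kak_max (u : nat -> R) (n : nat) : R := seqmax (kak_lengths u n).

Definition kak_threshold_is (u : nat -> R) (t : R) (n : nat) : Prop :=
  kak_max u n <= t /\ (forall k, (k < n)%N -> t < kak_max u k).

End kakutani.

Definition mutually_independent {R : realType} (d : measure_display)
  (T : measurableType d) (P : probability T R) (X : nat -> T -> R) : Prop :=
  forall (F : seq nat), uniq F ->
  forall (B : nat -> set R), (forall i, measurable (B i)) ->
    P (\bigcap_(i in [set` F]) (X i @^-1` B i)) =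
    (\big[*%E/1%E]_(i <- F) P (X i @^-1` B i))%E.

Definition Phi {R : realType} (x : R) : R :=
  fine (normal_prob 0 1 `]-oo, x]).

Definition kak_sigma2 {R : realType} : R := 16 * ln 2 - 10.

(* Main.v *)
(** Put [X = 1/t], [W = N_t + 1 - 2 X] and [c = 8 ln 2 - 5 = sigma^2 / 2].  Intervals evolve
    independently once they are separated, so the characteristic function of [W] at [s] is [f X],
    where [f x = e^(i s (1 - 2 x))] for [x <= 1] and [f x] is the integral of
    [f (u x) f ((1 - u) x)] over [0 <= u <= 1] for [x > 1].  Taking this equation as the definition
    of [f], the products of the [f (l_i / t)] over the current lengths [l_i] form a martingale until
    time [N_t], and [P(N_t >= n)] decays geometrically because the product of the [exp (l_i ^ 2)]
    contracts in mean.

    The second-order Taylor coefficient of [f] in [s] is explicit; it equals [c x] for [x >= 2].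
    This gives [f] up to [O(s^3)] for [x <= 40], and the equation propagates the bounds
    [|f x| <= e^(- c s^2 (x + 1) / 4)] and
    [|f x - e^(- c s^2 x / 2)| <= K s^3 x e^(- c s^2 x / 4)] to all [x >= 2], for [0 < s <= delta]
    with [delta] independent of [x]: two pieces of total length [x] lose the factor
    [e^(- c s^2 / 4)] at each splitting, which absorbs the contribution of short pieces.

    The indicator of a half-line is then replaced by a function whose Fourier transform is supported
    in [-delta, delta], with an error dominated by a nonnegative function of the same kind; both
    expectations are integrals of [f] and are compared with those of a centred Gaussian variable of
    variance [c X], at the cost of [O(X ^ (-1/2))]. *)

Require Import Defs.
From HB Require Import structures.
From mathcomp Require Import all_boot all_order all_algebra.
From mathcomp Require Import all_classical all_reals all_analysis.
From mathcomp Require Import measurable_realfun.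
From mathcomp Require Import complex ring lra.
Import Order.TTheory GRing.Theory Num.Theory.
Import numFieldNormedType.Exports.
Import Normc.
Local Open Scope classical_set_scope.
Local Open Scope ring_scope.
Set Implicit Arguments. Unset Strict Implicit. Unset Printing Implicit Defensive.

Local Notation Re := complex.Re.
Local Notation Im := complex.Im.

(** * Integrals over the unit interval *)

Section bounded_measurable.
Context {R : realType}.
Notation mu := (@lebesgue_measure R).

(** Counting intervals, [N_t + 1], rather than splits makes count and length both additive: [W] for
    an interval is the sum of the values for its two pieces. Subtracting twice the length makes the
    mean of [W] vanish exactly for [x > 1].

    The equation expresses [f x] through lengths arbitrarily close to [x], so bounds do not follow
    by plain induction on [x]. Instead a weighted bound is inserted into the equation and its
    constant is shown to contract; boundedness of [f] supplies the first finite constant.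

    An error bound linear in [x] is critical, because the errors of the two pieces add up to the
    error of the whole. The weight [x - 1] leaves a surplus of 1 at each splitting, which pays for
    pieces of length at most 2; for large [x] these occur with probability [4 / x], and from
    [x = 40] on the surplus suffices.

    A fixed bandwidth is enough since [W] is not normalised: measured in standard deviations, the
    smoothing has width of order [X ^ (-1/2)], and the integral of [s ^ 2 * X * e^(- c s^2 X / 4)]
    over [s] is of the same order. *)

Definition bm (h : R -> R) :=
  measurable_fun setT h /\ exists M, forall u, 0 <= u <= 1 -> `|h u| <= M.

Definition I01 (h : R -> R) : R := (\int[mu]_(u in `[0%R, 1%R]) h u)%R.

Lemma bm_integrable h : bm h -> mu.-integrable `[0%R, 1%R] (EFin \o h).
Proof.
move=> [mh [M hM]]; apply: measurable_bounded_integrable => //.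
- by rewrite /= lebesgue_measure_itv/= lte_fin ltr01 -EFinB ltry.
- exact: measurable_funTS.
- exists M; split; first exact: num_real.
  by move=> x Mx u /=; rewrite in_itv/= => /hM /le_trans; apply; exact: ltW.
Qed.

Lemma bm_cst (k : R) : bm (fun=> k).
Proof. by split => //; exists `|k|. Qed.

Lemma bm_id : bm id.
Proof. by split => //; exists 1 => u /andP[u0 u1]; rewrite ger0_norm. Qed.

Lemma bmD g h : bm g -> bm h -> bm (fun u => g u + h u).
Proof.
move=> [mg [M gM]] [mh [N hN]]; split; first exact: measurable_funD.
exists (M + N) => u u01; rewrite (le_trans (ler_normD _ _))// lerD ?gM ?hN//.
Qed.

Lemma bmN h : bm h -> bm (fun u => - h u).
Proof.
move=> [mh [N hN]]; split; first exact: measurableT_comp.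
by exists N => u u01; rewrite normrN hN.
Qed.

Lemma bmB g h : bm g -> bm h -> bm (fun u => g u - h u).
Proof. by move=> bg bh; apply: bmD => //; exact: bmN. Qed.

Lemma bmM g h : bm g -> bm h -> bm (fun u => g u * h u).
Proof.
move=> [mg [M gM]] [mh [N hN]]; split; first exact: measurable_funM.
by exists (M * N) => u u01; rewrite normrM ler_pM ?gM ?hN.
Qed.

Lemma bmX h n : bm h -> bm (fun u => h u ^+ n).
Proof.
move=> bh; elim: n => [|n IH]; first exact: bm_cst.
by under eq_fun do rewrite exprS; exact: bmM.
Qed.

Lemma bm_onem : bm (fun u => 1 - u).
Proof. by apply: bmB; [exact: bm_cst|exact: bm_id]. Qed.

Lemma bm_if (g h : R -> R) (b : R -> bool) : measurable_fun setT b ->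
  bm g -> bm h -> bm (fun u => if b u then g u else h u).
Proof.
move=> mb [mg [M gM]] [mh [N hN]]; split; first exact: measurable_fun_ifT.
exists (Num.max M N) => u u01; rewrite le_max; case: ifP => _; apply/orP.
  by left; exact: gM.
by right; exact: hN.
Qed.

Lemma bm_mfun (h : R -> R) (M : R) : measurable_fun setT h ->
  (forall u, 0 <= u <= 1 -> `|h u| <= M) -> bm h.
Proof. by move=> mh hM; split => //; exists M. Qed.

Lemma I01D g h : bm g -> bm h -> I01 (fun u => g u + h u) = I01 g + I01 h.
Proof. by move=> /bm_integrable ? /bm_integrable ?; exact: RintegralD. Qed.

Lemma I01B g h : bm g -> bm h -> I01 (fun u => g u - h u) = I01 g - I01 h.
Proof. by move=> /bm_integrable ? /bm_integrable ?; exact: RintegralB. Qed.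

Lemma I01Zl k h : bm h -> I01 (fun u => k * h u) = k * I01 h.
Proof. by move=> /bm_integrable ?; exact: RintegralZl. Qed.

Lemma I01Zr k h : bm h -> I01 (fun u => h u * k) = I01 h * k.
Proof. by move=> /bm_integrable ?; exact: RintegralZr. Qed.

Lemma I01_cst k : I01 (fun=> k) = k.
Proof.
rewrite /I01 Rintegral_cst//= lebesgue_measure_itv/= lte_fin ltr01.
by rewrite -EFinB/= subr0 mulr1.
Qed.

Lemma I01_le g h : bm g -> bm h -> (forall u, 0 <= u <= 1 -> g u <= h u) ->
  I01 g <= I01 h.
Proof.
move=> /bm_integrable ? /bm_integrable ? gh; exact: le_Rintegral.
Qed.

Lemma I01_eq g h : (forall u, 0 <= u <= 1 -> g u = h u) -> I01 g = I01 h.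
Proof.
move=> gh; apply: eq_Rintegral => u; rewrite inE/= in_itv/=; exact: gh.
Qed.

Lemma I01_ge0 h : (forall u, 0 <= u <= 1 -> 0 <= h u) -> 0 <= I01 h.
Proof. by move=> h0; apply: Rintegral_ge0 => u /=; rewrite in_itv/=; exact: h0. Qed.

Lemma I01_norm h g : bm h -> bm g -> (forall u, 0 <= u <= 1 -> `|h u| <= g u) ->
  `|I01 h| <= I01 g.
Proof.
move=> bh bg hg; rewrite ler_norml; apply/andP; split.
  rewrite -mulN1r -(I01Zl _ bg); apply: I01_le => //.
    by apply: bmM => //; exact: bm_cst.
  by move=> u /hg; rewrite mulN1r ler_norml => /andP[].
by apply: I01_le => // u /hg; rewrite ler_norml => /andP[].
Qed.

(** Half-open intervals can be glued without overlap. The case [a = b] is included because the last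
    of the three pieces in [I01_kv] is empty for [x <= 2]. *)
Lemma Rintegral_oc_FTC (a b : R) (h H : R -> R) : a <= b ->
  (forall u : R, a <= u <= b -> is_derive u 1 H (h u)) ->
  (forall u : R, a <= u <= b -> {for u, continuous h}) ->
  mu.-integrable `]a, b] (EFin \o h) /\
  (\int[mu]_(u in `]a, b]) h u)%R = H b - H a.
Proof.
move=> + dH ch.
rewrite le_eqVlt => /orP[/eqP <-|ab].
  rewrite subrr set_itv_ge ?bnd_simp ?ltxx// Rintegral_set0; split => //.
  exact: integrable_set0.
have cw : {within `[a, b], continuous h}.
  by apply: continuous_in_subspaceT => u; rewrite inE/= in_itv/=; exact: ch.
have dHo : derivable_oo_LRcontinuous H a b.
  split.
  - by move=> u; rewrite in_itv/= => /andP[au ub]; have [] := dH u; rewrite ?ltW.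
  - apply: cvg_at_right_filter.
    have [+ _] := dH a (introT andP (conj (lexx a) (ltW ab))).
    by move=> /derivable1_diffP /differentiable_continuous.
  - apply: cvg_at_left_filter.
    have [+ _] := dH b (introT andP (conj (ltW ab) (lexx b))).
    by move=> /derivable1_diffP /differentiable_continuous.
split.
  apply: (@integrableS _ _ _ mu `[a, b]%classic) => //; first exact: subset_itv_oc_cc.
  by apply: continuous_compact_integrable => //; exact: segment_compact.
rewrite /Rintegral integral_itv_obnd_cbnd; last first.
  apply/measurable_EFinP; apply: (@measurable_funS _ _ _ _ `[a, b]) => //.
    exact: subset_itv_oc_cc.
  exact: subspace_continuous_measurable_fun.
rewrite (continuous_FTC2 ab cw dHo)//= => u; rewrite in_itv/= => /andP[au ub].
by rewrite derive1E; have [_] := dH u (introT andP (conj (ltW au) (ltW ub))).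
Qed.

Lemma I01_indic_FTC (a b : R) (h H : R -> R) : 0 <= a -> a <= b -> b <= 1 ->
  (forall u : R, a <= u <= b -> is_derive u 1 H (h u)) ->
  (forall u : R, a <= u <= b -> {for u, continuous h}) ->
  I01 (fun u => if a < u <= b then h u else 0) = H b - H a.
Proof.
move=> a0 ab b1 dH ch; have [_ <-] := Rintegral_oc_FTC ab dH ch.
rewrite /I01 Rintegral_mkcond [RHS]Rintegral_mkcond.
apply: eq_Rintegral => u _; rewrite !patchE.
have [|] := boolP (u \in `]a, b]%classic).
  rewrite inE/= in_itv/= => /andP[au ub]; rewrite au ub/= ifT//.
  by rewrite inE/= in_itv/= (le_trans a0 (ltW au)) (le_trans ub b1).
rewrite notin_setE/= in_itv/= => /negP/negbTE ->.
by case: ifP.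
Qed.

Lemma I01_FTC (h H : R -> R) :
  (forall u : R, 0 <= u <= 1 -> is_derive u 1 H (h u)) ->
  (forall u : R, 0 <= u <= 1 -> {for u, continuous h}) ->
  I01 h = H 1 - H 0.
Proof.
move=> dH ch; have [ih <-] := Rintegral_oc_FTC ler01 dH ch.
by rewrite /I01 Rintegral_itv_obnd_cbnd.
Qed.

End bounded_measurable.


(** * Integrals of complex-valued functions *)

Section complex_integral.
Context {R : realType}.
Implicit Types (z : R[i]) (F G : R -> R[i]).

Lemma normc_ge_rot (a b : R) z : a ^+ 2 + b ^+ 2 = 1 ->
  a * Re z + b * Im z <= normc z.
Proof.
case: z => x y /= ab; apply: le_trans (ler_norm _) _.
rewrite -sqrtr_sqr ler_sqrt ?addr_ge0 ?sqr_ge0//.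
have -> : x ^+ 2 + y ^+ 2 = (a ^+ 2 + b ^+ 2) * (x ^+ 2 + y ^+ 2).
  by rewrite ab mul1r.
have -> : (a ^+ 2 + b ^+ 2) * (x ^+ 2 + y ^+ 2)
   = (a * x + b * y) ^+ 2 + (a * y - b * x) ^+ 2 by ring.
by rewrite lerDl sqr_ge0.
Qed.

(** Choosing [(a, b)] as the direction of [z] turns the linear form into the modulus. With
    [normc_ge_rot] this reduces the triangle inequality for complex integrals to a comparison of
    real ones. *)
Lemma normc_le_rot z (r : R) : 0 <= r ->
  (forall a b, a ^+ 2 + b ^+ 2 = 1 -> a * Re z + b * Im z <= r) -> normc z <= r.
Proof.
case: z => x y /= r0 H.
have [n0|n0] := eqVneq (Num.sqrt (x ^+ 2 + y ^+ 2)) 0; first by rewrite n0.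
set n := Num.sqrt _ in n0 *.
have n2 : n ^+ 2 = x ^+ 2 + y ^+ 2 by rewrite sqr_sqrtr// addr_ge0 ?sqr_ge0.
have := H (x / n) (y / n); rewrite !exprMn -mulrDl -n2 exprVn divff ?expf_neq0//.
move/(_ erefl); suff -> : x / n * x + y / n * y = n by [].
by rewrite -!(mulrAC _ _ (n^-1)) -mulrDl -!expr2 -n2 expr2 mulfK.
Qed.

Lemma normc_Re z : `|Re z| <= normc z.
Proof.
rewrite ler_norml; apply/andP; split.
  have := @normc_ge_rot (-1) 0 z; rewrite sqrrN expr1n expr0n/= addr0.
  by move/(_ erefl); rewrite mul0r addr0 mulN1r lerNl.
have := @normc_ge_rot 1 0 z; rewrite expr1n expr0n/= addr0.
by move/(_ erefl); rewrite mul0r addr0 mul1r.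
Qed.

Lemma normc_Im z : `|Im z| <= normc z.
Proof.
rewrite ler_norml; apply/andP; split.
  have := @normc_ge_rot 0 (-1) z; rewrite sqrrN expr1n expr0n/= add0r.
  by move/(_ erefl); rewrite mul0r add0r mulN1r lerNl.
have := @normc_ge_rot 0 1 z; rewrite expr1n expr0n/= add0r.
by move/(_ erefl); rewrite mul0r add0r mul1r.
Qed.

Lemma normc_leD (x y : R) : normc (x +i* y)%C <= `|x| + `|y|.
Proof.
rewrite -[leRHS]ger0_norm ?addr_ge0//= -sqrtr_sqr ler_sqrt ?sqr_ge0//.
rewrite sqrrD !real_normK ?num_real// -addrA lerD2l lerDr.
by rewrite mulrn_wge0// mulr_ge0.
Qed.

Definition cI F : R[i] := (I01 (fun u => Re (F u)) +i* I01 (fun u => Im (F u)))%C.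

Definition cbm F := bm (fun u => Re (F u)) /\ bm (fun u => Im (F u)).

Lemma cI_norm F (g : R -> R) : cbm F -> bm g ->
  (forall u, 0 <= u <= 1 -> normc (F u) <= g u) -> normc (cI F) <= I01 g.
Proof.
move=> [bF1 bF2] bg Fg; apply: normc_le_rot.
  apply: I01_ge0 => u /Fg; apply: le_trans; case: (F u) => ? ? /=.
  exact: sqrtr_ge0.
move=> a b ab /=; rewrite -!I01Zl// -I01D//; last 2 first.
- by apply: bmM => //; exact: bm_cst.
- by apply: bmM => //; exact: bm_cst.
apply: I01_le => //.
  by apply: bmD; apply: bmM => //; exact: bm_cst.
by move=> u /Fg; apply: le_trans; exact: normc_ge_rot.
Qed.

Lemma cbmD F G : cbm F -> cbm G -> cbm (fun u => F u + G u).
Proof.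
move=> [F1 F2] [G1 G2]; split.
  rewrite (_ : (fun _ => _) = (fun u => Re (F u) + Re (G u))); first exact: bmD.
  by apply/funext => u; case: (F u) (G u) => ? ? [].
rewrite (_ : (fun _ => _) = (fun u => Im (F u) + Im (G u))); first exact: bmD.
by apply/funext => u; case: (F u) (G u) => ? ? [].
Qed.

Lemma cbmB F G : cbm F -> cbm G -> cbm (fun u => F u - G u).
Proof.
move=> [F1 F2] [G1 G2]; split.
  rewrite (_ : (fun _ => _) = (fun u => Re (F u) - Re (G u))); first exact: bmB.
  by apply/funext => u; case: (F u) (G u) => ? ? [].
rewrite (_ : (fun _ => _) = (fun u => Im (F u) - Im (G u))); first exact: bmB.
by apply/funext => u; case: (F u) (G u) => ? ? [].
Qed.

Lemma cbmM F G : cbm F -> cbm G -> cbm (fun u => F u * G u).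
Proof.
move=> [F1 F2] [G1 G2]; split.
  rewrite (_ : (fun _ => _) =
    (fun u => Re (F u) * Re (G u) - Im (F u) * Im (G u))).
    by apply: bmB; exact: bmM.
  by apply/funext => u; case: (F u) (G u) => ? ? [].
rewrite (_ : (fun _ => _) =
    (fun u => Re (F u) * Im (G u) + Im (F u) * Re (G u))).
  by apply: bmD; exact: bmM.
by apply/funext => u; case: (F u) (G u) => ? ? [].
Qed.

Lemma cIB F G : cbm F -> cbm G -> cI (fun u => F u - G u) = cI F - cI G.
Proof.
move=> [F1 F2] [G1 G2]; rewrite /cI; apply/eqP; rewrite eq_complex /=.
rewrite -I01B// -I01B//; apply/andP; split; apply/eqP; apply: I01_eq => u _;
by case: (F u) (G u) => ? ? [].
Qed.

Lemma cI_eq F G : (forall u, 0 <= u <= 1 -> F u = G u) -> cI F = cI G.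
Proof.
by move=> FG; rewrite /cI; congr Complex; apply: I01_eq => u /FG ->.
Qed.

End complex_integral.

(** Iterating the improvement from the crude bound [M] gives [max S0 (k ^ n * |M|)], and the second
    entry eventually drops below [S0]. This stands in for induction on the length, since [rho] at
    one point may depend on its values at points arbitrarily close. *)
Lemma bootstrap_bound {R : realType} (E : set R) (rho : R -> R) (S0 k M : R) :
  0 < S0 -> 0 <= k < 1 -> (forall x, E x -> rho x <= M) ->
  (forall S, S0 <= S -> (forall x, E x -> rho x <= S) ->
     forall x, E x -> rho x <= Num.max S0 (k * S)) ->
  forall x, E x -> rho x <= S0.
Proof.
move=> S00 /andP[k0 k1] rM H.
have iter n : forall x, E x -> rho x <= Num.max S0 (k ^+ n * `|M|).
  elim: n => [|n IH] x Ex.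
    by rewrite expr0 mul1r le_max (le_trans (rM x Ex) (ler_norm _)) orbT.
  have := H (Num.max S0 (k ^+ n * `|M|)) _ IH x Ex.
  rewrite le_max lexx => /(_ isT) /le_trans; apply.
  rewrite ge_max !le_max lexx/=; apply/orP.
  rewrite exprS -mulrA; case: (leP S0 (k ^+ n * `|M|)) => [_|_]; first by right.
  by left; rewrite ler_piMl ?(ltW S00) ?(ltW k1).
move=> x Ex.
have : (fun n => k ^+ n * `|M|) @ \oo --> 0.
  rewrite -[X in _ --> X](mul0r `|M|); apply: cvgM; last exact: cvg_cst.
  by apply: cvg_expr; rewrite ger0_norm.
move=> /cvgrPdist_lt /(_ S0 S00) [n _ /(_ n (leqnn n))] /=.
rewrite sub0r normrN => /ltW /(le_trans (ler_norm _)) kS.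
by have := iter n x Ex; rewrite (max_l kS).
Qed.

Section integral_more.
Context {R : realType}.
Notation mu := (@lebesgue_measure R).

Lemma is_derive_continuous (h : R -> R) (u l : R) :
  is_derive u 1 h l -> {for u, continuous h}.
Proof. by move=> [+ _] => /derivable1_diffP /differentiable_continuous. Qed.

Let onem_measurable : measurable_fun setT (fun u : measurableTypeR R => 1 - u : measurableTypeR R).
Proof. exact: measurable_funB. Qed.

(** The reflection turns []a, b]] into [[1 - b, 1 - a[], of the same length, and a measure agreeing
    with Lebesgue measure on half-open intervals equals it. *)
Let pushforward_onem (A : set (measurableTypeR R)) : measurable A ->
  mu A = pushforward mu (fun u : measurableTypeR R => 1 - u : measurableTypeR R) A.
Proof.
move=> mA.
pose phi := mfun_Sub (mem_set onem_measurable : (fun u : measurableTypeR R => 1 - u : measurableTypeR R) \in mfun).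
apply: (@lebesgue_measure_unique _ (pushforward mu phi : {measure set _ -> \bar R})) => //.
move=> X [[a b] _ <-]; rewrite /pushforward.
transitivity (mu (`[1 - b, 1 - a[%classic : set R)); last first.
  congr (mu _).
  apply/seteqP; split => u /=; rewrite !in_itv/= => /andP[h1 h2]; apply/andP; split; lra.
rewrite /= !lebesgue_measure_itv/= !lte_fin ltrD2l ltrN2.
by case: ifP => // _; rewrite -!EFinB; congr (_%:E); ring.
Qed.

Lemma I01_sym (h : R -> R) : bm h -> I01 (fun u => h (1 - u)) = I01 h.
Proof.
move=> bh; have [mh _] := bh.
pose phi := mfun_Sub (mem_set onem_measurable : (fun u : measurableTypeR R => 1 - u : measurableTypeR R) \in mfun).
rewrite /I01 /Rintegral; congr fine; apply/esym.
rewrite [LHS](@eq_measure_integral _ _ _ _ (pushforward mu phi)); last first.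
  by move=> A mA _; exact: pushforward_onem.
have pE : phi @^-1` `[0, 1]%classic = `[0, 1]%classic :> set R.
  apply/seteqP; split => u /=; rewrite !in_itv/= => /andP[h1 h2]; apply/andP; split; lra.
rewrite integral_pushforward//=.
- by rewrite pE.
- apply/measurable_EFinP; exact: measurable_funTS.
- rewrite pE.
  apply: (@bm_integrable _ (fun u => h (1 - u))).
  have [M hM] := bh.2; apply: (@bm_mfun _ _ M).
    exact: (measurableT_comp mh onem_measurable).
  by move=> u /andP[u0 u1]; apply: hM; apply/andP; split; lra.
Qed.

Lemma bm_sym (h : R -> R) : bm h -> bm (fun u => h (1 - u)).
Proof.
move=> [mh [M hM]]; apply: (@bm_mfun _ _ M).
  exact: (measurableT_comp mh onem_measurable).
by move=> u /andP[u0 u1]; apply: hM; apply/andP; split; lra.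
Qed.

Lemma I01_pow n : I01 (fun u : R => u ^+ n) = n.+1%:R^-1.
Proof.
have H1 (u : R) : 0 <= u <= 1 ->
    is_derive u 1 (fun u : R => u ^+ n.+1 / n.+1%:R) (u ^+ n).
  move=> _.
  have ? : is_derive u 1 (fun u : R => u ^+ n.+1) (n.+1%:R * u ^+ n).
    have [d1 d2] := @is_deriveX R R id n.+1 u 1 1 (is_derive_id u 1).
    move: d1 d2; rewrite exprfctE => d1 d2.
    by apply: DeriveDef => //; rewrite d2 /GRing.scale/= mulr1.
  apply: is_derive_eq; rewrite /GRing.scale/=; field.
  by rewrite ?nat1r ?natr1 pnatr_eq0.
have H2 (u : R) : 0 <= u <= 1 -> {for u, continuous (fun u : R => u ^+ n)}.
  by move=> _; exact: exprn_continuous.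
by rewrite (I01_FTC H1 H2) expr1n expr0n/= mul0r subr0 mul1r.
Qed.

Lemma I01_onem_pow n : I01 (fun u : R => (1 - u) ^+ n) = n.+1%:R^-1.
Proof. by rewrite (I01_sym (bmX n bm_id)) I01_pow. Qed.

Lemma I01_cc_FTC (a b : R) (h H : R -> R) : 0 <= a -> a <= b -> b <= 1 ->
  (forall u : R, a <= u <= b -> is_derive u 1 H (h u)) ->
  (forall u : R, a <= u <= b -> {for u, continuous h}) ->
  I01 (fun u => if a <= u <= b then h u else 0) = H b - H a.
Proof.
move=> a0 ab b1 dH ch; have [ih <-] := Rintegral_oc_FTC ab dH ch.
rewrite Rintegral_itv_obnd_cbnd//.
rewrite /I01 Rintegral_mkcond [RHS]Rintegral_mkcond.
apply: eq_Rintegral => u _; rewrite !patchE.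
have [|] := boolP (u \in `[a, b]%classic).
  rewrite inE/= in_itv/= => /andP[au ub]; rewrite au ub/= ifT//.
  by rewrite inE/= in_itv/= (le_trans a0 au) (le_trans ub b1).
rewrite notin_setE/= in_itv/= => /negP/negbTE ->.
by case: ifP.
Qed.

Lemma is_derive_le (f df : R -> R) (a b : R) : a <= b ->
  (forall x : R, a <= x <= b -> is_derive x 1 f (df x)) ->
  (forall x, a <= x <= b -> 0 <= df x) -> f a <= f b.
Proof.
move=> ab d1 d2; rewrite -subr_ge0.
have [x| |x xab ->] := @MVT_segment R f df a b ab.
- by rewrite in_itv/= => /andP[/ltW ax /ltW xb]; apply: d1; rewrite ax.
- apply: continuous_in_subspaceT => x; rewrite inE/= in_itv/= => xab.
  exact: is_derive_continuous (d1 x xab).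
- rewrite mulr_ge0 ?subr_ge0//; apply: d2; by rewrite in_itv/= in xab.
Qed.

Lemma bm_le_ind (k x : R) : bm (fun u => if u * x <= k then 1 else 0).
Proof.
apply: bm_if; [|exact: bm_cst|exact: bm_cst].
by apply: measurable_fun_ler => //; exact: measurable_funM.
Qed.

Lemma I01_le_ind (k x : R) : 0 <= k <= x -> 0 < x ->
  I01 (fun u => if u * x <= k then 1 else 0) = k / x.
Proof.
move=> /andP[k0 kx] x0.
have H1 (u : R) : 0 <= u <= k / x -> is_derive u 1 (fun u : R => u) 1.
  by move=> _; exact: is_derive_id.
have H2 (u : R) : 0 <= u <= k / x -> {for u, continuous (fun u : R => 1 : R)}.
  by move=> _; exact: cst_continuous.
rewrite -[RHS]subr0 -(I01_cc_FTC (lexx 0) _ _ H1 H2).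
- by apply: I01_eq => u /andP[-> _]/=; rewrite ler_pdivlMr.
- by rewrite divr_ge0// ltW.
- by rewrite ler_pdivrMr// mul1r.
Qed.

End integral_more.

(** * The functional equation *)

Section complex_extra.
Context {R : realType}.
Implicit Types (z : R[i]) (f g : R -> R[i]).

Definition cis (a : R) : R[i] := (cos a +i* sin a)%C.

Lemma normc_cis a : normc (cis a) = 1.
Proof. by rewrite /cis/= cos2Dsin2 sqrtr1. Qed.

Lemma cisD a b : cis (a + b) = cis a * cis b.
Proof.
apply/eqP; rewrite eq_complex /= cosD sinD eqxx/=.
by apply/eqP; ring.
Qed.

Lemma normc_ge0 z : 0 <= normc z.
Proof. by case: z => a b /=; exact: sqrtr_ge0. Qed.

Lemma normcD z1 z2 : normc (z1 + z2) <= normc z1 + normc z2.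
Proof. exact: le_normcD. Qed.

Lemma normc_opp z : normc (- z) = normc z.
Proof. by case: z => a b /=; rewrite !sqrrN. Qed.

Lemma normcB z1 z2 : normc (z1 - z2) = normc (z2 - z1).
Proof. by rewrite -normc_opp opprB. Qed.

Lemma normc_tri z1 z2 z3 : normc (z1 - z3) <= normc (z1 - z2) + normc (z2 - z3).
Proof. by rewrite -{1}(subrK z2 z1) -addrA normcD. Qed.

Lemma normc_real (x : R) : normc (x%:C)%C = `|x|.
Proof. by rewrite /= expr0n/= addr0 sqrtr_sqr. Qed.

Definition cmeas f :=
  measurable_fun setT (fun x => Re (f x)) /\ measurable_fun setT (fun x => Im (f x)).

Lemma cmeas_cis (h : R -> R) : measurable_fun setT h ->
  cmeas (fun x => cis (h x)).
Proof.
move=> mh; split => /=; apply: measurableT_comp => //.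
  by apply: continuous_measurable_fun; exact: continuous_cos.
by apply: continuous_measurable_fun; exact: continuous_sin.
Qed.

Lemma cbm_cmeas f : cmeas f -> (forall x, normc (f x) <= 1) -> cbm f.
Proof.
move=> [m1 m2] f1; split; apply: (@bm_mfun _ _ 1) => // u _.
  exact: le_trans (normc_Re _) (f1 _).
exact: le_trans (normc_Im _) (f1 _).
Qed.

Lemma cmeas_comp f (h : R -> R) : cmeas f -> measurable_fun setT h ->
  cmeas (fun x => f (h x)).
Proof.
move=> [m1 m2] mh; split.
  exact: (measurableT_comp m1 mh).
exact: (measurableT_comp m2 mh).
Qed.

Lemma cbm_conv f g (x : R) : cmeas f -> (forall x, normc (f x) <= 1) ->
  cmeas g -> (forall x, normc (g x) <= 1) ->
  cbm (fun u => f (u * x) * g ((1 - u) * x)).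
Proof.
move=> mf f1 mg g1; apply: cbmM; apply: cbm_cmeas => //; apply: cmeas_comp => //.
  exact: measurable_funM.
by apply: measurable_funM => //; exact: measurable_funB.
Qed.

Lemma normc_mulB (a b c d : R[i]) :
  normc (a * b - c * d) <= normc (a - c) * normc b + normc c * normc (b - d).
Proof.
have -> : a * b - c * d = (a - c) * b + c * (b - d) by ring.
by apply: le_trans (normcD _ _) _; rewrite !normcM.
Qed.

End complex_extra.

Lemma measurable_I01 {R : realType} (h : R * R -> R) (M : R) :
  measurable_fun setT h -> (forall p, `|h p| <= M) ->
  measurable_fun setT (fun x => I01 (fun u => h (x, u))).
Proof.
move=> mh hM.
(* Adding [M] makes the integrand nonnegative, so that Tonelli's measurability of partial integrals
   applies; the constant is subtracted again at the end. *)
pose g (p : R * R) : \bar R := ((h p + M) * \1_(`[0%R, 1%R]%classic : set R) p.2)%:E.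
have g0 p : (0 <= g p)%E.
  rewrite lee_fin mulr_ge0// -lerBlDr sub0r.
  by have := hM p; rewrite ler_norml => /andP[].
have mg : measurable_fun setT g.
  apply/measurable_EFinP; apply: measurable_funM.
    exact: measurable_funD.
  exact: (@measurableT_comp _ _ _ _ _ _ (\1_(`[0%R, 1%R]%classic : set R) : R -> R)).
have mF := @measurable_fun_fubini_tonelli_F _ _ _ _ _ (@lebesgue_measure R) g mg g0.
have bh x : bm (fun u => h (x, u)).
  apply: (@bm_mfun _ _ M) => //.
  by apply: (measurableT_comp mh); exact: measurable_pair1.
have -> : (fun x => I01 (fun u => h (x, u))) =
    (fun x => fine (fubini_F (@lebesgue_measure R) g x) - M).
  apply/funext => x.
  have -> : fine (fubini_F lebesgue_measure g x) = I01 (fun u => h (x, u) + M).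
    rewrite /I01 /Rintegral integral_mkcond/= /fubini_F; congr fine.
    apply: eq_integral => u _; rewrite /g/= patchE indicE.
    by case: ifP => _; rewrite ?mulr1 ?mulr0.
  by rewrite I01D ?I01_cst ?addrK//; exact: bm_cst.
apply: measurable_funB => //.
exact: (measurableT_comp (@fine_measurable R setT measurableT) mF).
Qed.

Section sequence_half.
Context {R : realType}.

Lemma le_half_pow (a b C : R) : (forall k, a <= b + C / 2 ^+ k) -> a <= b.
Proof.
move=> H; apply/ler_addgt0Pr => e e0.
have : (fun k => `|C| * (2^-1) ^+ k) @ \oo --> (0 : R).
  rewrite -[X in _ --> X](mulr0 `|C|); apply: cvgM; first exact: cvg_cst.
  by apply: cvg_expr; rewrite ger0_norm ?invr_ge0// invf_lt1// ltr1n.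
move=> /cvgrPdist_lt /(_ e e0) [n _ /(_ n (leqnn n))] /=.
rewrite sub0r normrN => /ltW /(le_trans (ler_norm _)) Ce.
apply: le_trans (H n) _; rewrite lerD2l (le_trans _ Ce)// exprVn.
by rewrite ler_wpM2r ?ler_norm// invr_ge0 exprn_ge0.
Qed.

Lemma cauchy_half (a : nat -> R) (C : R) :
  (forall k, `|a k.+1 - a k| <= C / 2 ^+ k) ->
  exists l, forall k, `|l - a k| <= 2 * C / 2 ^+ k.
Proof.
move=> aC.
(* [b] decreases, [c] increases and [c] stays below [b], so the supremum of [c] is the limit and the
   rate is explicit. *)
pose b k := a k + 2 * C / 2 ^+ k; pose c k := a k - 2 * C / 2 ^+ k.
have C0 : 0 <= C.
  by have := aC 0%N; rewrite expr0 divr1; apply: le_trans.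
have P0 k : (0 : R) < 2 ^+ k by rewrite exprn_gt0.
have half k : 2 * C / 2 ^+ k.+1 = C / 2 ^+ k.
  by rewrite exprS invfM mulrA [2 * C]mulrC mulfK.
have dbl k : 2 * C / 2 ^+ k = C / 2 ^+ k + C / 2 ^+ k by lra.
have bS k n : b (k + n)%N <= b k.
  elim: n => [|n IH]; first by rewrite addn0.
  apply: le_trans IH; rewrite /b addnS half dbl.
  have := aC (k + n)%N; rewrite ler_norml => /andP[_]; lra.
have cS k n : c k <= c (k + n)%N.
  elim: n => [|n IH]; first by rewrite addn0.
  apply: le_trans IH _; rewrite /c addnS half dbl.
  have := aC (k + n)%N; rewrite ler_norml => /andP[+ _]; lra.
have cb k n : c k <= b n.
  apply: (le_trans (cS k n)); apply: (le_trans _ (bS n k)); rewrite addnC /c /b.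
  have : 0 <= 2 * C / 2 ^+ (n + k) by rewrite divr_ge0 ?mulr_ge0// ltW.
  lra.
have hs : has_sup (range c).
  split; first by exists (c 0%N); exists 0%N.
  by exists (b 0%N) => _ [k _ <-].
exists (sup (range c)) => k; rewrite ler_norml; apply/andP; split.
  have : c k <= sup (range c) by apply: sup_upper_bound => //; exists k.
  rewrite /c; lra.
have : sup (range c) <= b k.
  by apply: ge_sup; [case: hs|move=> _ [n _ <-]].
rewrite /b; lra.
Qed.

End sequence_half.

Section kakutani_function.
Context {R : realType}.

(* [f x] is the characteristic function at [s] of [Y - 2 x], where [Y] is the
   number of intervals when an interval of length [x] is split down to length
   at most [1]. *)
Definition kak_fun (s : R) (f : R -> R[i]) :=
  [/\ cmeas f, (forall x, normc (f x) <= 1),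
      (forall x, x <= 1 -> f x = cis (s * (1 - 2 * x))) &
      (forall x, 1 < x -> f x = cI (fun u => f (u * x) * f ((1 - u) * x)))].

Variable s : R.

Let e0 (x : R) : R[i] := cis (s * (1 - 2 * x)).

(** The functions sought are the measurable fixed points of [T] with modulus at most one; [phi] is
    the Picard iteration started from the formula for short intervals. *)
Let T (f : R -> R[i]) (x : R) : R[i] :=
  if x <= 1 then e0 x else cI (fun u => f (u * x) * f ((1 - u) * x)).

Let phi k := iter k T e0.

Let good f := cmeas f /\ (forall x : R, normc (f x) <= 1).

Let good_e0 : good e0.
Proof.
split; last by move=> x; rewrite normc_cis.
apply: cmeas_cis; apply: measurable_funM => //.
by apply: measurable_funB => //; exact: measurable_funM.
Qed.

Let good_T f : good f -> good (T f).
Proof.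
move=> [mf f1]; split; last first.
  move=> x; rewrite /T; case: ifP => _; first by rewrite normc_cis.
  rewrite -[leRHS]I01_cst; apply: cI_norm.
  - exact: cbm_conv.
  - exact: bm_cst.
  - move=> u _; rewrite normcM -[leRHS]mulr1 ler_pM//; exact: normc_ge0.
have mu1 : measurable_fun setT (fun p : R * R => p.2 * p.1).
  by apply: measurable_funM.
have mu2 : measurable_fun setT (fun p : R * R => (1 - p.2) * p.1).
  by apply: measurable_funM => //; apply: measurable_funB.
have ff1 a b : normc (f a * f b) <= 1.
  by rewrite normcM -[leRHS]mulr1 ler_pM//; exact: normc_ge0.
have [m1 m2] := mf; have [n1 n2] := good_e0.1.
have mle : measurable_fun setT (fun x : R => x <= 1) by exact: measurable_fun_ler.
split.
  rewrite (_ : (fun _ => _) = (fun x => if x <= 1 then Re (e0 x)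
      else I01 (fun u => Re (f (u * x) * f ((1 - u) * x))))); last first.
    by apply/funext => x; rewrite /T; case: ifP.
  apply: measurable_fun_ifT => //.
  apply: (@measurable_I01 _ (fun p => Re (f (p.2 * p.1) * f ((1 - p.2) * p.1))) 1).
    rewrite (_ : (fun _ => _) = (fun p : R * R =>
      Re (f (p.2 * p.1)) * Re (f ((1 - p.2) * p.1)) -
      Im (f (p.2 * p.1)) * Im (f ((1 - p.2) * p.1)))); last first.
      by apply/funext => p; case: (f _) (f _) => ? ? [].
    apply: measurable_funB; apply: measurable_funM.
    - exact: (measurableT_comp m1 mu1).
    - exact: (measurableT_comp m1 mu2).
    - exact: (measurableT_comp m2 mu1).
    - exact: (measurableT_comp m2 mu2).
  by move=> p; exact: le_trans (normc_Re _) (ff1 _ _).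
rewrite (_ : (fun _ => _) = (fun x => if x <= 1 then Im (e0 x)
    else I01 (fun u => Im (f (u * x) * f ((1 - u) * x))))); last first.
  by apply/funext => x; rewrite /T; case: ifP.
apply: measurable_fun_ifT => //.
apply: (@measurable_I01 _ (fun p => Im (f (p.2 * p.1) * f ((1 - p.2) * p.1))) 1).
  rewrite (_ : (fun _ => _) = (fun p : R * R =>
    Re (f (p.2 * p.1)) * Im (f ((1 - p.2) * p.1)) +
    Im (f (p.2 * p.1)) * Re (f ((1 - p.2) * p.1)))); last first.
    by apply/funext => p; case: (f _) (f _) => ? ? [].
  apply: measurable_funD; apply: measurable_funM.
  - exact: (measurableT_comp m1 mu1).
  - exact: (measurableT_comp m2 mu2).
  - exact: (measurableT_comp m2 mu1).
  - exact: (measurableT_comp m1 mu2).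
by move=> p; exact: le_trans (normc_Im _) (ff1 _ _).
Qed.

Let good_phi k : good (phi k).
Proof. by elim: k => // k IH; exact: good_T. Qed.

(** Since [f] and [g] are bounded by one, the difference of the products is at most the sum of the
    two differences. The weight [x ^ 3] contracts because [u ^ 3 + (1 - u) ^ 3] has mean [1 / 2]; a
    linear weight would only be preserved. *)
Let T_contract f g (K : R) : good f -> good g ->
  0 <= K -> (forall x : R, 0 <= x -> normc (f x - g x) <= K * x ^+ 3) ->
  forall x, 1 < x ->
  normc (cI (fun u => f (u * x) * f ((1 - u) * x)) -
         cI (fun u => g (u * x) * g ((1 - u) * x))) <= K / 2 * x ^+ 3.
Proof.
move=> [mf f1] [mg g1] K0 fgK x x1.
have x0 : 0 <= x by rewrite ltW// (lt_trans _ x1).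
have b1 := cbm_conv x mf f1 mf f1; have b2 := cbm_conv x mg g1 mg g1.
rewrite -cIB//.
have -> : K / 2 * x ^+ 3 =
    I01 (fun u => K * x ^+ 3 * u ^+ 3 + K * x ^+ 3 * (1 - u) ^+ 3).
  rewrite I01D; first rewrite !I01Zl ?I01_pow ?I01_onem_pow.
  - by field.
  - exact: (bmX 3 bm_onem).
  - exact: (bmX 3 bm_id).
  - by apply: bmM; [exact: bm_cst|exact: (bmX 3 bm_id)].
  - by apply: bmM; [exact: bm_cst|exact: (bmX 3 bm_onem)].
apply: cI_norm; first exact: cbmB.
  apply: bmD; apply: bmM; first exact: bm_cst.
  - exact: (bmX 3 bm_id).
  - exact: bm_cst.
  - exact: (bmX 3 bm_onem).
move=> u /andP[u0 u1]; apply: le_trans (normc_mulB _ _ _ _) _.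
apply: lerD.
  have := fgK (u * x) (mulr_ge0 u0 x0); rewrite exprMn mulrA mulrAC.
  apply: le_trans; rewrite -[leRHS]mulr1 ler_wpM2l//; exact: normc_ge0.
have u1' : 0 <= 1 - u by rewrite subr_ge0.
have := fgK ((1 - u) * x) (mulr_ge0 u1' x0); rewrite exprMn mulrA mulrAC.
apply: le_trans; rewrite -[leRHS]mul1r ler_wpM2r//; exact: normc_ge0.
Qed.

Let phi_diff k x : 0 <= x -> normc (phi k.+1 x - phi k x) <= 2 / 2 ^+ k * x ^+ 3.
Proof.
elim: k x => [|k IH] x x0.
  rewrite expr0 divr1 /phi/= {1}/T; case: ifPn => [_|].
    by rewrite subrr normc0 mulr_ge0// exprn_ge0.
  rewrite -ltNge => x1; apply: le_trans (normcD _ _) _; rewrite normc_opp.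
  have h1 : normc (cI (fun u => e0 (u * x) * e0 ((1 - u) * x))) <= 1.
    by have [_ /(_ x)] := good_T good_e0; rewrite /T (lt_geF x1).
  have h2 := good_e0.2 x.
  apply: (@le_trans _ _ (1 + 1)); first exact: lerD.
  by rewrite ler_peMr// exprn_ege1// ltW.
have pE j : phi j.+1 x = if x <= 1 then e0 x
    else cI (fun u => phi j (u * x) * phi j ((1 - u) * x)) by [].
rewrite (pE k.+1) (pE k); case: ifPn => [_|].
  by rewrite subrr normc0 mulr_ge0 ?exprn_ge0// divr_ge0// exprn_ge0.
rewrite -ltNge => x1.
have -> : 2 / 2 ^+ k.+1 = (2 / 2 ^+ k) / 2 :> R.
  by rewrite exprS invfM; ring.
by apply: (T_contract (good_phi k.+1) (good_phi k)) => //; rewrite divr_ge0// exprn_ge0.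
Qed.

Lemma kak_fun_exists : exists f, kak_fun s f.
Proof.
have ph x : 0 <= x -> forall k, normc (phi k.+1 x - phi k x) <= 2 * x ^+ 3 / 2 ^+ k.
  by move=> x0 k; have := phi_diff k x0; rewrite mulrAC.
have phn x : x <= 1 -> forall k, phi k x = e0 x.
  by move=> x1 [//|k]; rewrite /phi /= /T x1.
(* All iterates coincide at negative arguments, so the weight may vanish there; this gives one bound
   valid on the whole line. *)
pose w (x : R) := Num.max 0 x ^+ 3.
have w0 x : 0 <= w x by rewrite exprn_ge0// le_max lexx.
have phw x k : normc (phi k.+1 x - phi k x) <= 2 * w x / 2 ^+ k.
  have [x0|x0] := leP 0 x; first by rewrite /w max_r// ph.
  rewrite !phn ?(le_trans (ltW x0))// subrr normc0.
  by rewrite divr_ge0 ?exprn_ge0// mulr_ge0.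
have /choice[l1 Hl1] : forall x, exists l, forall k,
    `|l - Re (phi k x)| <= 2 * (2 * w x) / 2 ^+ k.
  move=> x; apply: cauchy_half => k; apply: le_trans (phw x k).
  apply: le_trans (normc_Re _); rewrite le_eqVlt; apply/orP; left; apply/eqP.
  by case: (phi k.+1 x) (phi k x) => ? ? [].
have /choice[l2 Hl2] : forall x, exists l, forall k,
    `|l - Im (phi k x)| <= 2 * (2 * w x) / 2 ^+ k.
  move=> x; apply: cauchy_half => k; apply: le_trans (phw x k).
  apply: le_trans (normc_Im _); rewrite le_eqVlt; apply/orP; left; apply/eqP.
  by case: (phi k.+1 x) (phi k x) => ? ? [].
pose f x : R[i] := (l1 x +i* l2 x)%C.
have fphi x k : normc (f x - phi k x) <= 8 * w x / 2 ^+ k.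
  have := Hl1 x k; have := Hl2 x k; rewrite /f; case: (phi k x) => a b /= h2 h1.
  apply: le_trans (normc_leD _ _) _.
  have -> : 8 * w x / 2 ^+ k = 2 * (2 * w x) / 2 ^+ k + 2 * (2 * w x) / 2 ^+ k.
    by rewrite -mulrDl; congr (_ / _); ring.
  exact: lerD.
have cvgl (l : R -> R) (P : R[i] -> R) :
    (forall x k, `|l x - P (phi k x)| <= 2 * (2 * w x) / 2 ^+ k) ->
    forall x, (fun k => P (phi k x)) @ \oo --> l x.
  move=> H x; apply/cvgrPdist_le => e e0'.
  have : (fun k => `|2 * (2 * w x)| * (2^-1) ^+ k) @ \oo --> (0 : R).
    rewrite -[X in _ --> X](mulr0 `|2 * (2 * w x)|); apply: cvgM; first exact: cvg_cst.
    by apply: cvg_expr; rewrite ger0_norm ?invr_ge0// invf_lt1// ltr1n.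
  move=> /cvgrPdist_lt /(_ e e0') [n _ Hn]; exists n => // k /= nk.
  have := Hn k nk; rewrite /= sub0r normrN => /ltW /(le_trans (ler_norm _)).
  apply: le_trans; apply: le_trans (H x k) _; rewrite exprVn.
  by rewrite ler_wpM2r ?ler_norm// invr_ge0 exprn_ge0.
have mf : cmeas f.
  split => /=.
    apply: (@measurable_fun_cvg _ _ _ _ (fun k x => Re (phi k x))).
      by move=> k; have [[]] := good_phi k.
    by move=> x _; apply: cvgl.
  apply: (@measurable_fun_cvg _ _ _ _ (fun k x => Im (phi k x))).
    by move=> k; have [[]] := good_phi k.
  by move=> x _; apply: cvgl.
have f1 x : normc (f x) <= 1.
  apply: (@le_half_pow _ _ _ (8 * w x)) => k.
  rewrite -(subrK (phi k x) (f x)); apply: le_trans (normcD _ _) _.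
  by rewrite addrC lerD// (good_phi k).2.
exists f; split => //.
  move=> x x1; apply/eqP; rewrite -subr_eq0; apply/eqP/eq0_normc/eqP.
  rewrite eq_le normc_ge0 andbT; apply: (@le_half_pow _ _ _ (8 * w x)) => k.
  by rewrite add0r -[cis _]/(e0 x) -(phn x x1 k).
move=> x x1; apply/eqP; rewrite -subr_eq0; apply/eqP/eq0_normc/eqP.
rewrite eq_le normc_ge0 andbT.
have x0 : 0 <= x by rewrite ltW// (lt_trans _ x1).
(* The limit is compared with [phi k.+1 x], which is by construction the integral built from
   [phi k], and then the contraction is applied to [f] and [phi k]. *)
apply: (@le_half_pow _ _ _ (8 * w x + 8 * x ^+ 3)) => k; rewrite add0r.
apply: le_trans (normc_tri _ (phi k.+1 x) _) _; rewrite mulrDl; apply: lerD.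
  apply: le_trans (fphi x k.+1) _; apply: ler_wpM2l; first by rewrite mulr_ge0.
  have P0 : (0 : R) < 2 ^+ k by rewrite exprn_gt0.
  rewrite exprS lef_pV2 ?posrE ?mulr_gt0//; lra.
rewrite [phi k.+1]/(T (phi k)) -/(phi k) /T (lt_geF x1) normcB.
have K0 : 0 <= 8 / 2 ^+ k :> R by rewrite divr_ge0// exprn_ge0.
have fK y : 0 <= y -> normc (f y - phi k y) <= 8 / 2 ^+ k * y ^+ 3.
  by move=> y0; have := fphi y k; rewrite /w max_r// mulrAC.
apply: le_trans (T_contract (conj mf f1) (good_phi k) K0 fK x1) _.
have : 0 <= 8 / 2 ^+ k * x ^+ 3 by rewrite mulr_ge0// exprn_ge0.
lra.
Qed.

End kakutani_function.

(** * Elementary bounds and Taylor coefficients *)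

Section elementary.
Context {R : realType}.

(** This starts the alternating Taylor bounds: in each one the derivative of the difference is
    nonnegative by the preceding bound. *)
Lemma sin_le_id (x : R) : 0 <= x -> sin x <= x.
Proof.
move=> x0; rewrite -subr_ge0.
have -> : 0 = 0 - sin 0 :> R by rewrite sin0 subr0.
apply: (@is_derive_le _ (fun y => y - sin y) (fun y => 1 - cos y)) => // y _.
Qed.

Lemma cos_ge (x : R) : 0 <= x -> 1 - x ^+ 2 / 2 <= cos x.
Proof.
move=> x0; rewrite -subr_ge0.
have -> : 0 = cos 0 - (1 - 0 ^+ 2 / 2) :> R.
  by rewrite cos0 expr0n/= mul0r subr0 subrr.
apply: (@is_derive_le _ (fun y => cos y - (1 - y ^+ 2 / 2)) (fun y => y - sin y)) => //.
- by move=> y _; apply: is_derive_eq; rewrite /GRing.scale/=; lra.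
- by move=> y /andP[y0 _]; rewrite subr_ge0 sin_le_id.
Qed.

Lemma sin_ge (x : R) : 0 <= x -> x - x ^+ 3 / 6 <= sin x.
Proof.
move=> x0; rewrite -subr_ge0.
have -> : 0 = sin 0 - (0 - 0 ^+ 3 / 6) :> R.
  by rewrite sin0 expr0n/= mul0r !subr0.
apply: (@is_derive_le _ (fun y => sin y - (y - y ^+ 3 / 6))
   (fun y => cos y - (1 - y ^+ 2 / 2))) => //.
- by move=> y _; apply: is_derive_eq; rewrite /GRing.scale/=; lra.
- by move=> y /andP[y0 _]; rewrite subr_ge0 cos_ge.
Qed.

Lemma cos_le (x : R) : 0 <= x -> cos x <= 1 - x ^+ 2 / 2 + x ^+ 4 / 24.
Proof.
move=> x0; rewrite -subr_ge0.
have -> : 0 = (1 - 0 ^+ 2 / 2 + 0 ^+ 4 / 24) - cos 0 :> R.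
  by rewrite cos0 !expr0n/= !mul0r subr0 addr0 subrr.
apply: (@is_derive_le _ (fun y => (1 - y ^+ 2 / 2 + y ^+ 4 / 24) - cos y)
   (fun y => sin y - (y - y ^+ 3 / 6))) => //.
- by move=> y _; apply: is_derive_eq; rewrite /GRing.scale/=; lra.
- by move=> y /andP[y0 _]; rewrite subr_ge0 sin_ge.
Qed.

Lemma cos_approx (x : R) : `|x| <= 1 -> `|cos x - (1 - x ^+ 2 / 2)| <= `|x| ^+ 3.
Proof.
wlog x0 : x / 0 <= x.
  move=> H; have [x0|x0] := leP 0 x; first exact: H.
  by have := H (- x); rewrite cosN sqrrN normrN; apply; lra.
rewrite (ger0_norm x0) => x1.
rewrite ger0_norm ?subr_ge0 ?cos_ge//.
have := cos_le x0; have : x ^+ 4 <= x ^+ 3 by rewrite exprS ler_piMl// exprn_ge0.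
have : 0 <= x ^+ 3 by rewrite exprn_ge0.
lra.
Qed.

Lemma sin_approx (x : R) : `|sin x - x| <= `|x| ^+ 3.
Proof.
wlog x0 : x / 0 <= x.
  move=> H; have [x0|x0] := leP 0 x; first exact: H.
  by have := H (- x); rewrite sinN normrN -opprD normrN; apply; lra.
rewrite (ger0_norm x0) ler0_norm ?subr_le0 ?sin_le_id//.
have := sin_ge x0.
have : 0 <= x ^+ 3 by rewrite exprn_ge0.
lra.
Qed.

Lemma expR_le_inv (y : R) : y < 1 -> expR y <= (1 - y)^-1.
Proof.
move=> y1; rewrite -[y in expR y]opprK expRN lef_pV2 ?posrE ?expR_gt0 ?subr_gt0//.
exact: expR_ge1Dx.
Qed.

Lemma expR_le1D2 (y : R) : 0 <= y <= 2^-1 -> expR y <= 1 + 2 * y.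
Proof.
move=> /andP[y0 y1]; apply: le_trans (expR_le_inv _) _; first lra.
rewrite -[leLHS]mul1r ler_pdivrMr; last lra.
nra.
Qed.

Lemma expRN_le (y : R) : 0 <= y <= 1 -> expR (- y) <= 1 - y / 2.
Proof.
move=> /andP[y0 y1]; apply: le_trans (expR_le_inv _) _; first lra.
rewrite opprK -[leLHS]mul1r ler_pdivrMr; last lra.
nra.
Qed.

Lemma expR_approx2 (y : R) : 0 <= y <= 2^-1 -> `|expR y - (1 + y)| <= 2 * y ^+ 2.
Proof.
move=> /andP[y0 y1]; rewrite ger0_norm ?subr_ge0 ?expR_ge1Dx//.
have : expR y <= (1 - y)^-1 by apply: expR_le_inv; lra.
have -> : (1 - y)^-1 = 1 + y + y ^+ 2 / (1 - y) by field; lra.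
suff : y ^+ 2 / (1 - y) <= 2 * y ^+ 2 by lra.
rewrite ler_pdivrMr; last lra.
have := sqr_ge0 y; nra.
Qed.

Lemma expRN_approx2 (y : R) : 0 <= y -> `|expR (- y) - (1 - y)| <= y ^+ 2.
Proof.
move=> y0; rewrite ger0_norm ?subr_ge0 ?expR_ge1Dx//.
have : expR (- y) <= (1 + y)^-1 by rewrite -{2}[y]opprK expR_le_inv//; lra.
have -> : (1 + y)^-1 = 1 - y + y ^+ 2 / (1 + y) by field; lra.
suff : y ^+ 2 / (1 + y) <= y ^+ 2 by lra.
rewrite ler_pdivrMr; last lra.
have := sqr_ge0 y; nra.
Qed.

Definition kc : R := 8 * ln 2 - 5.

Lemma ln2_gt : 5 / 8 < ln 2 :> R.
Proof.
rewrite -ltr_expR lnK ?posrE//.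
(* Splitting the exponent in four makes the crude bound [1 / (1 - y)] sharp enough:
   [(32 / 27) ^ 4 < 2]. *)
have -> : 5 / 8 = 5 / 32 * 4%:R :> R by field.
rewrite expRM_natr.
have h : expR (5 / 32 : R) <= 32 / 27.
  have := @expR_le_inv (5 / 32); have -> : (1 - 5 / 32)^-1 = 32 / 27 :> R by field.
  by apply; lra.
apply: (@le_lt_trans _ _ ((32 / 27) ^+ 4)); last lra.
by rewrite lerXn2r ?nnegrE ?expR_ge0//; lra.
Qed.

Lemma kc_gt0 : 0 < kc.
Proof. have := ln2_gt; rewrite /kc; lra. Qed.

Lemma kc_le1 : kc <= 1.
Proof.
suff : ln 2 <= 3 / 4 :> R by rewrite /kc; lra.
rewrite -ler_expR lnK ?posrE//.
(* Likewise eight factors suffice for the tangent bound: [(1 + 3 / 32) ^ 8 > 2]. *)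
have -> : 3 / 4 = 3 / 32 * 8%:R :> R by field.
rewrite expRM_natr.
apply: (@le_trans _ _ ((1 + 3 / 32) ^+ 8)); first lra.
by rewrite lerXn2r ?nnegrE ?expR_ge0 ?expR_ge1Dx//; lra.
Qed.

End elementary.

Section taylor_coefficients.
Context {R : realType}.
Implicit Types x y : R.

(** [km] and [kv] are the first and second moments of [W] for an interval of length [x], that is,
    the coefficients in [f x = 1 + i s km x - s ^ 2 kv x / 2 + O(s ^ 3)]. *)
Definition km x : R := if x <= 1 then 1 - 2 * x else 0.

Let q x : R := 2 + 2 * x + 8 * (x * ln x) - 4 * x ^+ 2.
(** An antiderivative of [q] whose constant [2 / 3] gives [Vq 1 = 1 / 3], the integral of
    [(1 - 2 y) ^ 2] over the unit interval. Hence [Vq x] is the integral of [kv] from 0 to [x] when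
    [1 <= x <= 2]. *)
Let Vq x : R := 2 / 3 + 2 * x + 4 * (x ^+ 2 * ln x) - 4 / 3 * x ^+ 3 - x ^+ 2.

Definition kv x : R :=
  if x <= 1 then (1 - 2 * x) ^+ 2 else
  if x <= 2 then 2 + 2 * x + 8 * (x * ln x) - 4 * x ^+ 2 else kc * x.

(** For [x > 1], [kV x] is the integral of [kv] over [[0, x]] and [kM x] is the convolution of [km]
    with itself at [x]; see [I01_kv] and [I01_kmm]. *)
Definition kV x : R :=
  if x <= 2 then 2 / 3 + 2 * x + 4 * (x ^+ 2 * ln x) - 4 / 3 * x ^+ 3 - x ^+ 2
  else kc * x ^+ 2 / 2.

Definition kM x : R :=
  if x <= 2 then - (2 / 3) - x + 2 * x ^+ 2 - 2 / 3 * x ^+ 3 else 0.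

(** This is the functional equation at order [s ^ 2]: each piece contributes its second moment, and
    the cross term contributes the product of the means. For [x > 2] the cross term vanishes, which
    leaves the linear solution [c x]. *)
Lemma kv_VM x : 1 < x -> x * kv x = 2 * kV x + 2 * kM x.
Proof.
move=> x1; rewrite /kv /kV /kM lt_geF//; case: ifP => _; first by field.
by field.
Qed.

Lemma kv_ge2 x : 2 <= x -> kv x = kc * x.
Proof.
rewrite le_eqVlt => /orP[/eqP <-|x2]; rewrite /kv; last first.
  by rewrite !lt_geF// (lt_trans _ x2)// ltr1n.
by rewrite lexx lt_geF ?ltr1n// /kc; field.
Qed.

Lemma kV_ge2 x : 2 <= x -> kV x = kc * x ^+ 2 / 2.
Proof.
rewrite le_eqVlt => /orP[/eqP <-|x2]; rewrite /kV; last by rewrite lt_geF.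
by rewrite lexx /kc; field.
Qed.

Lemma kv_bound x : 0 <= x -> `|kv x| <= 38 + x.
Proof.
move=> x0; rewrite /kv; case: ifPn => [x1|]; last rewrite -ltNge => x1.
  by rewrite ger0_norm ?sqr_ge0//; nra.
case: ifPn => [x2|]; last rewrite -ltNge => x2.
  have l0 : 0 <= ln x by apply: ln_ge0; lra.
  have l1 : ln x <= 1.
    have := @le_ln1Dx R (x - 1); have -> : 1 + (x - 1) = x by ring.
    by move/(_ ltac:(lra)); lra.
  rewrite ler_norml; apply/andP; split; nra.
have := @kc_gt0 R; have := @kc_le1 R => c1 c0.
rewrite ger0_norm; nra.
Qed.

Lemma km_bound x : 0 <= x -> `|km x| <= 1.
Proof.
move=> x0; rewrite /km; case: ifP => [x1|_]; last by rewrite normr0.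
rewrite ler_norml; apply/andP; split; lra.
Qed.

Lemma measurable_km : measurable_fun setT km.
Proof.
apply: measurable_fun_ifT => //.
  exact: measurable_fun_ler.
by apply: measurable_funB => //; exact: measurable_funM.
Qed.

Lemma measurable_kv : measurable_fun setT kv.
Proof.
apply: measurable_fun_ifT; first exact: measurable_fun_ler.
  by apply: measurable_funX; apply: measurable_funB => //; exact: measurable_funM.
apply: measurable_fun_ifT; first exact: measurable_fun_ler.
  apply: measurable_funB.
    apply: measurable_funD.
      by apply: measurable_funD => //; exact: measurable_funM.
    by apply: measurable_funM => //; apply: measurable_funM => //; exact: measurable_ln.
  by apply: measurable_funM => //; exact: measurable_funX.
exact: measurable_funM.
Qed.

Lemma bm_km x : 0 <= x -> bm (fun u => km (u * x)).
Proof.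
move=> x0; apply: (@bm_mfun _ _ 1).
  by apply: (measurableT_comp measurable_km); exact: measurable_funM.
by move=> u /andP[u0 _]; apply: km_bound; exact: mulr_ge0.
Qed.

Lemma bm_kv x : 0 <= x -> bm (fun u => kv (u * x)).
Proof.
move=> x0; apply: (@bm_mfun _ _ (38 + x)).
  by apply: (measurableT_comp measurable_kv); exact: measurable_funM.
move=> u /andP[u0 u1]; apply: le_trans (kv_bound (mulr_ge0 u0 x0)) _.
by rewrite lerD2l ler_piMl.
Qed.

Lemma I01_km x : 1 < x -> I01 (fun u => km (u * x)) = 0.
Proof.
move=> x1; have x0 : 0 < x by lra.
have H1 (u : R) : 0 <= u <= x^-1 ->
    is_derive u 1 (fun u : R => u - u ^+ 2 * x) (1 - 2 * (u * x)).
  by move=> _; apply: is_derive_eq; rewrite /GRing.scale/=; ring.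
have H2 (u : R) : 0 <= u <= x^-1 ->
    {for u, continuous (fun u : R => 1 - 2 * (u * x))}.
  by move=> _; apply: is_derive_continuous.
transitivity (I01 (fun u => if 0 <= u <= x^-1 then 1 - 2 * (u * x) else 0)).
  apply: I01_eq => u /andP[u0 _]; rewrite /km u0/=.
  by rewrite -[x^-1]mul1r ler_pdivlMr.
rewrite (I01_cc_FTC (lexx 0) _ _ H1 H2); first by field; lra.
  by rewrite invr_ge0 ltW.
by rewrite invf_le1// ltW.
Qed.

Let derive_Vq y : 0 < y -> is_derive y 1 Vq (q y).
Proof.
move=> y0; have ? := is_derive1_ln y0.
apply: is_derive_eq; rewrite /q /GRing.scale/=; field; lra.
Qed.

Let cont_q y : 0 < y -> {for y, continuous q}.
Proof. by move=> y0; have ? := is_derive1_ln y0; apply: is_derive_continuous. Qed.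

Lemma I01_kv x : 1 < x -> I01 (fun u => kv (u * x)) = kV x / x.
Proof.
move=> x1; have x0 : 0 < x by lra.
have xV0 : 0 < x^-1 by rewrite invr_gt0.
have xV1 : x^-1 <= 1 by rewrite invf_le1// ltW.
(* [kv (u * x)] changes formula at [u = 1 / x] and [u = 2 / x]; the minimum covers [x <= 2], where
   the linear branch is not reached. *)
pose B := Num.min 1 (2 / x).
have B1 : B <= 1 by rewrite ge_min lexx.
have BV : x^-1 <= B.
  by rewrite le_min xV1/= ler_pdivlMr// mulVf ?gt_eqF// ler1n.
have B0 : 0 < B by apply: lt_le_trans BV.
have bv := bm_kv (ltW x0).
have mle (k : R) : measurable_fun setT (fun u : R => u <= k) by exact: measurable_fun_ler.
have mlt (k : R) : measurable_fun setT (fun u : R => k < u) by exact: measurable_fun_ltr.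
have mlc (k l : R) : measurable_fun setT (fun u : R => k <= u <= l).
  by apply: measurable_and => //; exact: measurable_fun_ler.
have mll (k l : R) : measurable_fun setT (fun u : R => k < u <= l) by exact: measurable_and.
pose p1 u := if 0 <= u <= x^-1 then kv (u * x) else 0.
pose p2 u := if x^-1 < u <= B then kv (u * x) else 0.
pose p3 u := if B < u <= 1 then kv (u * x) else 0.
have b1 : bm p1 by apply: bm_if => //; exact: bm_cst.
have b2 : bm p2 by apply: bm_if => //; exact: bm_cst.
have b3 : bm p3 by apply: bm_if => //; exact: bm_cst.
have -> : I01 (fun u => kv (u * x)) = I01 p1 + I01 p2 + I01 p3.
  rewrite -!I01D//; last exact: bmD.
  apply: I01_eq => u /andP[u0 u1]; rewrite /p1 /p2 /p3 u0 u1/= andbT.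
  have [ux|xu] := leP u x^-1.
    by rewrite (le_gtF (le_trans ux BV)) !addr0.
  have [uB|Bu] := leP u B; first by rewrite add0r addr0.
  by rewrite !add0r.
have e1 : I01 p1 = (3 * x)^-1.
  have H1 (u : R) : 0 <= u <= x^-1 ->
    is_derive u 1 (fun u : R => u - 2 * x * u ^+ 2 + 4 / 3 * x ^+ 2 * u ^+ 3)
      ((1 - 2 * (u * x)) ^+ 2).
    by move=> _; apply: is_derive_eq; rewrite /GRing.scale/=; field.
  have H2 (u : R) : 0 <= u <= x^-1 ->
      {for u, continuous (fun u : R => (1 - 2 * (u * x)) ^+ 2)}.
    by move=> _; apply: is_derive_continuous.
  transitivity (I01 (fun u => if 0 <= u <= x^-1 then (1 - 2 * (u * x)) ^+ 2 else 0)).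
    apply: I01_eq => u _; rewrite /p1; case: ifP => // /andP[u0 ux].
    by rewrite /kv -ler_pdivlMr// mul1r ux.
  by rewrite (I01_cc_FTC (lexx 0) (ltW xV0) xV1 H1 H2); field; lra.
have e2 : I01 p2 = Vq (B * x) / x - (3 * x)^-1.
  have H1 (u : R) : x^-1 <= u <= B -> is_derive u 1 (fun u : R => Vq (u * x) / x) (q (u * x)).
    move=> /andP[ux uB]; have ux0 : 0 < u * x by rewrite mulr_gt0// (lt_le_trans _ ux).
    have d1 := derive_Vq ux0.
    have d2 : is_derive u 1 (fun u => u * x) x.
      by apply: is_derive_eq; rewrite /GRing.scale/=; ring.
    have d3 := @is_derive1_comp R Vq (fun u => u * x) u _ _ d1 d2.
    rewrite (_ : (fun _ => _) = (Vq \o (fun u => u * x)) * cst x^-1)//.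
    by apply: is_derive_eq; rewrite /GRing.scale/=; field; lra.
  have H2 (u : R) : x^-1 <= u <= B -> {for u, continuous (fun u : R => q (u * x))}.
    move=> /andP[ux uB]; have ux0 : 0 < u * x by rewrite mulr_gt0// (lt_le_trans _ ux).
    have cm : {for u, continuous (fun u : R => u * x)} by apply: is_derive_continuous.
    exact: (@continuous_comp R R R (fun u : R => u * x) q u cm (cont_q ux0)).
  transitivity (I01 (fun u => if x^-1 < u <= B then q (u * x) else 0)).
    apply: I01_eq => u _; rewrite /p2; case: ifP => // /andP[ux uB].
    rewrite /kv; have -> : (u * x <= 1) = false.
      by apply: lt_geF; rewrite -ltr_pdivrMr// mul1r.
    have -> // : u * x <= 2.
    by rewrite -ler_pdivlMr// (le_trans uB)// ge_min lexx orbT.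
  rewrite (I01_indic_FTC (ltW xV0) BV B1 H1 H2) mulVf ?gt_eqF//; congr (_ - _).
  by rewrite /Vq ln1; field; lra.
have e3 : I01 p3 = kc * x / 2 - kc * x * B ^+ 2 / 2.
  have H1 (u : R) : B <= u <= 1 -> is_derive u 1 (fun u : R => kc * x * u ^+ 2 / 2) (kc * (u * x)).
    by move=> _; apply: is_derive_eq; rewrite /GRing.scale/=; field.
  have H2 (u : R) : B <= u <= 1 -> {for u, continuous (fun u : R => kc * (u * x))}.
    by move=> _; apply: is_derive_continuous.
  transitivity (I01 (fun u => if B < u <= 1 then kc * (u * x) else 0)).
    apply: I01_eq => u _; rewrite /p3; case: ifP => // /andP[].
    rewrite gt_min => /orP[u1'|ux] u1.
      by have := lt_le_trans u1' u1; rewrite ltxx.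
    by rewrite kv_ge2// -ler_pdivrMr// ltW.
  by rewrite (I01_indic_FTC (ltW B0) B1 (lexx 1) H1 H2) expr1n mulr1.
rewrite e1 e2 e3; have [x2|x2] := leP x 2.
  have -> : B = 1 by rewrite /B min_l// ler_pdivlMr// mul1r.
  by rewrite /kV x2 mul1r expr1n /Vq; field; lra.
have -> : B = 2 / x by rewrite /B min_r// ler_pdivrMr// mul1r ltW.
rewrite divfK ?gt_eqF// (kV_ge2 (ltW x2)).
have -> : Vq 2 = 2 * kc by rewrite /Vq /kc; field.
by field; lra.
Qed.

Lemma I01_kmm x : 1 < x -> I01 (fun u => km (u * x) * km ((1 - u) * x)) = kM x / x.
Proof.
move=> x1; have x0 : 0 < x by lra.
(* When [x > 2] the two pieces cannot both have length at most 1, so one factor is zero. Otherwise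
   both factors are nonzero branches exactly for [1 - 1 / x <= u <= 1 / x]. *)
rewrite /kM; have [x2|x2] := leP x 2; last first.
  rewrite mul0r -[RHS](I01_cst 0); apply: I01_eq => u _.
  rewrite /km; case: ifP => // h1; last by rewrite mul0r.
  by case: ifP => h2; rewrite ?mulr0//; nra.
have xV0 : 0 < x^-1 by rewrite invr_gt0.
have xV1 : x^-1 <= 1 by rewrite invf_le1// ltW.
have a0 : 0 <= 1 - x^-1 by rewrite subr_ge0.
have ab : 1 - x^-1 <= x^-1.
  suff : 2^-1 <= x^-1 by lra.
  by rewrite lef_pV2 ?posrE.
have H1 (u : R) : 1 - x^-1 <= u <= x^-1 ->
    is_derive u 1 (fun u : R => (1 - 2 * x) * u + 2 * x ^+ 2 * u ^+ 2 - 4 / 3 * x ^+ 2 * u ^+ 3)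
      ((1 - 2 * (u * x)) * (1 - 2 * ((1 - u) * x))).
  by move=> _; apply: is_derive_eq; rewrite /GRing.scale/=; field.
have H2 (u : R) : 1 - x^-1 <= u <= x^-1 ->
    {for u, continuous (fun u : R => (1 - 2 * (u * x)) * (1 - 2 * ((1 - u) * x)))}.
  by move=> _; apply: is_derive_continuous.
transitivity (I01 (fun u => if 1 - x^-1 <= u <= x^-1
    then (1 - 2 * (u * x)) * (1 - 2 * ((1 - u) * x)) else 0)).
  apply: I01_eq => u _; rewrite /km -!ler_pdivlMr// !mul1r.
  have -> : (1 - x^-1 <= u) = (1 - u <= x^-1) by apply/idP/idP; lra.
  by case: (u <= _); case: (1 - u <= _); rewrite ?mulr0 ?mul0r.
by rewrite (I01_cc_FTC a0 ab xV1 H1 H2); field; lra.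
Qed.

End taylor_coefficients.

(** * Expansion and decay *)

Section expansion.
Context {R : realType}.
Implicit Types s x y : R.

Local Notation c := (@kc R).

Lemma normc_le (a b r : R) : 0 <= r -> a ^+ 2 + b ^+ 2 <= r ^+ 2 ->
  normc (a +i* b)%C <= r.
Proof.
move=> r0 h; rewrite /= -[leRHS](ger0_norm r0) -sqrtr_sqr.
by rewrite ler_sqrt ?sqr_ge0.
Qed.

(** The Taylor polynomial of [f x] of degree two in [s]. *)
Definition ka s x : R[i] := ((1 - s ^+ 2 * kv x / 2) +i* (s * km x))%C.

Lemma cbm_ka s x : 0 <= x -> cbm (fun u => ka s (u * x)).
Proof.
move=> x0; split => /=.
  apply: bmB; first exact: bm_cst.
  by apply: bmM; [apply: bmM; [exact: bm_cst|exact: bm_kv]|exact: bm_cst].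
by apply: bmM; [exact: bm_cst|exact: bm_km].
Qed.

Lemma cbm_sym (F : R -> R[i]) : cbm F -> cbm (fun u => F (1 - u)).
Proof. by move=> [F1 F2]; split; [exact: (bm_sym F1)|exact: (bm_sym F2)]. Qed.

(** The moment identities cancel all terms up to order [s ^ 2], so only the cubic and quartic terms
    of the product of two Taylor polynomials remain. *)
Lemma ka_residual : exists2 K : R, 0 < K & forall s x, 0 < s <= 1 -> 1 < x <= 40 ->
  normc (ka s x - cI (fun u => ka s (u * x) * ka s ((1 - u) * x))) <= K * s ^+ 3.
Proof.
(* [78 = 38 + 40] bounds [kv] on [[0, 40]] by [kv_bound]. *)
pose B : R := 78; have BE : B = 78 by []; clearbody B.
have B0 : 0 < B by rewrite BE.
exists (B * B + B); first by rewrite addr_gt0// mulr_gt0.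
move=> s x /andP[s0 s1] /andP[x1 x40]; have x0 : 0 <= x by lra.
(* [L] is the product truncated at degree two in [s]; its integral is exactly [ka s x]. *)
pose L u : R[i] := ((1 - s ^+ 2 / 2 * kv (u * x) - s ^+ 2 / 2 * kv ((1 - u) * x)
    - s ^+ 2 * (km (u * x) * km ((1 - u) * x)))
  +i* (s * km (u * x) + s * km ((1 - u) * x)))%C.
have bv := bm_kv x0; have bv' := bm_sym bv; have bm_ := bm_km x0; have bm' := bm_sym bm_.
have bmm := bmM bm_ bm'.
have Z (k : R) h : bm h -> bm (fun u => k * h u).
  by move=> bh; apply: bmM => //; exact: bm_cst.
have bL : cbm L.
  split => /=.
    by apply: bmB; [apply: bmB; [apply: bmB; [exact: bm_cst|exact: Z]|exact: Z]|exact: Z].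
  by apply: bmD; exact: Z.
have ba : cbm (fun u => ka s (u * x) * ka s ((1 - u) * x)).
  by apply: cbmM; [exact: cbm_ka|exact: (cbm_sym (cbm_ka s x0))].
have -> : ka s x = cI L.
  rewrite /cI /ka /L/=; congr Complex.
    rewrite I01B; [|by apply: bmB; [apply: bmB; [exact: bm_cst|exact: Z]|exact: Z]|exact: Z].
    rewrite I01B; [|by apply: bmB; [exact: bm_cst|exact: Z]|exact: Z].
    rewrite I01B; [|exact: bm_cst|exact: Z].
    rewrite I01_cst !I01Zl// (I01_sym bv) I01_kv// I01_kmm//.
    have -> : kv x = (2 * kV x + 2 * kM x) / x by rewrite -kv_VM// mulrC mulKf// gt_eqF//; lra.
    by field; lra.
  rewrite I01D; [|exact: Z|exact: Z].
  by rewrite !I01Zl// (I01_sym bm_) I01_km// !mulr0 addr0 /km lt_geF// mulr0.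
rewrite -cIB// -[leRHS]I01_cst; apply: cI_norm; [exact: cbmB|exact: bm_cst|].
move=> u /andP[u0 u1].
have y0 : 0 <= u * x by exact: mulr_ge0.
have y0' : 0 <= (1 - u) * x by apply: mulr_ge0 => //; lra.
have yx : u * x <= 40 by nra.
have yx' : (1 - u) * x <= 40 by nra.
have v1 : `|kv (u * x)| <= B by rewrite BE; have := kv_bound y0; lra.
have v2 : `|kv ((1 - u) * x)| <= B by rewrite BE; have := kv_bound y0'; lra.
have n1 := km_bound y0; have n2 := km_bound y0'.
rewrite /L /ka; move: (kv (u * x)) (kv ((1 - u) * x)) (km (u * x)) (km ((1 - u) * x)) v1 v2 n1 n2.
move=> a b p q a1 b1 p1 q1 /=.
rewrite [leLHS](_ : _ = normc ((- (s ^+ 4 / 4 * (a * b))) +i* (s ^+ 3 / 2 * (a * q + b * p)))%C).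
  apply: le_trans (normc_leD _ _) _.
  rewrite normrN (normrM (s ^+ 4 / 4)) (normrM (s ^+ 3 / 2)) (normrM a b).
  have s3 : 0 <= s ^+ 3 by rewrite exprn_ge0// ltW.
  have s4 : s ^+ 4 <= s ^+ 3 by rewrite exprS ler_piMl.
  have s40 : 0 <= s ^+ 4 by rewrite exprn_ge0// ltW.
  rewrite (ger0_norm (_ : 0 <= s ^+ 4 / 4)) ?divr_ge0//.
  rewrite (ger0_norm (_ : 0 <= s ^+ 3 / 2)) ?divr_ge0//.
  have ab : `|a| * `|b| <= B * B by exact: ler_pM.
  have aq : `|a * q + b * p| <= B + B.
    apply: le_trans (ler_normD _ _) _; rewrite !normrM.
    by apply: lerD; rewrite -[leRHS]mulr1 ler_pM.
  clear -ab aq s3 s4 s40 B0.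
  have : s ^+ 4 / 4 * (`|a| * `|b|) <= s ^+ 3 / 4 * (B * B).
    have e1 : s ^+ 4 / 4 <= s ^+ 3 / 4 by lra.
    apply: (le_trans (ler_wpM2r _ e1)); first by rewrite mulr_ge0.
    by apply: ler_wpM2l => //; rewrite divr_ge0.
  have : s ^+ 3 / 2 * `|a * q + b * p| <= s ^+ 3 / 2 * (B + B).
    by apply: ler_wpM2l => //; lra.
  have : 0 <= s ^+ 3 * (B * B) by rewrite mulr_ge0// ltW// mulr_gt0.
  lra.
by congr (Num.sqrt (_ ^+ 2 + _ ^+ 2)); field.
Qed.

Lemma kak_expansion_le1 s f x : 0 < s <= 1 -> kak_fun s f -> 0 <= x <= 1 ->
  normc (f x - ka s x) <= 2 * s ^+ 3.
Proof.
move=> /andP[s0 s1] [_ _ fe _] /andP[x0 x1].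
rewrite fe// /ka /km /kv x1 /cis /=; set t := s * (1 - 2 * x).
have ts : `|t| <= s.
  rewrite /t normrM (gtr0_norm s0) ler_piMr ?(ltW s0)// ler_norml; apply/andP; split; lra.
have t1 : `|t| <= 1 by lra.
have t3 : `|t| ^+ 3 <= s ^+ 3 by rewrite lerXn2r ?nnegrE// ltW.
apply: le_trans (normc_leD _ _) _.
have -> : s ^+ 2 * (1 - 2 * x) ^+ 2 / 2 = t ^+ 2 / 2 by rewrite /t exprMn.
have := cos_approx t1; have := sin_approx t; lra.
Qed.

Lemma normc_ka s x : 0 < s <= 20^-1 -> 0 <= x <= 40 -> normc (ka s x) <= 2.
Proof.
move=> /andP[s0 s1] /andP[x0 x1]; apply: le_trans (normc_leD _ _) _.
have := kv_bound x0; have := km_bound x0 => n1 v1.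
have s2 : s ^+ 2 <= 100^-1 by nra.
have : `|s * km x| <= 20^-1 * 1 by rewrite normrM ler_pM// gtr0_norm.
have : `|s ^+ 2 * kv x / 2| <= 100^-1 * 78 / 2.
  rewrite normrM (normrM (s ^+ 2)) [`|2^-1|]gtr0_norm// (ger0_norm (sqr_ge0 s)).
  by rewrite ler_wpM2r// ler_pM ?sqr_ge0//; lra.
have := ler_normB 1 (s ^+ 2 * kv x / 2); rewrite normr1; lra.
Qed.

Lemma cbm_kak s f x : kak_fun s f -> cbm (fun u => f (u * x)).
Proof.
move=> [mf f1 _ _]; apply: cbm_cmeas => //; apply: cmeas_comp => //.
exact: measurable_funM.
Qed.

(** The error is bootstrapped on []1, 40]] with weight [y ^ 5]. Replacing the factors one at a time
    costs 1 for [f] and 2 for [ka], and [u ^ 5 + 2 (1 - u) ^ 5] has mean [1 / 2]. The bounded range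
    of [x] turns the weight into a constant. *)
Lemma kak_expansion : exists2 K : R, 0 < K & forall s f x,
  0 < s <= 20^-1 -> kak_fun s f -> 0 <= x <= 40 ->
  normc (f x - ka s x) <= K * s ^+ 3.
Proof.
have [K1 K10 resid] := ka_residual.
(* [K1] is the residual and [6 = 2 + 2 * 2] comes from pieces of length at most 1. With
   [K1 + 6 = K / 4] these terms take a quarter of the bound, next to the half left by the weight:
   the contraction factor is [3 / 4]. *)
pose K := 4 * (K1 + 6); have KE : K1 + 6 = K / 4 by rewrite /K; field.
have K0 : 2 < K by rewrite /K; lra.
clearbody K.
have [P P1 Pb] : exists2 P : R, 1 <= P & forall x, 0 <= x <= 40 -> x ^+ 5 <= P.
  exists (40 ^+ 5); first by apply: exprn_ege1; lra.
  by move=> x /andP[x0 x40]; rewrite lerXn2r ?nnegrE//; lra.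
exists (K * P); first by apply: mulr_gt0; lra.
move=> s f x ss kf /andP[x0 x40]; have /andP[s0 s20] := ss.
have s1 : 0 < s <= 1 by apply/andP; split => //; lra.
have s3 : 0 < s ^+ 3 by rewrite exprn_gt0.
have [x1|x1] := leP x 1.
  apply: le_trans (kak_expansion_le1 s1 kf _) _; first by rewrite x0.
  apply: ler_wpM2r; first exact: ltW.
  by clear -P1 K0; nra.
have [mf f1 _ fx] := kf.
pose E : set R := [set y : R | 1 < y <= 40].
pose rho y := normc (f y - ka s y) / y ^+ 5.
suff H : forall y, E y -> rho y <= K * s ^+ 3.
  have := H x; rewrite /E/= x1 x40 => /(_ isT); rewrite /rho ler_pdivrMr ?exprn_gt0//; last lra.
  move=> /le_trans; apply; rewrite mulrAC; apply: ler_wpM2r; first exact: ltW.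
  by apply: ler_wpM2l; [lra|apply: Pb; rewrite x0].
apply: (@bootstrap_bound R E rho (K * s ^+ 3) (3 / 4) 3) => //.
- by apply: mulr_gt0 => //; lra.
- by apply/andP; split; lra.
- move=> y /andP[y1 y40]; rewrite /rho ler_pdivrMr ?exprn_gt0//; last lra.
  apply: le_trans (normcD _ _) _; rewrite normc_opp.
  have := f1 y; have : normc (ka s y) <= 2 by apply: normc_ka => //; lra.
  have : 1 <= y ^+ 5 by rewrite exprn_ege1// ltW.
  lra.
move=> S S0 HS y /andP[y1 y40]; rewrite le_max; apply/orP; right.
have y0 : 0 <= y by lra.
have S00 : 0 <= S by apply: le_trans S0; rewrite mulr_ge0 ?(ltW s3)//; lra.
rewrite /rho ler_pdivrMr ?exprn_gt0//; last lra.
have D z : 0 <= z <= 40 -> normc (f z - ka s z) <= 2 * s ^+ 3 + S * z ^+ 5.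
  move=> /andP[z0 z40]; have [z1|z1] := leP z 1.
    have := kak_expansion_le1 s1 kf (introT andP (conj z0 z1)).
    have : 0 <= S * z ^+ 5 by rewrite mulr_ge0// exprn_ge0.
    lra.
  have := HS z; rewrite /E/= z1 z40 /rho => /(_ isT).
  rewrite ler_pdivrMr ?exprn_gt0//; last lra.
  by lra.
have bf := cbm_kak y kf; have bf' := cbm_sym bf.
have ba := cbm_ka s y0; have ba' := cbm_sym ba.
apply: le_trans (normc_tri _ (cI (fun u => ka s (u * y) * ka s ((1 - u) * y))) _) _.
rewrite [X in _ + X]normcB.
have res := resid s y s1 (introT andP (conj y1 y40)).
have main : normc (f y - cI (fun u => ka s (u * y) * ka s ((1 - u) * y))) <=
    6 * s ^+ 3 + S * y ^+ 5 / 2.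
  rewrite fx// -cIB; [|exact: cbmM|exact: cbmM].
  have -> : 6 * s ^+ 3 + S * y ^+ 5 / 2 =
    I01 (fun u => 6 * s ^+ 3 + (S * y ^+ 5 * u ^+ 5 + 2 * S * y ^+ 5 * (1 - u) ^+ 5)).
    have b5 := bmX 5 (@bm_id R); have b5' := bmX 5 (@bm_onem R).
    have Z (k : R) h : bm h -> bm (fun u => k * h u).
      by move=> bh; apply: bmM => //; exact: bm_cst.
    rewrite I01D; [|exact: bm_cst|by apply: bmD; exact: Z].
    rewrite I01D; [|exact: Z|exact: Z].
    by rewrite I01_cst !I01Zl// I01_pow I01_onem_pow; field.
  apply: cI_norm.
  - by apply: cbmB; exact: cbmM.
  - apply: bmD; first exact: bm_cst.
    apply: bmD; apply: bmM; [exact: bm_cst| |exact: bm_cst|].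
      exact: (bmX 5 bm_id).
    exact: (bmX 5 bm_onem).
  move=> u /andP[u0 u1].
  have z0 : 0 <= u * y <= 40 by apply/andP; split; nra.
  have z0' : 0 <= (1 - u) * y <= 40 by apply/andP; split; nra.
  have := D _ z0; have := D _ z0'; rewrite !exprMn => d' d.
  apply: le_trans (normc_mulB _ _ _ _) _.
  have h1 : normc (f (u * y) - ka s (u * y)) * normc (f ((1 - u) * y)) <=
      (2 * s ^+ 3 + S * (u ^+ 5 * y ^+ 5)) * 1.
    by apply: ler_pM => //; exact: normc_ge0.
  have h2 : normc (ka s (u * y)) * normc (f ((1 - u) * y) - ka s ((1 - u) * y)) <=
      2 * (2 * s ^+ 3 + S * ((1 - u) ^+ 5 * y ^+ 5)).
    by apply: ler_pM => //; [exact: normc_ge0|exact: normc_ge0|exact: normc_ka].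
  lra.
have y5 : 1 <= y ^+ 5 by rewrite exprn_ege1// ltW.
have : (K1 + 6) * s ^+ 3 * 1 <= S / 4 * y ^+ 5.
  apply: ler_pM => //; first by rewrite mulr_ge0 ?(ltW s3)//; lra.
  by rewrite KE; lra.
clear -main res; lra.
Qed.

(** Two long pieces give [e^(- th (y + 2))], a gain of [e^(- th)] over the target. A piece of length
    at most 2 is bounded by 1, at a cost of at most [e^(2 th)], but this has probability only
    [4 / y]. *)
Lemma kak_modulus_propagate s f (th : R) : 0 < th <= 80^-1 -> kak_fun s f ->
  (forall y, 2 <= y <= 40 -> normc (f y) <= expR (- (th * (y + 1)))) ->
  forall x, 2 <= x -> normc (f x) <= expR (- (th * (x + 1))).
Proof.
move=> /andP[th0 th1] kf base x x2; have [mf f1 _ fx] := kf.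
(* The range grows by one unit at a time. If both pieces exceed 2, each is at most [y - 2] and lies
   in the range already treated; only a long piece next to a short one needs the bootstrap constant
   [S]. *)
have step n : forall y, 2 <= y <= 40 + n%:R -> normc (f y) <= expR (- (th * (y + 1))).
  elim: n => [|n IH]; first by rewrite addr0.
  pose E : set R := [set y : R | 2 <= y <= 40 + n.+1%:R].
  pose rho y := normc (f y) * expR (th * (y + 1)).
  suff H : forall y, E y -> rho y <= 1.
    by move=> y /H; rewrite /rho expRN -ler_pdivlMr ?expR_gt0// mul1r.
  have N0 : 0 <= n.+1%:R :> R by [].
  apply: (@bootstrap_bound R E rho 1 (1 - th / 20) (expR (th * (40 + n.+1%:R + 1)))) => //.
  - by apply/andP; split; lra.
  - move=> y /andP[y2 yn]; rewrite /rho -[leRHS]mul1r ler_pM ?normc_ge0 ?expR_ge0//.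
    by rewrite ler_expR ler_pM2l//; lra.
  move=> S S1 HS y /andP[y2 yn]; rewrite le_max.
  have [yn'|yn'] := leP y (40 + n%:R).
    apply/orP; left; have := IH y; rewrite y2 yn' => /(_ isT).
    by rewrite /rho expRN -ler_pdivlMr ?expR_gt0// mul1r.
  have n0 : 0 <= n%:R :> R by [].
  have nS : n.+1%:R = n%:R + 1 :> R by rewrite natr1.
  clear base x x2.
  apply/orP; right; rewrite /rho -ler_pdivlMr ?expR_gt0// -expRN.
  have y1 : 1 < y by lra.
  have y0 : 0 < y by lra.
  pose e := expR (- (th * (y + 1))).
  have e0 : 0 < e by exact: expR_gt0.
  rewrite -/e fx//.
  pose i1 (u : R) : R := if u * y <= 2 then 1 else 0.
  pose i2 (u : R) : R := if (1 - u) * y <= 2 then 1 else 0.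
  have bi1 : bm i1 by exact: bm_le_ind.
  have bi2 : bm i2 by exact: (bm_sym bi1).
  (* The excess of the bound with a short piece over the bound with two long ones; for [y > 40] the
     two indicators are never both 1. *)
  pose k := e * (S * expR (2 * th) - expR (- th)).
  have -> // : (1 - th / 20) * S * e >= I01 (fun u => e * expR (- th) + (k * i1 u + k * i2 u)) ->
     normc (cI (fun u => f (u * y) * f ((1 - u) * y))) <= (1 - th / 20) * S * e.
    apply: le_trans; apply: cI_norm.
    - by apply: cbmM; [exact: cbm_kak kf|exact: (cbm_sym (cbm_kak y kf))].
    - by apply: bmD; [exact: bm_cst|apply: bmD; apply: bmM => //; exact: bm_cst].
    move=> u /andP[u0 u1]; rewrite normcM.
    have g1 : expR (- th) <= S * expR (2 * th).
      apply: (@le_trans _ _ (1 * 1)).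
        by rewrite mulr1 expR_le1; lra.
      by apply: ler_pM => //; have := expR_ge1Dx (2 * th); lra.
    have k0 : 0 <= k by rewrite /k mulr_ge0 ?(ltW e0)// subr_ge0.
    have Sb z : 2 <= z -> z <= y -> normc (f z) <= S * expR (- (th * (z + 1))).
      move=> z2 zy; have := HS z; rewrite /E/= z2 (le_trans zy yn)/= => /(_ isT).
      by rewrite /rho expRN -ler_pdivlMr ?expR_gt0.
    have small z w : 0 <= z -> z <= 2 -> 0 <= w -> z + w = y ->
        normc (f z) * normc (f w) <= e * (S * expR (2 * th)).
      move=> z0 z2 w0 zw.
      apply: (@le_trans _ _ (1 * (S * expR (- (th * (w + 1)))))).
        by apply: ler_pM; rewrite ?normc_ge0//; apply: Sb; lra.
      rewrite mul1r mulrCA ler_wpM2l//; first lra.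
      rewrite /e -expRD ler_expR -zw; nra.
    rewrite /i1 /i2; have [uy2|uy2] := leP (u * y) 2.
      have -> : ((1 - u) * y <= 2) = false by apply: lt_geF; nra.
      rewrite mulr1 mulr0 addr0.
      have -> : e * expR (- th) + k = e * (S * expR (2 * th)) by rewrite /k; ring.
      by apply: small; [nra|nra|nra|ring].
    have [uy2'|uy2'] := leP ((1 - u) * y) 2.
      rewrite mulr1 mulr0 add0r.
      have -> : e * expR (- th) + k = e * (S * expR (2 * th)) by rewrite /k; ring.
      by rewrite mulrC; apply: small; [nra|nra|nra|ring].
    rewrite !mulr0 !addr0.
    have a1 := IH (u * y); have a2 := IH ((1 - u) * y).
    have /a1 {}a1 : 2 <= u * y <= 40 + n%:R by apply/andP; split; nra.
    have /a2 {}a2 : 2 <= (1 - u) * y <= 40 + n%:R by apply/andP; split; nra.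
    apply: le_trans (ler_pM _ _ a1 a2) _; rewrite ?normc_ge0//.
    by rewrite /e -!expRD ler_expR; nra.
  rewrite I01D; [|exact: bm_cst|by apply: bmD; apply: bmM => //; exact: bm_cst].
  rewrite I01D; [|by apply: bmM => //; exact: bm_cst|by apply: bmM => //; exact: bm_cst].
  rewrite I01_cst !I01Zl// (_ : I01 i2 = I01 i1); last exact: (I01_sym bi1).
  rewrite I01_le_ind//; last by apply/andP; split; lra.
  have E1 : expR (2 * th) <= 1 + 2 * (2 * th) by apply: expR_le1D2; apply/andP; split; lra.
  have E2 : expR (- th) <= 1 - th / 2 by apply: expRN_le; apply/andP; split; lra.
  have yV : 0 < y^-1 <= 40^-1.
    by rewrite invr_gt0 y0/= lef_pV2 ?posrE//; lra.
  rewrite /k; move: (expR (2 * th)) (expR (- th)) E1 E2 (y^-1) yV => A B E1 E2 Y /andP[Y0 Y1].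
  have -> : e * B + (e * (S * A - B) * (2 * Y) + e * (S * A - B) * (2 * Y)) =
     e * (B * (1 - 4 * Y) + 4 * Y * (S * A)) by ring.
  rewrite mulrC ler_pM2r//.
  have h1 : B * (1 - 4 * Y) <= (1 - th / 2) * (1 - 4 * Y) * S.
    apply: (@le_trans _ _ ((1 - th / 2) * (1 - 4 * Y))); first by apply: ler_wpM2r => //; lra.
    by rewrite ler_peMr// mulr_ge0//; lra.
  have h2 : 4 * Y * (S * A) <= 4 * Y * (S * (1 + 2 * (2 * th))).
    by apply: ler_wpM2l; [lra|apply: ler_wpM2l => //; lra].
  (* The left side is [1 - th / 2 + 18 * th * Y], and [Y <= 1 / 40] gives exactly [1 - th / 20]:
     this is where the threshold 40 is used. *)
  have h3 : (1 - th / 2) * (1 - 4 * Y) + 4 * Y * (1 + 2 * (2 * th)) <= 1 - th / 20 by nra.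
  have := ler_wpM2l (_ : 0 <= S) h3 => /(_ ltac:(lra)); lra.
have [n xn] : exists n : nat, x <= 40 + n%:R.
  exists (Num.truncn x).+1; have := truncnS_gt x; lra.
by apply: (step n); rewrite x2.
Qed.

Lemma kak_modulus : exists2 d : R, 0 < d <= 20^-1 &
  forall s f x, 0 < s <= d -> kak_fun s f -> 2 <= x ->
  normc (f x) <= expR (- (c / 4 * s ^+ 2 * (x + 1))).
Proof.
have [KC K0 expansion] := kak_expansion.
have c0 := @kc_gt0 R; have c1 := @kc_le1 R.
(* With [th = c s ^ 2 / 4], the second entry makes the expansion error at most [th]. On [[2, 40]]
   the modulus is then at most [1 - 2 th y + th], hence at most [1 - th (y + 1)] because
   [y >= 2]. *)
exists (Num.min 20^-1 (c / (4 * KC))).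
  by rewrite lt_min ge_min lexx/= andbT invr_gt0 divr_gt0 ?mulr_gt0//; lra.
move=> s f x /andP[s0]; rewrite le_min => /andP[s20 sK] kf x2.
have ss : 0 < s <= 20^-1 by rewrite s0.
set th := c / 4 * s ^+ 2.
have s2 : s ^+ 2 <= 100^-1 by nra.
have s20' : 0 < s ^+ 2 by rewrite exprn_gt0.
have th0 : 0 < th by rewrite /th; nra.
have th1 : th <= 80^-1 by rewrite /th; nra.
have KCs : KC * s ^+ 3 <= th.
  move: sK; rewrite ler_pdivlMr ?mulr_gt0// => sK.
  have -> : KC * s ^+ 3 = (s * (4 * KC)) * s ^+ 2 / 4 by field.
  rewrite /th; nra.
apply: (@kak_modulus_propagate s f th) => //; first by rewrite th0.
move=> y /andP[y2 y40].
apply: (@le_trans _ _ (1 - th * (y + 1))); last exact: expR_ge1Dx.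
have y0 : 0 <= y <= 40 by apply/andP; split; lra.
have := expansion s f y ss kf y0.
have -> : ka s y = ((1 - 2 * th * y)%:C)%C.
  rewrite /ka kv_ge2// /km lt_geF ?mulr0//; last lra.
  by congr Complex; rewrite /th; field.
have h : normc ((1 - 2 * th * y)%:C)%C = 1 - 2 * th * y.
  by rewrite normc_real ger0_norm//; nra.
rewrite -[f y in X in _ -> X](subrK ((1 - 2 * th * y)%:C)%C).
by move=> h2; apply: le_trans (normcD _ _) _; rewrite h; clear -h2 KCs th0 y2; nra.
Qed.

End expansion.

(** * Gaussian approximation of the solution *)

(** The error is measured against [e * h y * (y - 1)]: for [p + r = y] the weights add up to
    [y - 2], one less than [y - 1], while [h p * h r = h y]. This surplus covers short pieces, the
    factor [1 + 22 q], and the residual of the model [B]. In the application [e = s ^ 3] and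
    [q = s ^ 2]. *)
Lemma gaussian_propagate (R : realType) (e q x K : R) (f B : R -> R[i]) (h g : R -> R)
    (ind := fun z : R => if z <= 2 then 1 else 0 : R) :
  0 < e -> 0 <= q -> 88 * q <= 4^-1 -> 40 < K -> 40 < x ->
  (forall y, 1 < y -> f y = cI (fun u => f (u * y) * f ((1 - u) * y))) ->
  (forall y, normc (f y) <= 1) ->
  (forall y, cbm (fun u => f (u * y))) -> (forall y, 0 <= y -> cbm (fun u => B (u * y))) ->
  (forall y, 0 < h y) -> (forall y z, h (y + z) = h y * h z) ->
  (forall y z, y <= z -> h z <= h y) -> (forall y, 0 <= y -> h y <= 1) ->
  (forall y, 0 < g y) -> (forall y, 0 <= y -> g y <= h y) ->
  (forall y, 2 < y -> B y = ((g y)%:C)%C) ->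
  (forall y, 0 <= y -> normc (f y) <= h y * (1 + 22 * q * ind y)) ->
  (forall y, 0 <= y -> normc (B y) <= h y * (1 + 22 * q * ind y)) ->
  (forall y, 40 <= y ->
     normc (((g y)%:C)%C - cI (fun u => B (u * y) * B ((1 - u) * y))) <= g y * (e * (40 / y))) ->
  (forall y, 0 <= y <= 40 -> normc (f y - B y) <= K * e * h y) ->
  normc (f x - ((g x)%:C)%C) <= K * e * x * h x.
Proof.
move=> e0 q0 s88 KD0 x40 fx f1 cf cB h_gt0 hD h_mono h_le1 g_gt0 g_le_h Bg fB bB resid low.
pose E : set R := [set y : R | 40 <= y <= x].
pose rho y := normc (f y - ((g y)%:C)%C) / (e * h y * (y - 1)).
have den y : E y -> 0 < e * h y * (y - 1).
  by move=> /andP[y40 _]; rewrite !mulr_gt0//; lra.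
suff H : forall y, E y -> rho y <= K.
  have Ex : E x by rewrite /E/= lexx andbT ltW.
  have := H x Ex; rewrite /rho ler_pdivrMr ?den//.
  move=> /le_trans; apply.
  have -> : K * e * x * h x = K * (e * h x * x) by ring.
  rewrite ler_wpM2l//; first lra.
  by rewrite ler_wpM2l ?mulr_ge0 ?(ltW e0) ?(ltW (h_gt0 _))//; lra.
(* The contraction factor and the initial bound may depend on [x], since only the limiting constant
   [K] survives. *)
apply: (@bootstrap_bound R E rho K (1 - (5 / 2 * x)^-1) (2 / (e * h x))) => //.
- lra.
- have : (5 / 2 * x)^-1 <= 1 by rewrite invf_le1//; lra.
  have : 0 < (5 / 2 * x)^-1 by rewrite invr_gt0; lra.
  by move=> ? ?; apply/andP; split; lra.
- move=> y Ey; rewrite /rho ler_pdivrMr ?den//.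
  have /andP[y40 yx] := Ey.
  apply: (@le_trans _ _ 2).
    apply: le_trans (normcD _ _) _; rewrite normc_opp normc_real gtr0_norm//.
    have := f1 y; have : g y <= 1 by apply: le_trans (g_le_h y _) (h_le1 y _); lra.
    lra.
  rewrite mulrAC ler_pdivlMr ?mulr_gt0//.
  have -> : 2 * (e * h y * (y - 1)) = 2 * e * (h y * (y - 1)) by ring.
  rewrite [leLHS](_ : _ = 2 * e * h x); last by ring.
  apply: ler_wpM2l; first lra.
  have := h_mono y x yx.
  have := h_gt0 y; nra.
move=> S SK HS y Ey; rewrite le_max; apply/orP; right.
rewrite /rho ler_pdivrMr ?den//; have /andP[y40 yx] := Ey.
have y0 : 0 < y by lra.
have y1 : 1 < y by lra.
(* The extra 2 keeps the weight at least 1 on short pieces, where [z - 1] may be negative. It adds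
   [8 / y] on average, since each piece is short with probability [2 / y]. *)
pose w z := (z - 1) + 2 * ind z.
have D z : 0 <= z <= y -> normc (f z - B z) <= S * e * h z * w z.
  move=> /andP[z0 zy].
  have P0 : 0 < e * h z by exact: mulr_gt0.
  have [z40|z40] := leP z 40.
    have := low z; rewrite z0 z40 => /(_ isT) /le_trans; apply.
    have w1 : 1 <= w z by rewrite /w /ind; case: ifPn => [_|]; [lra|rewrite -ltNge; lra].
    apply: (@le_trans _ _ (S * (e * h z))).
      by rewrite -mulrA; apply: ler_wpM2r => //; exact: ltW P0.
    rewrite [leRHS](_ : _ = S * (e * h z) * w z); last by ring.
    by rewrite ler_peMr// mulr_ge0 ?(ltW P0)//; lra.
  have Ez : E z by rewrite /E/= (ltW z40) (le_trans zy yx).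
  have z2 : 2 < z by lra.
  have := HS z Ez; rewrite /rho ler_pdivrMr ?den// Bg// /w /ind (lt_geF z2).
  by rewrite mulr0 addr0 !mulrA.
have w_le z : 0 <= z <= y -> 0 <= w z <= y.
  by move=> /andP[z0 zy]; rewrite /w /ind; case: ifPn => [z2|]; [|rewrite -ltNge => z2];
    apply/andP; split; lra.
have bf := cf y; have bf' := cbm_sym bf.
have bb := cB y (ltW y0); have bb' := cbm_sym bb.
have bi := bm_le_ind 2 y; have bi' := bm_sym bi.
have biw : bm (fun u => w (u * y)).
  apply: bmD; last by apply: bmM => //; exact: bm_cst.
  by apply: bmB; [apply: bmM; [exact: bm_id|exact: bm_cst]|exact: bm_cst].
have biw' := bm_sym biw.
have Z (k : R) r : bm r -> bm (fun u => k * r u).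
  by move=> be; apply: bmM => //; exact: bm_cst.
have main : normc (f y - cI (fun u => B (u * y) * B ((1 - u) * y))) <=
    S * e * h y * (y - 2 + 8 / y + 88 * q).
  rewrite fx// -cIB; [|exact: cbmM|exact: cbmM].
  pose G u := S * e * h y * ((w (u * y) + w ((1 - u) * y)) +
     22 * q * y * (ind (u * y) + ind ((1 - u) * y))).
  have b2 := Z (22 * q * y) _ (bmD bi bi').
  have b1 := bmD (bmD biw biw') b2.
  have bG : bm G := Z (S * e * h y) _ b1.
  have -> : S * e * h y * (y - 2 + 8 / y + 88 * q) = I01 G.
    rewrite /G (I01Zl _ b1) (I01D (bmD biw biw') b2).
    rewrite I01D// (I01_sym biw) I01Zl; last exact: bmD.
    rewrite I01D// (I01_sym bi) I01_le_ind//; last by apply/andP; split; lra.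
    have -> : I01 (fun u => w (u * y)) = y / 2 - 1 + 4 / y.
      rewrite /w I01D; [|by apply: bmB; [apply: bmM; [exact: bm_id|exact: bm_cst]|exact: bm_cst]|exact: Z].
      rewrite I01B; [|by apply: bmM; [exact: bm_id|exact: bm_cst]|exact: bm_cst].
      rewrite I01_cst I01Zl// I01_le_ind//; last by apply/andP; split; lra.
      rewrite I01Zr; last exact: bm_id.
      have -> : I01 (id : R -> R) = 2^-1.
        rewrite -(I01_pow 1); apply: I01_eq => u _; by rewrite expr1.
      by field; lra.
    by field; lra.
  apply: cI_norm => //.
    by apply: cbmB; exact: cbmM.
  move=> u /andP[u0 u1].
  have z1 : 0 <= u * y <= y by apply/andP; split; nra.
  have z2 : 0 <= (1 - u) * y <= y by apply/andP; split; nra.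
  have zz : u * y + (1 - u) * y = y by ring.
  rewrite /G; move: (u * y) ((1 - u) * y) z1 z2 zz => p r p1 r1 pq.
  have hpq : h y = h p * h r by rewrite -hD pq.
  have /andP[p0 _] := p1; have /andP[r0 _] := r1.
  have /andP[wp0 wpy] := w_le p p1; have /andP[wq0 wqy] := w_le r r1.
  have i0 z : 0 <= ind z by rewrite /ind; case: ifP.
  apply: le_trans (normc_mulB _ _ _ _) _.
  have h1 : normc (f p - B p) * normc (f r) <=
     S * e * h p * w p * (h r * (1 + 22 * q * ind r)).
    by apply: ler_pM; rewrite ?normc_ge0 ?D ?fB.
  have h2 : normc (B p) * normc (f r - B r) <=
     (h p * (1 + 22 * q * ind p)) * (S * e * h r * w r).
    by apply: ler_pM; rewrite ?normc_ge0 ?D ?bB.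
  apply: (le_trans (lerD h1 h2)).
  have -> : S * e * h p * w p * (h r * (1 + 22 * q * ind r)) +
      h p * (1 + 22 * q * ind p) * (S * e * h r * w r) =
     S * e * h y * ((w p + w r) + 22 * q * (w p * ind r + w r * ind p)).
    by rewrite hpq; ring.
  rewrite ler_wpM2l//.
    by rewrite mulr_ge0 ?(ltW (h_gt0 _))// mulr_ge0 ?(ltW e0)//; lra.
  rewrite lerD2l -[X in _ <= X]mulrA ler_wpM2l//; first lra.
  rewrite mulrDr addrC; apply: lerD; exact: ler_wpM2r.
have res := resid y y40.
apply: le_trans (normc_tri _ (cI (fun u => B (u * y) * B ((1 - u) * y))) _) _.
rewrite [X in _ + X]normcB.
have res2 : g y * (e * (40 / y)) <= h y * e.
  apply: ler_pM; rewrite ?(ltW (g_gt0 _)) ?g_le_h ?(ltW y0)//.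
    by rewrite mulr_ge0 ?divr_ge0 ?(ltW e0) ?(ltW y0).
  by rewrite ler_piMr ?(ltW e0)// ler_pdivrMr// mul1r.
have yV : 0 < y^-1 <= 40^-1 by rewrite invr_gt0 y0/= lef_pV2 ?posrE//.
have k1 : y - 7 / 5 <= (1 - (5 / 2 * x)^-1) * (y - 1).
  have -> : (5 / 2 * x)^-1 = 2 / 5 * x^-1 by field; lra.
  have : y * x^-1 <= 1 by rewrite ler_pdivrMr ?mul1r//; lra.
  have : 0 < x^-1 by rewrite invr_gt0; lra.
  nra.
have hs0 : 0 < e * h y by exact: mulr_gt0.
have -> : (1 - (5 / 2 * x)^-1) * S * (e * h y * (y - 1)) =
   e * h y * (S * ((1 - (5 / 2 * x)^-1) * (y - 1))) by ring.
apply: (@le_trans _ _ (e * h y * (S * (y - 2 + 8 / y + 88 * q) + 1))).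
  lra.
apply: ler_wpM2l; first exact: ltW.
have S0 : 40 < S by lra.
(* Since [8 / y <= 1 / 5], [88 q <= 1 / 4] and [1 <= S / 40], the surplus of 1 is reduced to no less
   than [2 / 5]. As [y <= x], this is a relative gain of at least [2 / (5 x)]. *)
apply: (@le_trans _ _ (S * (y - 7 / 5))); last by rewrite ler_wpM2l//; lra.
have /andP[yV0 yV1] := yV.
nra.
Qed.

Section gaussian_approximation.
Context {R : realType}.
Implicit Types s x y : R.

Local Notation c := (@kc R).

Let g s x : R := expR (- (c / 2 * s ^+ 2 * x)).
(** The square root of the Gaussian factor [g]: the rate of decay that [kak_modulus] provides for
    [f] itself. *)
Let h s x : R := expR (- (c / 4 * s ^+ 2 * x)).
(** The model for [f]: the Gaussian factor is wrong on short intervals already at order [s], so the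
    Taylor polynomial replaces it there. *)
Let b s x : R[i] := if x <= 2 then ka s x else ((g s x)%:C)%C.
(** The relative deviation of [b] from [g], up to [O(s ^ 3)]; it vanishes for [x > 2]. *)
Let lin s x : R[i] := ((s ^+ 2 / 2 * (c * x - kv x)) +i* (s * km x))%C.
Let ind x : R := if x <= 2 then 1 else 0.

Let gD s x y : g s (x + y) = g s x * g s y.
Proof. by rewrite /g -expRD; congr expR; ring. Qed.

Let hD s x y : h s (x + y) = h s x * h s y.
Proof. by rewrite /h -expRD; congr expR; ring. Qed.

Let h_gt0 s x : 0 < h s x. Proof. exact: expR_gt0. Qed.
Let g_gt0 s x : 0 < g s x. Proof. exact: expR_gt0. Qed.

Let h_le1 s x : 0 <= x -> h s x <= 1.
Proof.
move=> x0; rewrite expR_le1 oppr_le0 mulr_ge0// mulr_ge0 ?sqr_ge0// divr_ge0//.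
by rewrite ltW// kc_gt0.
Qed.

Let g_le_h s x : 0 <= x -> g s x <= h s x.
Proof.
move=> x0; rewrite ler_expR lerN2 ler_wpM2r// ler_wpM2r ?sqr_ge0//.
have := @kc_gt0 R; lra.
Qed.

Let bm_expR (k x : R) : bm (fun u => expR (- (k * (u * x)))).
Proof.
apply: (@bm_mfun _ _ (expR (`|k| * `|x|))).
  apply: measurableT_comp => //; apply: measurableT_comp => //.
  by apply: measurable_funM => //; exact: measurable_funM.
move=> u /andP[u0 u1]; rewrite ger0_norm ?expR_ge0// ler_expR.
apply: le_trans (ler_norm _) _; rewrite normrN !normrM ler_wpM2l//.
by rewrite ler_piMl// ger0_norm.
Qed.

Let cbm_b s x : 0 <= x -> cbm (fun u => b s (u * x)).
Proof.
move=> x0; have [a1 a2] := cbm_ka s x0.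
have m2 : measurable_fun setT (fun u : R => u * x <= 2).
  by apply: measurable_fun_ler => //; exact: measurable_funM.
split.
  rewrite (_ : (fun _ => _) =
     (fun u => if u * x <= 2 then Re (ka s (u * x)) else g s (u * x))); last first.
    by apply/funext => u; rewrite /b; case: ifP.
  by apply: bm_if => //; exact: bm_expR.
rewrite (_ : (fun _ => _) =
   (fun u => if u * x <= 2 then Im (ka s (u * x)) else 0)); last first.
  by apply/funext => u; rewrite /b; case: ifP.
by apply: bm_if => //; exact: bm_cst.
Qed.

Let cbm_lin s x : 0 <= x -> cbm (fun u => lin s (u * x)).
Proof.
move=> x0; split => /=.
  apply: bmM; first exact: bm_cst.
  apply: bmB; last exact: bm_kv.
  by apply: bmM; [exact: bm_cst|apply: bmM; [exact: bm_id|exact: bm_cst]].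
by apply: bmM; [exact: bm_cst|exact: bm_km].
Qed.

(** The mean of [km (u * x)] is zero, and for [x >= 2] the integral of [kv] up to [x] is that of
    [c y]. Thus the deviations on short pieces cancel on average, although they do not cancel
    pointwise. *)
Let cI_lin s x : 2 <= x -> cI (fun u => lin s (u * x)) = 0.
Proof.
move=> x2; have x0 : 0 <= x by lra.
have bu : bm (fun u => c * (u * x)).
  by apply: bmM; [exact: bm_cst|apply: bmM; [exact: bm_id|exact: bm_cst]].
rewrite /cI /lin/=; apply/eqP; rewrite eq_complex/=; apply/andP; split; apply/eqP.
  rewrite I01Zl; last by apply: bmB => //; exact: bm_kv.
  rewrite I01B//; last exact: bm_kv.
  rewrite I01_kv ?kV_ge2//; last lra.
  rewrite I01Zl; last by apply: bmM; [exact: bm_id|exact: bm_cst].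
  rewrite I01Zr; last exact: bm_id.
  have -> : I01 (id : R -> R) = 2^-1.
    rewrite -(I01_pow 1); apply: I01_eq => u _; by rewrite expr1.
  by field; lra.
by rewrite I01Zl ?I01_km ?mulr0//; [lra|exact: bm_km].
Qed.

(** On short intervals the polynomial has modulus at most [1 + 21 s ^ 2], and [h] is at least
    [1 - c s ^ 2 / 2]; the factor [1 + 22 s ^ 2] absorbs both. *)
Let b_bound s y : 0 < s <= 20^-1 -> 0 <= y ->
  normc (b s y) <= h s y * (1 + 22 * s ^+ 2 * ind y).
Proof.
move=> /andP[s0 s20] y0; rewrite /b /ind; case: ifPn => [y2|_]; last first.
  by rewrite mulr0 addr0 mulr1 normc_real ger0_norm ?g_le_h// ltW.
rewrite mulr1.
have c0 := @kc_gt0 R; have c1 := @kc_le1 R.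
have s2 : s ^+ 2 <= 100^-1 by nra.
have s20' : 0 < s ^+ 2 by rewrite exprn_gt0.
have n1 : normc (ka s y) <= 1 + 21 * s ^+ 2.
  have := kv_bound y0; have := km_bound y0; rewrite !ler_norml => /andP[p1 p2] /andP[v1 v2].
  apply: normc_le; first lra.
  move: s2 s20' p1 p2 v1 v2.
  have -> : (s * km y) ^+ 2 = s ^+ 2 * km y ^+ 2 by rewrite exprMn.
  move: (s ^+ 2) (kv y) (km y) => q v p q1 q0 p1 p2 v1 v2.
  have pp : p ^+ 2 <= 1 by nra.
  have vv : (1 - q * v / 2) ^+ 2 <= (1 + 20 * q) ^+ 2.
    have : - (1 + 20 * q) <= 1 - q * v / 2 by nra.
    have : 1 - q * v / 2 <= 1 + 20 * q by nra.
    move: (1 - q * v / 2) => w w1 w2; nra.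
  nra.
have h1 : 1 - c / 2 * s ^+ 2 <= h s y.
  apply: le_trans (expR_ge1Dx _); rewrite lerD2l lerN2.
  have -> : c / 2 * s ^+ 2 = c / 4 * s ^+ 2 * 2 by field.
  by apply: ler_wpM2l => //; rewrite mulr_ge0 ?(ltW s20')//; lra.
apply: le_trans n1 _.
have cq : c * s ^+ 2 <= s ^+ 2 by rewrite ler_piMl// ltW.
have cqq : c * s ^+ 2 * s ^+ 2 <= s ^+ 2 * 100^-1.
  exact: ler_pM (mulr_ge0 (ltW c0) (ltW s20')) (ltW s20') cq s2.
apply: (@le_trans _ _ ((1 - c / 2 * s ^+ 2) * (1 + 22 * s ^+ 2))); first lra.
by apply: ler_wpM2r => //; lra.
Qed.

Let f_bound s f y : 0 < s <= 20^-1 -> kak_fun s f ->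
  (forall x, 2 <= x -> normc (f x) <= expR (- (c / 4 * s ^+ 2 * (x + 1)))) ->
  0 <= y -> normc (f y) <= h s y * (1 + 22 * s ^+ 2 * ind y).
Proof.
move=> /andP[s0 s20] [_ f1 _ _] fm y0; rewrite /ind; case: ifPn => [y2|].
  have c0 := @kc_gt0 R; have c1 := @kc_le1 R.
  have s2 : s ^+ 2 <= 100^-1 by nra.
  have s20' : 0 < s ^+ 2 by rewrite exprn_gt0.
  have h1 : 1 - c / 2 * s ^+ 2 <= h s y.
    apply: le_trans (expR_ge1Dx _); rewrite lerD2l lerN2.
    have -> : c / 2 * s ^+ 2 = c / 4 * s ^+ 2 * 2 by field.
    by apply: ler_wpM2l => //; rewrite mulr_ge0 ?(ltW s20')//; lra.
  rewrite mulr1; apply: le_trans (f1 _) _.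
  have cq : c * s ^+ 2 <= s ^+ 2 by rewrite ler_piMl// ltW.
have cqq : c * s ^+ 2 * s ^+ 2 <= s ^+ 2 * 100^-1.
  exact: ler_pM (mulr_ge0 (ltW c0) (ltW s20')) (ltW s20') cq s2.
apply: (@le_trans _ _ ((1 - c / 2 * s ^+ 2) * (1 + 22 * s ^+ 2))); first lra.
  by apply: ler_wpM2r => //; lra.
rewrite -ltNge => y2; rewrite mulr0 addr0 mulr1.
apply: le_trans (fm y (ltW y2)) _; rewrite ler_expR lerN2 ler_wpM2l//; last lra.
by rewrite mulr_ge0 ?sqr_ge0// divr_ge0// ltW// kc_gt0.
Qed.

Let ae_approx s y : 0 < s <= 20^-1 -> 0 <= y <= 2 ->
  normc (ka s y * ((expR (c / 2 * s ^+ 2 * y))%:C)%C - 1 - lin s y) <= 10 * s ^+ 3.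
Proof.
move=> /andP[s0 s20] /andP[y0 y2].
have c0 := @kc_gt0 R; have c1 := @kc_le1 R.
have s2 : s ^+ 2 <= 100^-1 by nra.
have s20' : 0 < s ^+ 2 by rewrite exprn_gt0.
set t := c / 2 * s ^+ 2 * y.
have cy : 0 <= c * y <= 2 by apply/andP; split; nra.
have t0 : 0 <= t by rewrite /t; nra.
have ts : t <= s ^+ 2 by rewrite /t; nra.
have t2 : 0 <= t <= 2^-1 by rewrite t0/=; lra.
have := expR_approx2 t2; set r := expR t - (1 + t) => r2.
have -> : expR t = 1 + t + r by rewrite /r; ring.
have ss3 : s ^+ 4 <= s ^+ 3 / 20.
  by rewrite exprS mulrC ler_wpM2l// exprn_ge0// ltW.
have s30 : 0 < s ^+ 3 by rewrite exprn_gt0.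
have r4 : `|r| <= 2 * s ^+ 4.
  apply: le_trans r2 _; rewrite ler_wpM2l//.
  have -> : s ^+ 4 = (s ^+ 2) ^+ 2 by rewrite -exprM.
  by rewrite lerXn2r ?nnegrE// ltW.
have kv1 := kv_bound y0; have km1 := km_bound y0.
pose L : R[i] := ((- (s ^+ 2 * kv y / 2)) +i* (s * km y))%C.
have L1 : normc L <= 2 * s.
  apply: le_trans (normc_leD _ _) _; rewrite normrN.
  have : `|s * km y| <= s * 1 by rewrite normrM gtr0_norm// ler_wpM2l// ltW.
  have : `|s ^+ 2 * kv y / 2| <= s ^+ 2 * 40 / 2.
    rewrite normrM (normrM (s ^+ 2)) [`|2^-1|]gtr0_norm// (gtr0_norm s20').
    by rewrite ler_wpM2r// ler_wpM2l ?(ltW s20')//; lra.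
  have : s ^+ 2 <= s / 20 by rewrite expr2 ler_wpM2l// ltW.
  lra.
have -> : ka s y * ((1 + t + r)%:C)%C - 1 - lin s y = L * ((t + r)%:C)%C + (r%:C)%C.
  rewrite /ka /lin /L; apply/eqP; rewrite eq_complex/=; apply/andP; split; apply/eqP.
    have tE : s ^+ 2 / 2 * (c * y) = t by rewrite /t; field.
    by rewrite mulrBr tE; field.
  by field.
apply: le_trans (normcD _ _) _; rewrite normcM !normc_real.
have : `|t + r| <= s ^+ 2 + 2 * s ^+ 4.
  by apply: le_trans (ler_normD _ _) _; rewrite (ger0_norm t0) lerD.
move=> tr.
have : normc L * `|t + r| <= 2 * s * (s ^+ 2 + 2 * s ^+ 4).
  by apply: ler_pM => //; exact: normc_ge0.
have -> : 2 * s * (s ^+ 2 + 2 * s ^+ 4) = 2 * s ^+ 3 + 4 * s * s ^+ 4 by ring.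
have : s * s ^+ 4 <= 20^-1 * s ^+ 4.
  by apply: ler_wpM2r => //; rewrite exprn_ge0// ltW.
lra.
Qed.

(** [g] is multiplicative, so two long pieces leave no error. A short piece leaves [10 s ^ 3] after
    the linear deviation is removed, and it occurs with probability [4 / x]. *)
Let b_residual s x : 0 < s <= 20^-1 -> 40 <= x ->
  normc (((g s x)%:C)%C - cI (fun u => b s (u * x) * b s ((1 - u) * x))) <=
  g s x * (s ^+ 3 * (40 / x)).
Proof.
move=> ss x40; have x0 : 0 < x by lra.
have /andP[s0 s20] := ss.
have s30 : 0 < s ^+ 3 by rewrite exprn_gt0.
have bl := cbm_lin s (ltW x0); have bl' := cbm_sym bl.
have bb := cbm_b s (ltW x0); have bb' := cbm_sym bb.
have bc (z : R[i]) : cbm (fun=> z) by split; exact: bm_cst.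
pose F u := ((g s x)%:C)%C * (1 + lin s (u * x) + lin s ((1 - u) * x)).
have bF : cbm F by apply: cbmM => //; apply: cbmD => //; apply: cbmD.
have -> : ((g s x)%:C)%C = cI F.
  have e1 := cI_lin s (_ : 2 <= x); have {}e1 := e1 ltac:(lra).
  have e2 : cI (fun u => lin s ((1 - u) * x)) = 0.
    rewrite -[RHS]e1 /cI; congr Complex.
      exact: (I01_sym bl.1).
    exact: (I01_sym bl.2).
  move: e1 e2; rewrite /cI => /eqP; rewrite eq_complex => /andP[/eqP/= r1 /eqP/= i1].
  move=> /eqP; rewrite eq_complex => /andP[/eqP/= r2 /eqP/= i2].
  apply/eqP; rewrite eq_complex/=; apply/andP; split; apply/eqP.
    rewrite (@I01_eq _ _ (fun u => g s x * (1 + Re (lin s (u * x)) + Re (lin s ((1 - u) * x))))).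
      rewrite I01Zl; last first.
        by apply: bmD; [apply: bmD; [exact: bm_cst|exact: bl.1]|exact: bl'.1].
      rewrite I01D; [|by apply: bmD; [exact: bm_cst|exact: bl.1]|exact: bl'.1].
      rewrite I01D; [|exact: bm_cst|exact: bl.1].
      by rewrite I01_cst r1 r2 !addr0 mulr1.
    by move=> u _; rewrite /F /=; ring.
  rewrite (@I01_eq _ _ (fun u => g s x * (Im (lin s (u * x)) + Im (lin s ((1 - u) * x))))).
    rewrite I01Zl; last by apply: bmD; [exact: bl.2|exact: bl'.2].
    rewrite I01D; [|exact: bl.2|exact: bl'.2].
    by rewrite i1 i2 !addr0 mulr0.
  by move=> u _; rewrite /F /=; ring.
rewrite -cIB//; last exact: cbmM.
have bi := bm_le_ind 2 x; have bi' := bm_sym bi.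
pose G (u : R) := g s x * (10 * s ^+ 3) * ((if u * x <= 2 then 1 else 0) +
   (if (1 - u) * x <= 2 then 1 else 0)).
have -> : g s x * (s ^+ 3 * (40 / x)) = I01 G.
  rewrite /G I01Zl; last exact: bmD.
  rewrite I01D// (I01_sym bi) I01_le_ind//; first by field; lra.
  by apply/andP; split; lra.
apply: cI_norm.
- by apply: cbmB => //; exact: cbmM.
- by apply: bmM; [exact: bm_cst|exact: bmD].
move=> u /andP[u0 u1].
have big z : 2 < z -> lin s z = 0.
  move=> z2; rewrite /lin kv_ge2 ?ltW// subrr mulr0 /km lt_geF ?mulr0//; lra.
have small z w : 0 <= z -> z <= 2 -> 2 < w -> z + w = x ->
   normc (((g s x)%:C)%C * (1 + lin s z + lin s w) - b s z * b s w) <=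
   g s x * (10 * s ^+ 3).
  move=> z0 z2 w2 zw; rewrite (big _ w2) addr0 /b z2 (lt_geF w2).
  have -> : ((g s x)%:C)%C * (1 + lin s z) - ka s z * ((g s w)%:C)%C =
     - (((g s x)%:C)%C * (ka s z * ((expR (c / 2 * s ^+ 2 * z))%:C)%C - 1 - lin s z)).
    have -> : g s w = g s x * expR (c / 2 * s ^+ 2 * z).
      by rewrite -zw gD mulrAC /g -expRD addNr expR0 mul1r.
    by rewrite rmorphM; ring.
  rewrite normc_opp normcM normc_real gtr0_norm// ler_wpM2l ?(ltW (g_gt0 _ _))//.
  by apply: ae_approx => //; rewrite z0.
rewrite /F /G; have [ux2|ux2] := leP (u * x) 2.
  have -> : ((1 - u) * x <= 2) = false by apply: lt_geF; nra.
  by rewrite addr0 mulr1; apply: small; [nra|nra|nra|ring].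
have [ux2'|ux2'] := leP ((1 - u) * x) 2.
  rewrite add0r mulr1 [b s _ * _]mulrC [_ + _ + _]addrAC.
  by apply: small; [nra|nra|nra|ring].
rewrite !big// !addr0 mulr1 mulr0 /b (lt_geF ux2) (lt_geF ux2') -rmorphM -gD.
have -> : u * x + (1 - u) * x = x by ring.
by rewrite subrr normc0.
Qed.

Lemma kak_gaussian : exists2 K : R, 0 < K & forall s f x,
  0 < s <= 20^-1 -> kak_fun s f ->
  (forall x, 2 <= x -> normc (f x) <= expR (- (c / 4 * s ^+ 2 * (x + 1)))) ->
  2 <= x ->
  normc (f x - ((expR (- (c / 2 * s ^+ 2 * x)))%:C)%C) <=
  K * s ^+ 3 * x * expR (- (c / 4 * s ^+ 2 * x)).
Proof.
have [KC K0 expansion] := @kak_expansion R.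
(* On [[0, 40]] the Taylor error is [KC s ^ 3], passing from the polynomial to the Gaussian costs
   another [20 s ^ 3], and the factor 2 compensates [h >= 1 / 2]. *)
pose KD := 2 * (KC + 20); have KDE : KC + 20 = KD / 2 by rewrite /KD; field.
have KD0 : 40 < KD by rewrite /KD; lra.
clearbody KD; exists KD; first lra.
move=> s f x ss kf fm x2; have /andP[s0 s20] := ss.
rewrite -/(g s x) -/(h s x).
have c0 := @kc_gt0 R; have c1 := @kc_le1 R.
have s2 : s ^+ 2 <= 100^-1 by nra.
have s20' : 0 < s ^+ 2 by rewrite exprn_gt0.
have s30 : 0 < s ^+ 3 by rewrite exprn_gt0.
have ss3 : s ^+ 4 <= s ^+ 3 / 20.
  by rewrite exprS mulrC ler_wpM2l// exprn_ge0// ltW.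
have s88 : 88 * s ^+ 2 <= 4^-1 by nra.
have ag y : 2 <= y <= 40 -> normc (ka s y - ((g s y)%:C)%C) <= 20 * s ^+ 3.
  move=> /andP[y2 y40].
  have -> : ka s y = ((1 - c / 2 * s ^+ 2 * y)%:C)%C.
    rewrite /ka kv_ge2// /km lt_geF; last lra.
    by rewrite mulr0; congr Complex; field.
  rewrite -rmorphB normc_real distrC.
  set t := c / 2 * s ^+ 2 * y.
  have cy : 0 <= c * y <= 40 by apply/andP; split; nra.
  have t0 : 0 <= t by rewrite /t; nra.
  have ts : t <= 20 * s ^+ 2 by rewrite /t; nra.
  apply: le_trans (expRN_approx2 t0) _.
  apply: (@le_trans _ _ ((20 * s ^+ 2) ^+ 2)); first by rewrite lerXn2r ?nnegrE//; lra.
  have -> : (20 * s ^+ 2) ^+ 2 = 400 * s ^+ 4 by ring.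
  lra.
have h40 y : 0 <= y <= 40 -> 2^-1 <= h s y.
  move=> /andP[y0 y40]; apply: le_trans (expR_ge1Dx _).
  have : c / 4 * s ^+ 2 * y <= 2^-1; last lra.
  have : c * y <= 40 by nra.
  nra.
have low y : 0 <= y <= 40 -> normc (f y - b s y) <= KD * s ^+ 3 * h s y.
  move=> y40; have hy := h40 _ y40.
  apply: (@le_trans _ _ ((KC + 20) * s ^+ 3)); last first.
    rewrite KDE [leRHS]mulrAC; apply: ler_wpM2r; first exact: ltW.
    by apply: ler_wpM2l; lra.
  have := expansion s f y ss kf y40; rewrite /b; case: ifPn => [_|]; first lra.
  rewrite -ltNge => y2 h1; apply: le_trans (normc_tri _ (ka s y) _) _.
  have : normc (ka s y - ((g s y)%:C)%C) <= 20 * s ^+ 3.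
    by apply: ag; have /andP[_ ->] := y40; rewrite ltW.
  lra.
have [x40|x40] := leP x 40.
  have x0 : 0 <= x <= 40 by rewrite x40 andbT; lra.
  have := low _ x0; rewrite /b; case: ifPn => [x2'|_ h1]; last first.
    apply: le_trans h1 _; rewrite ler_wpM2r ?(ltW (h_gt0 _ _))//.
    by rewrite ler_peMr//; [rewrite mulr_ge0 ?(ltW s30)//; lra|lra].
  (* At the junction the model still uses the Taylor branch, so the passage to the Gaussian is made
     by hand. *)
  have -> : x = 2 by apply/eqP; rewrite eq_le x2 x2'.
  move=> h1; apply: le_trans (normc_tri _ (ka s 2) _) _.
  have h2 : normc (ka s 2 - ((g s 2)%:C)%C) <= 20 * s ^+ 3.
    by apply: ag; rewrite lexx/=; lra.
  have hy := h40 2 ltac:(apply/andP; split; lra).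
  have : 20 * s ^+ 3 <= KD * s ^+ 3 * h s 2.
    rewrite mulrAC; apply: ler_wpM2r; first exact: ltW.
    nra.
  lra.
apply: (@gaussian_propagate _ (s ^+ 3) (s ^+ 2) x KD f (b s) (h s) (g s)) => //.
- exact: ltW.
- by move: kf => [].
- by move: kf => [].
- by move=> y; exact: cbm_kak kf.
- by move=> y; exact: cbm_b.
- move=> y z yz; rewrite ler_expR lerN2 ler_wpM2l// mulr_ge0 ?sqr_ge0// divr_ge0// ltW//.
- by move=> y; exact: h_le1.
- by move=> y; exact: g_le_h.
- by move=> y y2; rewrite /b (lt_geF y2).
- by move=> y; exact: f_bound.
- by move=> y; exact: b_bound.
- by move=> y; exact: b_residual.
Qed.

End gaussian_approximation.

(** * The band-limited kernel *)

Section kernel.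
Context {R : realType}.
Implicit Types z s : R.

(** Off zero, [1 / x] is [x * e^(- ln (x ^ 2))], a composition of measurable functions. *)
Lemma measurable_inv : measurable_fun setT (@GRing.inv R : R -> R).
Proof.
rewrite (_ : GRing.inv = (fun x : R => if x == 0 then 0 else x * expR (- ln (x ^+ 2)))).
  apply: measurable_fun_ifT => //; first exact: measurable_fun_eqr.
  apply: measurable_funM => //; apply: measurableT_comp => //.
  apply: measurableT_comp => //; apply: measurableT_comp; first exact: measurable_ln.
  exact: measurable_funX.
apply/funext => x; case: eqP => [->|/eqP x0]; first by rewrite invr0.
have x2 : 0 < x ^+ 2 by rewrite exprn_even_gt0.
by rewrite expRN lnK ?posrE//; field.
Qed.

Lemma measurable_sin : measurable_fun setT (@sin R).
Proof. exact: continuous_measurable_fun (@continuous_sin R). Qed.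

Lemma measurable_cos : measurable_fun setT (@cos R).
Proof. exact: continuous_measurable_fun (@continuous_cos R). Qed.

(** A quadratic remainder bound survives integration, so this serves to differentiate under the
    integral sign, both for [kQ] and for Gaussian expectations. *)
Lemma is_derive_quadratic (F : R -> R) (z l C : R) :
  (forall h, `|F (z + h) - F z - h * l| <= C * h ^+ 2) -> is_derive z 1 F l.
Proof.
move=> H.
have cv : h^-1 *: (F (h *: 1 + z) - F z) @[h --> 0^'] --> l.
  apply/cvgrPdist_le => e e0.
  near=> h.
  have h0 : h != 0 by near: h; exact: nbhs_dnbhs_neq.
  rewrite /GRing.scale/= mulr1 [h + z]addrC.
  have -> : l - h^-1 * (F (z + h) - F z) = - (h^-1 * (F (z + h) - F z - h * l)).
    by field.
  rewrite normrN normrM normfV.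
  have C0 : 0 <= C by have := H 1; rewrite expr1n mulr1; apply: le_trans.
  apply: (@le_trans _ _ (`|h|^-1 * (C * h ^+ 2))).
    by rewrite ler_wpM2l// invr_ge0.
  rewrite -real_normK ?num_real// mulrCA expr2 mulKf ?normr_eq0//.
  apply: (@le_trans _ _ (`|C| * `|h| + `|h|)).
    by rewrite (ger0_norm C0) lerDl.
  rewrite -[X in _ + X]mul1r -mulrDl -ler_pdivlMl ?ltr_wpDl//.
  near: h; apply: dnbhs0_le.
  by rewrite mulr_gt0// invr_gt0 ltr_wpDl.
split; first by apply/cvg_ex; exists l.
exact: cvg_lim cv.
Unshelve. all: by end_near. Qed.

Lemma sin_add_approx (a b : R) : `|sin (a + b) - sin a - b * cos a| <= 3 * b ^+ 2.
Proof.
have -> : sin (a + b) - sin a - b * cos a = sin a * (cos b - 1) + cos a * (sin b - b).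
  by rewrite sinD; ring.
apply: le_trans (ler_normD _ _) _; rewrite !normrM.
have sa : `|sin a| <= 1 by rewrite ler_norml sin_geN1 sin_le1.
have ca : `|cos a| <= 1 by rewrite ler_norml cos_geN1 cos_le1.
have b2 : b ^+ 2 = `|b| ^+ 2 by rewrite real_normK ?num_real.
have h1 : `|cos b - 1| <= b ^+ 2 / 2.
  rewrite ler0_norm ?subr_le0 ?cos_le1//.
  have := @cos_ge R `|b| (normr_ge0 _); rewrite -b2.
  have -> : cos `|b| = cos b by case: (ger0P b) => // _; rewrite cosN.
  lra.
have h2 : `|sin b - b| <= 2 * b ^+ 2.
  have [b1|b1] := leP `|b| 1.
    apply: le_trans (sin_approx b) _; rewrite b2.
    have := normr_ge0 b; rewrite exprS; nra.
  apply: le_trans (ler_normB _ _) _.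
  have : `|sin b| <= 1 by rewrite ler_norml sin_geN1 sin_le1.
  rewrite b2; nra.
have : `|sin a| * `|cos b - 1| <= 1 * (b ^+ 2 / 2) by exact: ler_pM.
have : `|cos a| * `|sin b - b| <= 1 * (2 * b ^+ 2) by exact: ler_pM.
have := sqr_ge0 b; lra.
Qed.

Lemma sin_norm_le (x : R) : `|sin x| <= `|x|.
Proof.
wlog x0 : x / 0 <= x.
  move=> H; have [x0|x0] := leP 0 x; first exact: H.
  by rewrite -normrN -sinN -(normrN x) H// oppr_ge0 ltW.
rewrite (ger0_norm x0) ler_norml; apply/andP; split; last exact: sin_le_id.
have [x1|x1] := leP 1 x; first by have := sin_geN1 x; lra.
have := sin_ge x0.
have : x ^+ 3 <= x by rewrite exprS ler_piMr// expr2; nra.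
lra.
Qed.

(** A smoothed sine integral: an odd function with frequencies in [[-1, 1]] that tends to the
    Dirichlet integral at infinity. The factor [1 - s ^ 2] vanishes at the band edge, which improves
    the convergence to order [z ^ (-2)]. *)
Definition kQ z : R := I01 (fun s => (1 - s ^+ 2) * (sin (s * z) / s)).

Lemma sin_div_le z s : 0 <= s -> `|sin (s * z) / s| <= `|z|.
Proof.
rewrite le_eqVlt => /orP[/eqP <-|s0]; first by rewrite invr0 mulr0 normr0.
rewrite normrM normfV (gtr0_norm s0) ler_pdivrMr// mulrC.
by apply: le_trans (sin_norm_le _) _; rewrite normrM (gtr0_norm s0).
Qed.

Lemma kQ_bm z : bm (fun s => (1 - s ^+ 2) * (sin (s * z) / s)).
Proof.
apply: bmM; first by apply: bmB; [exact: bm_cst|exact: (bmX 2 bm_id)].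
apply: (@bm_mfun _ _ `|z|); last by move=> s /andP[s0 _]; exact: sin_div_le.
apply: measurable_funM; last exact: measurable_inv.
by apply: (measurableT_comp measurable_sin); exact: measurable_funM.
Qed.

Lemma kQN z : kQ (- z) = - kQ z.
Proof.
rewrite -[RHS]mulN1r /kQ -(I01Zl (-1) (kQ_bm z)); apply: I01_eq => s _.
by rewrite mulrN sinN; ring.
Qed.

Lemma bm_sq : bm (fun s : R => 1 - s ^+ 2).
Proof. by apply: bmB; [exact: bm_cst|exact: (bmX 2 bm_id)]. Qed.

Lemma bm_cos z : bm (fun s : R => cos (s * z)).
Proof.
apply: (@bm_mfun _ _ 1); last by move=> s _; rewrite ler_norml cos_geN1 cos_le1.
by apply: (measurableT_comp measurable_cos); exact: measurable_funM.
Qed.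

Lemma kQ_le z : `|kQ z| <= `|z|.
Proof.
rewrite -[leRHS]I01_cst; apply: I01_norm; [exact: kQ_bm|exact: bm_cst|].
move=> s /andP[s0 s1]; rewrite normrM -[leRHS]mul1r ler_pM ?sin_div_le//.
rewrite ler_norml; apply/andP; split; nra.
Qed.

Let q z : R := I01 (fun s => (1 - s ^+ 2) * cos (s * z)).

Lemma kQ_derive z : is_derive z 1 kQ (q z).
Proof.
apply: (@is_derive_quadratic _ _ _ 3) => h.
have bc := bmM bm_sq (bm_cos z).
(* At [s = 0] the quotient of sines is 0 by the convention for inverses. It is replaced by its limit
   [h], so that the quadratic estimate holds at every point. *)
pose k s := (1 - s ^+ 2) * (if s == 0 then h else sin (s * (z + h)) / s - sin (s * z) / s).
have bk : bm k.
  apply: bmM; first exact: bm_sq.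
  apply: bm_if; first exact: measurable_fun_eqr.
    exact: bm_cst.
  apply: (@bm_mfun _ _ (`|z + h| + `|z|)).
    apply: measurable_funB; apply: measurable_funM; try exact: measurable_inv.
      by apply: (measurableT_comp measurable_sin); exact: measurable_funM.
    by apply: (measurableT_comp measurable_sin); exact: measurable_funM.
  by move=> s /andP[s0 _]; apply: le_trans (ler_normB _ _) _; rewrite lerD ?sin_div_le.
have kE : I01 k = kQ (z + h) - kQ z.
  rewrite -I01B; [|exact: kQ_bm|exact: kQ_bm].
  rewrite /I01 -!(@Rintegral_itv_obnd_cbnd _ 0 (BRight 1)); last 2 first.
  - apply: (@integrableS _ _ _ lebesgue_measure `[0%R, 1%R]%classic) => //.
      exact: subset_itv_oc_cc.
    by apply: bm_integrable; apply: bmB; exact: kQ_bm.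
  - apply: (@integrableS _ _ _ lebesgue_measure `[0%R, 1%R]%classic) => //.
      exact: subset_itv_oc_cc.
    exact: bm_integrable.
  apply: eq_Rintegral => s; rewrite inE/= in_itv/= => /andP[s0 _].
  by rewrite /k gt_eqF//; ring.
rewrite -kE -I01Zl// -I01B//; last by apply: bmM => //; exact: bm_cst.
rewrite -[leRHS]I01_cst; apply: I01_norm; [|exact: bm_cst|].
  by apply: bmB => //; apply: bmM => //; exact: bm_cst.
move=> s /andP[s0 s1].
rewrite [X in `|X|](_ : _ = (1 - s ^+ 2) *
   ((if s == 0 then h else sin (s * (z + h)) / s - sin (s * z) / s) - h * cos (s * z))); last first.
  by rewrite /k; set w := (if _ then _ else _); ring.
rewrite normrM; apply: (@le_trans _ _ (1 * (3 * h ^+ 2))); last by rewrite mul1r.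
apply: ler_pM => //; first by rewrite ler_norml; apply/andP; split; nra.
have [->|sn0] := eqVneq s 0.
  by rewrite mul0r cos0 mulr1 subrr normr0 mulr_ge0// sqr_ge0.
have sp : 0 < s by rewrite lt_neqAle eq_sym sn0.
have -> : sin (s * (z + h)) / s - sin (s * z) / s - h * cos (s * z) =
    (sin (s * z + s * h) - sin (s * z) - s * h * cos (s * z)) / s.
  by rewrite mulrDr; field.
rewrite normrM normfV (gtr0_norm sp) ler_pdivrMr//.
apply: le_trans (sin_add_approx _ _) _; rewrite exprMn.
have := sqr_ge0 h; nra.
Qed.

Let qE z : z != 0 -> q z = 2 * sin z / z ^+ 3 - 2 * cos z / z ^+ 2.
Proof.
move=> z0.
pose A s := (1 - s ^+ 2) * sin (s * z) / z - 2 * s * cos (s * z) / z ^+ 2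
   + 2 * sin (s * z) / z ^+ 3.
have dlin (s : R) : is_derive s 1 (fun s : R => s * z) z.
  by apply: is_derive_eq; rewrite /GRing.scale/=; ring.
have dsin (s : R) : is_derive s 1 (fun s : R => sin (s * z)) (cos (s * z) * z).
  exact: (@is_derive1_comp R sin (fun s => s * z) s _ _ (is_derive_sin _) (dlin s)).
have dcos (s : R) : is_derive s 1 (fun s : R => cos (s * z)) (- sin (s * z) * z).
  exact: (@is_derive1_comp R cos (fun s => s * z) s _ _ (is_derive_cos _) (dlin s)).
have H1 (s : R) : 0 <= s <= 1 -> is_derive s 1 A ((1 - s ^+ 2) * cos (s * z)).
  by move=> _; apply: is_derive_eq; rewrite /GRing.scale/=; field.
have H2 (s : R) : 0 <= s <= 1 ->
    {for s, continuous (fun s : R => (1 - s ^+ 2) * cos (s * z))}.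
  by move=> _; apply: is_derive_continuous.
rewrite /q (I01_FTC H1 H2) /A !mul0r !mul1r expr1n expr0n/= sin0 subrr.
by field.
Qed.

(** The derivative of [kQ] has an oscillating part of order [z ^ (-2)]. Adding [2 sin z / z ^ 2]
    removes it and leaves the derivative [-2 sin z / z ^ 3], so [Rr - 1 / z ^ 2] increases and
    [Rr + 1 / z ^ 2] decreases. *)
Lemma kQ_limit : exists2 L : R, 0 < L & forall z, 1 <= z -> `|kQ z - L| <= 3 / z ^+ 2.
Proof.
pose Rr z := kQ z + 2 * sin z / z ^+ 2.
have dR z (e : R) : 0 < z ->
    is_derive z 1 (fun z => Rr z + e / z ^+ 2) (- 2 * (sin z + e) / z ^+ 3).
  move=> z0; have ? := kQ_derive z.
  have zn0 : z != 0 by rewrite gt_eqF.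
  have ? : is_derive z 1 (fun z : R => (z ^+ 2)^-1) (- 2 / z ^+ 3).
    have d2 : is_derive z 1 (fun z : R => z ^+ 2) (2 * z).
      by apply: is_derive_eq; rewrite /GRing.scale/=; ring.
    have z2 : z ^+ 2 != 0 by rewrite expf_neq0.
    have dV := @is_deriveV R (fun z : R => z ^+ 2) z _ 1 z2 d2.
    by apply: is_derive_eq; rewrite /GRing.scale/=; field.
  by apply: is_derive_eq; rewrite /GRing.scale/= qE//; field.
have up a b : 1 <= a -> a <= b -> Rr a + - 1 / a ^+ 2 <= Rr b + - 1 / b ^+ 2.
  move=> a1 ab; apply: (@is_derive_le _ (fun z => Rr z + - 1 / z ^+ 2)
      (fun z => - 2 * (sin z + - 1) / z ^+ 3)) => //.
    by move=> x /andP[ax _]; apply: dR; lra.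
  move=> x /andP[ax _]; apply: divr_ge0; last by apply: exprn_ge0; lra.
  by have := sin_le1 x; lra.
have dn a b : 1 <= a -> a <= b -> Rr b + 1 / b ^+ 2 <= Rr a + 1 / a ^+ 2.
  move=> a1 ab; rewrite -lerN2; apply: (@is_derive_le _ (fun z => - (Rr z + 1 / z ^+ 2))
      (fun z => - (- 2 * (sin z + 1) / z ^+ 3))) => //.
    move=> x /andP[ax _]; have ? := @dR x 1 ltac:(lra).
    by apply: is_derive_eq.
  move=> x /andP[ax _]; rewrite !mulNr opprK; apply: divr_ge0; last by apply: exprn_ge0; lra.
  by have := sin_geN1 x; lra.
pose A : set R := [set Rr z + - 1 / z ^+ 2 | z in [set z : R | 1 <= z]].
have ub a b : 1 <= a -> 1 <= b -> Rr b + - 1 / b ^+ 2 <= Rr a + 1 / a ^+ 2.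
  move=> a1 b1; pose m := Num.max a b.
  have am : a <= m by rewrite le_max lexx.
  have bm_ : b <= m by rewrite le_max lexx orbT.
  have := up _ _ b1 bm_; have := dn _ _ a1 am.
  have : 0 <= 1 / m ^+ 2 by rewrite divr_ge0 ?sqr_ge0.
  rewrite mulNr; lra.
have hs : has_sup A.
  split; first by exists (Rr 1 + - 1 / 1 ^+ 2); exists 1 => //=.
  by exists (Rr 1 + 1 / 1 ^+ 2) => _ [b /= b1 <-]; apply: ub.
have Lb z : 1 <= z -> Rr z + - 1 / z ^+ 2 <= sup A <= Rr z + 1 / z ^+ 2.
  move=> z1; apply/andP; split.
    by apply: sup_upper_bound => //; exists z.
  by apply: ge_sup; [case: hs|move=> _ [b /= b1 <-]; exact: ub].
exists (sup A).
  have /andP[+ _] := Lb 2 ltac:(lra); apply: lt_le_trans.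
  have s2 : 0 <= sin 2 :> R by have := @sin_ge R 2 ltac:(lra); rewrite !exprS expr0; lra.
  have Q2 : 7 / 18 <= kQ 2.
    have Z (k : R) n : bm (fun s => k * s ^+ n).
      by apply: bmM; [exact: bm_cst|exact: (bmX n bm_id)].
    (* The polynomial is [(1 - s ^ 2) s (2 - 4 s ^ 2 / 3)], from the cubic lower bound for
       [sin (2 s)]. The extra factor [s <= 1] makes the comparison hold also at [s = 0], where the
       quotient is read as 0. Since [7 / 18 > 1 / 4], the limit is positive. *)
    have -> : 7 / 18 = I01 (fun s : R => 2 * s ^+ 1 + (- (10 / 3) * s ^+ 3 + 4 / 3 * s ^+ 5)).
      rewrite I01D; [|exact: Z|by apply: bmD; exact: Z].
      rewrite I01D; [|exact: Z|exact: Z].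
      rewrite (I01Zl 2 (bmX 1 bm_id)) (I01Zl (- (10 / 3)) (bmX 3 bm_id)).
      by rewrite (I01Zl (4 / 3) (bmX 5 bm_id)) !I01_pow; field.
    apply: I01_le; [|exact: kQ_bm|].
      by apply: bmD; [exact: Z|by apply: bmD; exact: Z].
    move=> s /andP[s0 s1].
    rewrite [leLHS](_ : _ = (1 - s ^+ 2) * (s * (2 - 4 / 3 * s ^+ 2))); last by field.
    apply: ler_wpM2l; first nra.
    move: s0; rewrite le_eqVlt => /orP[/eqP <-|s0]; first by rewrite invr0 mul0r mulr0.
    rewrite ler_pdivlMr//.
    have := @sin_ge R (s * 2) ltac:(lra).
    rewrite exprMn => h; apply: le_trans h.
    rewrite [leLHS](_ : _ = s ^+ 2 * (2 - 4 / 3 * s ^+ 2)); last by ring.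
    rewrite [leRHS](_ : _ = s * (2 - 4 / 3 * s ^+ 2)); last by field.
    apply: ler_wpM2r; nra.
  rewrite /Rr.
  have : 0 <= 2 * sin 2 / 2 ^+ 2 :> R by rewrite divr_ge0 ?mulr_ge0// sqr_ge0.
  rewrite expr2; lra.
move=> z z1; have /andP[h1 h2] := Lb z z1.
have z2 : 0 < z ^+ 2 by rewrite exprn_gt0//; lra.
have hs1 : `|2 * sin z / z ^+ 2| <= 2 / z ^+ 2.
  rewrite normrM (gtr0_norm (_ : 0 < (z ^+ 2)^-1)) ?invr_gt0// ler_wpM2r ?invr_ge0 ?(ltW z2)//.
  rewrite normrM (gtr0_norm (_ : (0 : R) < 2))// -[leRHS]mulr1 ler_wpM2l//.
  by rewrite ler_norml sin_geN1 sin_le1.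
move: hs1; rewrite !ler_norml => /andP[h3 h4].
have e3 : 3 / z ^+ 2 = 2 / z ^+ 2 + 1 / z ^+ 2 by rewrite -mulrDl; congr (_ / _); ring.
have e1 : - 1 / z ^+ 2 = - (1 / z ^+ 2) by rewrite mulNr.
move: h1 h2; rewrite /Rr e1 e3 => h1 h2; apply/andP; split; lra.
Qed.

(** The Fejer kernel, [(1 - cos z) / z ^ 2] away from zero: nonnegative, with a triangular Fourier
    transform supported in [[-1, 1]]. *)
Definition kF z : R := I01 (fun s => (1 - s) * cos (s * z)).

Lemma kF_bm z : bm (fun s => (1 - s) * cos (s * z)).
Proof. by apply: bmM; [exact: bm_onem|exact: bm_cos]. Qed.

Lemma kFE z : z ^+ 2 * kF z = 1 - cos z.
Proof.
have [->|z0] := eqVneq z 0; first by rewrite expr0n/= mul0r cos0 subrr.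
pose A s := (1 - s) * sin (s * z) / z - cos (s * z) / z ^+ 2.
have dlin (s : R) : is_derive s 1 (fun s : R => s * z) z.
  by apply: is_derive_eq; rewrite /GRing.scale/=; ring.
have dsin (s : R) : is_derive s 1 (fun s : R => sin (s * z)) (cos (s * z) * z).
  exact: (@is_derive1_comp R sin (fun s => s * z) s _ _ (is_derive_sin _) (dlin s)).
have dcos (s : R) : is_derive s 1 (fun s : R => cos (s * z)) (- sin (s * z) * z).
  exact: (@is_derive1_comp R cos (fun s => s * z) s _ _ (is_derive_cos _) (dlin s)).
have H1 (s : R) : 0 <= s <= 1 -> is_derive s 1 A ((1 - s) * cos (s * z)).
  by move=> _; apply: is_derive_eq; rewrite /GRing.scale/=; field.
have H2 (s : R) : 0 <= s <= 1 ->
    {for s, continuous (fun s : R => (1 - s) * cos (s * z))}.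
  by move=> _; apply: is_derive_continuous.
rewrite /kF (I01_FTC H1 H2) /A !mul0r !mul1r sin0 cos0 subrr.
by field.
Qed.

Lemma kF_ge0 z : 0 <= kF z.
Proof.
have [->|z0] := eqVneq z 0.
  by apply: I01_ge0 => s /andP[s0 s1]; rewrite mulr0 cos0 mulr1; lra.
have z2 : 0 < z ^+ 2 by rewrite exprn_even_gt0.
by rewrite -(pmulr_rge0 _ z2) kFE subr_ge0 cos_le1.
Qed.

(** One Fejer kernel vanishes at the nonzero multiples of [2 pi]. Its translate by 1 does not vanish
    there, so the sum is bounded below by a multiple of [(1 + |z|) ^ (-2)]. *)
Definition kpsi z : R := kF z + kF (z + 1).

Lemma kpsi_ge : exists2 k : R, 0 < k & forall z, k <= (1 + `|z|) ^+ 2 * kpsi z.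
Proof.
have c1 : cos (2^-1) < 1 :> R.
  by have := @cos_le R 2^-1 ltac:(lra); rewrite !exprS expr0; lra.
have c0 : 0 <= cos (2^-1) :> R.
  by have := @cos_ge R 2^-1 ltac:(lra); rewrite !exprS expr0; lra.
exists (2 - 2 * cos 2^-1); first lra.
move=> z; rewrite /kpsi mulrDr.
have h1 : z ^+ 2 * kF z <= (1 + `|z|) ^+ 2 * kF z.
  apply: ler_wpM2r; first exact: kF_ge0.
  by rewrite -(real_normK (num_real z)) lerXn2r ?nnegrE ?addr_ge0//; have := normr_ge0 z; lra.
have h2 : (z + 1) ^+ 2 * kF (z + 1) <= (1 + `|z|) ^+ 2 * kF (z + 1).
  apply: ler_wpM2r; first exact: kF_ge0.
  rewrite -(real_normK (num_real (z + 1))) lerXn2r ?nnegrE ?addr_ge0//.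
  by rewrite addrC (le_trans (ler_normD _ _))// normr1.
apply: le_trans (lerD h1 h2); rewrite !kFE.
have : cos z + cos (z + 1) <= 2 * cos 2^-1; last lra.
have -> : cos z = cos (z + 2^-1 - 2^-1) by congr cos; ring.
have -> : cos (z + 1) = cos (z + 2^-1 + 2^-1) by congr cos; field.
rewrite cosB (cosD (z + 2^-1)); set w := cos (z + 2^-1).
have w1 : 0 <= 1 - w by rewrite subr_ge0 cos_le1.
have := mulr_ge0 w1 c0; lra.
Qed.

(* The indicator of [0, +oo) is approximated by a function with Fourier
   transform supported in [-1, 1], up to a nonnegative error of the same kind:
   this replaces the sup argument of Esseen's smoothing inequality. *)
Lemma kernel_bound : exists2 L : R, 0 < L & exists2 C : R, 0 <= C &
  forall z, `|(if 0 <= z then 1 else 0) - 2^-1 - kQ z / (2 * L)| <= C * kpsi z.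
Proof.
have [L L0 QL] := kQ_limit; have [k k0 psik] := kpsi_ge.
have C0 : 0 <= 4 + 6 / L by rewrite addr_ge0// divr_ge0// ltW.
exists L => //; exists ((4 + 6 / L) / k); first by rewrite divr_ge0// ltW.
(* Both sides decay like [(1 + |z|) ^ (-2)]: near zero everything is bounded, for large [z] the rate
   of [kQ_limit] applies, and negative [z] follows by oddness. *)
have key z : `|(if 0 <= z then 1 else 0) - 2^-1 - kQ z / (2 * L)| * (1 + `|z|) ^+ 2
    <= 4 + 6 / L.
  have LV : 0 < L^-1 by rewrite invr_gt0.
  have [z1|z1] := leP `|z| 1.
    have h1 : `|(if 0 <= z then 1 else 0) - 2^-1 - kQ z / (2 * L)| <= 2^-1 + 2^-1 / L.
      apply: le_trans (ler_normB _ _) _; apply: lerD.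
        by case: ifP => _; rewrite ler_norml; apply/andP; split; lra.
      rewrite normrM invfM (gtr0_norm (_ : 0 < 2^-1 / L)) ?mulr_gt0//.
      rewrite -[leRHS]mul1r ler_wpM2r ?mulr_ge0 ?(ltW LV)//.
      exact: le_trans (kQ_le _) z1.
    have h2 : (1 + `|z|) ^+ 2 <= 4 by have := normr_ge0 z; nra.
    apply: le_trans (ler_pM _ _ h1 h2) _; rewrite ?sqr_ge0//; lra.
  have main w : 1 < w -> `|2^-1 - kQ w / (2 * L)| * (1 + w) ^+ 2 <= 4 + 6 / L.
    move=> w1; have w2 : 0 < w ^+ 2 by rewrite exprn_gt0//; lra.
    have -> : 2^-1 - kQ w / (2 * L) = - ((kQ w - L) / (2 * L)) by field; lra.
    rewrite normrN normrM (gtr0_norm (_ : 0 < (2 * L)^-1)) ?invr_gt0 ?mulr_gt0//.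
    have h1 := QL w (ltW w1).
    have h2 : (1 + w) ^+ 2 <= 4 * w ^+ 2 by nra.
    have h3 : `|kQ w - L| / (2 * L) <= 3 / w ^+ 2 / (2 * L).
      by rewrite ler_wpM2r// invr_ge0 mulr_ge0// ltW.
    apply: le_trans (ler_pM _ _ h3 h2) _; rewrite ?sqr_ge0//.
      by rewrite divr_ge0// mulr_ge0// ltW.
    have -> : 3 / w ^+ 2 / (2 * L) * (4 * w ^+ 2) = 6 / L by field; lra.
    lra.
  have [z0|z0] := leP 0 z.
    rewrite (ger0_norm z0) in z1 *; have := main z z1.
    by have -> : 1 - 2^-1 = 2^-1 :> R by field.
  rewrite (ltr0_norm z0) in z1 *; have := main (- z) z1.
  rewrite kQN; have -> : 2^-1 - - kQ z / (2 * L) = - (0 - 2^-1 - kQ z / (2 * L)) by field; lra.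
  by rewrite normrN.
move=> z; rewrite mulrAC ler_pdivlMr//.
have p0 : 0 <= kpsi z by rewrite addr_ge0 ?kF_ge0.
apply: (@le_trans _ _ (`|(if 0 <= z then 1 else 0) - 2^-1 - kQ z / (2 * L)| *
    ((1 + `|z|) ^+ 2 * kpsi z))); first by rewrite ler_wpM2l.
by rewrite mulrA ler_wpM2r.
Qed.

End kernel.

(** * Smoothing of the Gaussian distribution function *)

Section gaussian.
Context {R : realType}.
Notation mu := (@lebesgue_measure R).
Implicit Types (h : R -> R) (y r : R).

Let p y : R := normal_pdf 0 1 y.

Let pE y : p y = normal_peak (1 : R) * expR (- (y ^+ 2 / 2)).
Proof.
rewrite /p normal_pdfE ?oner_eq0// /normal_fun subr0 expr1n.
by congr (_ * expR _); rewrite mulNr.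
Qed.

Let p_ge0 y : 0 <= p y. Proof. exact: normal_pdf_ge0. Qed.

Let mp : measurable_fun setT p. Proof. exact: measurable_normal_pdf. Qed.

(** The normal density of variance 2 dominates [(1 + y ^ 2) * p y] up to a constant, and so serves
    as an integrable majorant for functions of quadratic growth. *)
Let p2 y : R := normal_pdf 0 (Num.sqrt 2) y.

Let p2E y : p2 y = normal_peak (Num.sqrt 2 : R) * expR (- (y ^+ 2 / 4)).
Proof.
have s0 : Num.sqrt 2 != 0 :> R by rewrite sqrtr_eq0 -ltNge.
rewrite /p2 normal_pdfE// /normal_fun subr0 sqr_sqrtr//.
by congr (_ * expR _); rewrite mulNr; congr (- (_ / _)); rewrite -mulr_natl; ring.
Qed.

Let Kp : R := 4 * normal_peak (1 : R) / normal_peak (Num.sqrt 2).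

Let p_dom y : (1 + y ^+ 2) * p y <= Kp * p2 y.
Proof.
have s0 : Num.sqrt 2 != 0 :> R by rewrite sqrtr_eq0 -ltNge.
have k2 := normal_peak_gt0 s0; have k1 := @normal_peak_ge0 R 1.
rewrite pE p2E /Kp; set E := expR (- (y ^+ 2 / 4)).
have E0 : 0 <= E by exact: expR_ge0.
have -> : expR (- (y ^+ 2 / 2)) = E * E by rewrite /E -expRD; congr expR; field.
have h : (1 + y ^+ 2) * E <= 4.
  rewrite /E expRN ler_pdivrMr ?expR_gt0//.
  by have := expR_ge1Dx (y ^+ 2 / 4); lra.
rewrite [leLHS](_ : _ = normal_peak 1 * E * ((1 + y ^+ 2) * E)); last by ring.
rewrite [leRHS](_ : _ = normal_peak 1 * E * 4); last by field; rewrite gt_eqF.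
by apply: ler_wpM2l => //; exact: mulr_ge0.
Qed.

(** Quadratic growth accommodates the remainder [3 (h y) ^ 2] that arises when a Gaussian
    expectation is differentiated in its frequency. *)
Definition gm h := measurable_fun setT h /\
  exists2 A, 0 <= A & forall y, `|h y| <= A * (1 + y ^+ 2).

Definition EG h : R := (\int[mu]_y (h y * p y))%R.

Let gm_dom h A y : 0 <= A -> `|h y| <= A * (1 + y ^+ 2) -> `|h y * p y| <= A * Kp * p2 y.
Proof.
move=> A0 hA; rewrite normrM (ger0_norm (p_ge0 _)).
apply: le_trans (ler_wpM2r (p_ge0 _) hA) _.
by rewrite -[leRHS]mulrA -[leLHS]mulrA; apply: ler_wpM2l => //; exact: p_dom.
Qed.

Let integrable_p2 (k : R) : mu.-integrable setT (EFin \o (fun y => k * p2 y)).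
Proof.
rewrite (_ : EFin \o _ = (fun y => k%:E * (p2 y)%:E)%E); last by apply/funext.
by apply: integrableZl => //; exact: integrable_normal_pdf.
Qed.

Lemma gm_integrable h : gm h -> mu.-integrable setT (EFin \o (fun y => h y * p y)).
Proof.
move=> [mh [A A0 hA]].
apply: (le_integrable _ _ _ (integrable_p2 (A * Kp))) => //.
- by apply/measurable_EFinP; exact: measurable_funM.
- move=> y _ /=; rewrite lee_fin.
  by apply: le_trans (gm_dom A0 (hA y)) _; exact: ler_norm.
Qed.

Lemma gm_bounded h (A : R) : measurable_fun setT h -> (forall y, `|h y| <= A) -> gm h.
Proof.
move=> mh hA; split => //; exists A; first exact: le_trans (hA 0).
have A0 : 0 <= A by exact: le_trans (hA 0).
by move=> y; apply: le_trans (hA y) _; rewrite ler_peMr// lerDl sqr_ge0.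
Qed.

Lemma gmD h1 h2 : gm h1 -> gm h2 -> gm (fun y => h1 y + h2 y).
Proof.
move=> [m1 [A A0 hA]] [m2 [B B0 hB]]; split; first exact: measurable_funD.
exists (A + B); first exact: addr_ge0.
by move=> y; rewrite mulrDl; apply: le_trans (ler_normD _ _) _; exact: lerD.
Qed.

Lemma gmZ (k : R) h : gm h -> gm (fun y => k * h y).
Proof.
move=> [m1 [A A0 hA]]; split; first exact: measurable_funM.
exists (`|k| * A); first exact: mulr_ge0.
by move=> y; rewrite normrM -mulrA ler_wpM2l.
Qed.

Lemma gmB h1 h2 : gm h1 -> gm h2 -> gm (fun y => h1 y - h2 y).
Proof.
move=> g1 g2; have := gmD g1 (gmZ (-1) g2).
by congr gm; apply/funext => y; rewrite mulN1r.
Qed.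

Lemma EGD h1 h2 : gm h1 -> gm h2 -> EG (fun y => h1 y + h2 y) = EG h1 + EG h2.
Proof.
move=> /gm_integrable i1 /gm_integrable i2; rewrite /EG -RintegralD//.
by apply: eq_Rintegral => y _; rewrite mulrDl.
Qed.

Lemma EGZ (k : R) h : gm h -> EG (fun y => k * h y) = k * EG h.
Proof.
move=> /gm_integrable i1; rewrite /EG -RintegralZl//.
by apply: eq_Rintegral => y _; rewrite mulrA.
Qed.

Lemma EGB h1 h2 : gm h1 -> gm h2 -> EG (fun y => h1 y - h2 y) = EG h1 - EG h2.
Proof.
move=> /gm_integrable i1 /gm_integrable i2; rewrite /EG -RintegralB//.
by apply: eq_Rintegral => y _; rewrite mulrBl.
Qed.

Lemma EG_le h1 h2 : gm h1 -> gm h2 -> (forall y, h1 y <= h2 y) -> EG h1 <= EG h2.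
Proof.
move=> /gm_integrable i1 /gm_integrable i2 h12; apply: le_Rintegral => // y _.
by rewrite ler_wpM2r.
Qed.

Lemma EG_norm h1 h2 : gm h1 -> gm h2 -> (forall y, `|h1 y| <= h2 y) -> `|EG h1| <= EG h2.
Proof.
move=> g1 g2 h12; rewrite ler_norml; apply/andP; split.
  rewrite -mulN1r -EGZ//; apply: EG_le => //; first exact: gmZ.
  by move=> y; have := h12 y; rewrite mulN1r ler_norml => /andP[].
by apply: EG_le => // y; have := h12 y; rewrite ler_norml => /andP[].
Qed.

Lemma EG_cst (k : R) : EG (fun=> k) = k.
Proof.
rewrite /EG RintegralZl//; last exact: integrable_normal_pdf.
by rewrite /Rintegral integral_normal_pdf mulr1.
Qed.

Let derive_p y : is_derive y 1 p (- y * p y).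
Proof.
rewrite pE (_ : p = (fun y => normal_peak (1 : R) * expR (- (y ^+ 2 / 2)))); last first.
  by apply/funext => x; exact: pE.
have d1 : is_derive y 1 (fun y => - (y ^+ 2 / 2)) (- y).
  by apply: is_derive_eq; rewrite /GRing.scale/=; field.
have d2 := @is_derive1_comp R expR (fun y => - (y ^+ 2 / 2)) y _ _ (is_derive_expR _) d1.
rewrite (_ : (fun _ => _) = cst (normal_peak 1) * (expR \o (fun y => - (y ^+ 2 / 2))))//.
by apply: is_derive_eq; rewrite /GRing.scale/=; ring.
Qed.

Let dlin r a y : is_derive y 1 (fun y : R => r * y + a) r.
Proof. by apply: is_derive_eq; rewrite /GRing.scale/=; ring. Qed.

Let dsin r a y : is_derive y 1 (fun y : R => sin (r * y + a)) (cos (r * y + a) * r).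
Proof.
exact: (@is_derive1_comp R sin (fun y => r * y + a) y _ _ (is_derive_sin _) (dlin r a y)).
Qed.

Let dcos r a y : is_derive y 1 (fun y : R => cos (r * y + a)) (- sin (r * y + a) * r).
Proof.
exact: (@is_derive1_comp R cos (fun y => r * y + a) y _ _ (is_derive_cos _) (dlin r a y)).
Qed.

Let mlin r a : measurable_fun setT (fun y : R => r * y + a).
Proof. by apply: measurable_funD => //; exact: measurable_funM. Qed.

Let gm_sin r a : gm (fun y => sin (r * y + a)).
Proof.
apply: (@gm_bounded _ 1); first exact: (measurableT_comp measurable_sin (mlin r a)).
by move=> y; rewrite ler_norml sin_geN1 sin_le1.
Qed.

Let gm_ycos r a : gm (fun y => y * cos (r * y + a)).
Proof.
split.
  by apply: measurable_funM => //; exact: (measurableT_comp measurable_cos (mlin r a)).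
exists 1 => // y; rewrite mul1r normrM.
apply: (@le_trans _ _ (`|y| * 1)).
  by rewrite ler_wpM2l// ler_norml cos_geN1 cos_le1.
rewrite mulr1 -(real_normK (num_real y)); have := normr_ge0 y; nra.
Qed.

Let gm_sqr : gm (fun y => y ^+ 2).
Proof.
split; first exact: measurable_funX.
by exists 1 => // y; rewrite mul1r ger0_norm ?sqr_ge0// lerDr.
Qed.

(** Gaussian integration by parts: the sum of the two integrands times the density is the derivative
    of [- p y * cos (r y + a)]. The formula is integrated over []-n, n]], the boundary terms tend to
    0, and dominated convergence gives the whole line. *)
Let stein r a : EG (fun y => y * cos (r * y + a)) = - r * EG (fun y => sin (r * y + a)).
Proof.
pose D y := (y * cos (r * y + a) + r * sin (r * y + a)) * p y.
pose H y := - (p y * cos (r * y + a)).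
have gD : gm (fun y => y * cos (r * y + a) + r * sin (r * y + a)).
  by apply: gmD => //; exact: gmZ.
have iD := gm_integrable gD.
suff H0 : (\int[mu]_y (D y) = 0)%R.
  move: H0; rewrite /D -/(EG (fun y => y * cos (r * y + a) + r * sin (r * y + a))).
  by rewrite EGD ?EGZ//; [lra|exact: gmZ].
have mD : measurable_fun setT D by apply: measurable_funM => //; case: gD.
pose f_ (n : nat) y : \bar R := (if - n%:R < y <= n%:R then D y else 0)%:E.
have cv : (\int[mu]_y f_ n y)%E @[n --> \oo] --> (\int[mu]_y (D y)%:E)%E.
  apply: (@dominated_cvg _ _ _ mu setT measurableT f_ (EFin \o D) (fun y => `|D y|%:E)).
  - move=> n; apply/measurable_EFinP; apply: measurable_fun_ifT => //.
    by apply: measurable_and; [exact: measurable_fun_ltr|exact: measurable_fun_ler].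
  - move=> y _; apply: cvg_near_cst; exists (Num.truncn `|y|).+1 => // n /= yn.
    have : `|y| < n%:R.
      by apply: lt_le_trans (truncnS_gt _) _; rewrite ler_nat.
    by rewrite ltr_norml /f_ => /andP[-> /ltW ->].
  - by [].
  - exact: (@integrable_abse _ _ _ mu setT (EFin \o D)).
  - move=> n y _; rewrite /f_ /= lee_fin; case: ifP => // _; by rewrite normr0.
have fE n : (\int[mu]_y f_ n y)%E = (H n%:R - H (- n%:R))%:E.
  have ab : - n%:R <= n%:R :> R by rewrite ge0_cp.
  have dH (u : R) : - n%:R <= u <= n%:R -> is_derive u 1 H (D u).
    move=> _; have ? := derive_p u; have ? := dcos r a u.
    by apply: is_derive_eq; rewrite /D /GRing.scale/=; ring.
  have cD (u : R) : - n%:R <= u <= n%:R -> {for u, continuous D}.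
    move=> _; have ? := derive_p u; have ? := dcos r a u; have ? := dsin r a u.
    by apply: is_derive_continuous.
  have [iI <-] := Rintegral_oc_FTC ab dH cD.
  rewrite /Rintegral fineK; last exact: integrable_fin_num.
  rewrite [RHS]integral_mkcond; apply: eq_integral => y _; rewrite patchE /f_.
  have [|] := boolP (y \in _); first by rewrite inE/= in_itv/= => ->.
  by rewrite notin_setE/= in_itv/= => /negP/negbTE ->.
have pn y : `|H y| <= normal_peak (1 : R) / (1 + y ^+ 2 / 2).
  rewrite /H normrN normrM (ger0_norm (p_ge0 _)).
  apply: (@le_trans _ _ (p y * 1)).
    by rewrite ler_wpM2l// ler_norml cos_geN1 cos_le1.
  rewrite mulr1 pE ler_wpM2l ?normal_peak_ge0// expRN lef_pV2 ?posrE ?expR_gt0//.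
    exact: expR_ge1Dx.
  have := sqr_ge0 y; lra.
have cv0 : (H n%:R - H (- n%:R))%:E @[n --> \oo] --> 0%:E.
  apply: cvg_EFin; first exact: nearW.
  apply/cvgrPdist_le => e e0; near=> n.
  have nb : (4 * normal_peak (1 : R)) / e <= n%:R by near: n; exact: nbhs_infty_ger.
  have n1 : 1 <= n%:R :> R by near: n; exact: nbhs_infty_ger.
  have k0 := @normal_peak_ge0 R 1.
  have bound : normal_peak (1 : R) / (1 + n%:R ^+ 2 / 2) <= e / 2.
    rewrite ler_pdivrMr; last nra.
    move: nb; rewrite ler_pdivrMr// => nb; nra.
  rewrite sub0r normrN; apply: le_trans (ler_normB _ _) _.
  have := pn n%:R; have := pn (- n%:R); rewrite sqrrN => h1 h2; lra.
have := cvg_unique _ cv; move: cv; rewrite (funext fE) => cv /(_ _ _).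
have E0 : (\int[mu]_y (D y)%:E)%E = 0%:E.
  exact: (cvg_unique _ cv cv0).
by rewrite /Rintegral E0.
Unshelve. all: by end_near. Qed.

(** By [stein] the expectation, as a function of [r], satisfies [phi' = - r phi], so
    [phi r * e^(r ^ 2 / 2)] is constant. The free phase [a] yields the cosine by a quarter turn. *)
Lemma EG_sin r a : EG (fun y => sin (r * y + a)) = expR (- (r ^+ 2 / 2)) * sin a.
Proof.
pose phi r := EG (fun y => sin (r * y + a)).
have dphi (x : R) : is_derive x 1 phi (- x * phi x).
  rewrite -stein; apply: (@is_derive_quadratic _ _ _ _ (3 * EG (fun y => y ^+ 2))) => h.
  rewrite /phi -EGB// -EGZ// -EGB//; [|exact: gmB|exact: gmZ].
  rewrite mulrAC -EGZ; last exact: gm_sqr.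
  apply: EG_norm; [by apply: gmB; [exact: gmB|exact: gmZ]|exact: gmZ|].
  move=> y; have -> : (x + h) * y + a = (x * y + a) + h * y by ring.
  rewrite mulrA; apply: le_trans (sin_add_approx _ _) _.
  by rewrite exprMn mulrA.
have cst_ x : phi x * expR (x ^+ 2 / 2) = phi 0 * expR (0 ^+ 2 / 2).
  apply: (@is_derive_0_is_cst R (fun x => phi x * expR (x ^+ 2 / 2))) => z.
  have d1 : is_derive z 1 (fun y => y ^+ 2 / 2) z.
    by apply: is_derive_eq; rewrite /GRing.scale/=; field.
  have d2 := @is_derive1_comp R expR (fun y => y ^+ 2 / 2) z _ _ (is_derive_expR _) d1.
  have ? := dphi z.
  rewrite (_ : (fun _ => _) = phi * (expR \o (fun y => y ^+ 2 / 2)))//.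
  by apply: is_derive_eq; rewrite /GRing.scale/=; ring.
have := cst_ r; rewrite expr0n/= mul0r expR0 mulr1 {2}/phi.
have -> : EG (fun y => sin (0 * y + a)) = sin a.
  rewrite -[RHS]EG_cst; congr EG; apply/funext => y; by rewrite mul0r add0r.
by rewrite expRN => <-; rewrite mulrC mulfK// gt_eqF// expR_gt0.
Qed.

Lemma EG_cos r a : EG (fun y => cos (r * y + a)) = expR (- (r ^+ 2 / 2)) * cos a.
Proof.
have sc x : sin (x + pi / 2) = cos x :> R.
  by rewrite sinD cos_pihalf sin_pihalf mulr0 mulr1 add0r.
rewrite -sc -EG_sin; congr EG; apply/funext => y.
by rewrite addrA sc.
Qed.

Lemma Phi_EG (x : R) : Phi x = EG (fun y => if y <= x then 1 else 0).
Proof.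
rewrite /Phi /normal_prob /EG /Rintegral; congr fine.
rewrite [LHS]integral_mkcond; apply: eq_integral => y _; rewrite patchE -/(p y).
have [|] := boolP (y \in _); first by rewrite inE/= in_itv/= => ->; rewrite mul1r.
by rewrite notin_setE/= in_itv/= => /negP/negbTE ->; rewrite mul0r.
Qed.

(** Fubini's theorem, with the density and the indicator of the unit interval moved into the
    integrand; [p2] supplies the integrable bound. *)
Lemma EG_I01 (k : R * R -> R) (A : R) : 0 <= A -> measurable_fun setT k ->
  (forall s y, 0 <= s <= 1 -> `|k (s, y)| <= A * (1 + y ^+ 2)) ->
  EG (fun y => I01 (fun s => k (s, y))) = I01 (fun s => EG (fun y => k (s, y))).
Proof.
move=> A0 mk kA.
pose F (q : R * R) : \bar R := (k q * p q.2 * \1_(`[0%R, 1%R]%classic : set R) q.1)%:E.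
have gk s : 0 <= s <= 1 -> gm (fun y => k (s, y)).
  move=> s01; split; last by exists A => // y; exact: kA.
  by apply: (measurableT_comp mk); exact: measurable_pair1.
have E1 : EG (fun y => I01 (fun s => k (s, y))) = fine (\int[mu]_y \int[mu]_s F (s, y))%E.
  rewrite /EG {1}/Rintegral; congr fine; apply: eq_integral => y _.
  have bk : bm (fun s => k (s, y)).
    apply: (@bm_mfun _ _ (A * (1 + y ^+ 2))); last by move=> s; exact: kA.
    by apply: (measurableT_comp mk); exact: measurable_pair2.
  have bkp : bm (fun s => k (s, y) * p y) := bmM bk (bm_cst (p y)).
  rewrite -(I01Zr (p y) bk) /I01 /Rintegral fineK.
    rewrite integral_mkcond; apply: eq_integral => s _; rewrite patchE /F/= indicE.
    by case: ifP => _ /=; rewrite ?mulr1 ?mulr0.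
  apply: integrable_fin_num; first exact: measurable_itv.
  exact: bm_integrable.
have E2 : I01 (fun s => EG (fun y => k (s, y))) = fine (\int[mu]_s \int[mu]_y F (s, y))%E.
  rewrite /I01 {1}/Rintegral; congr fine; rewrite [LHS]integral_mkcond.
  apply: eq_integral => s _; rewrite patchE; have [sI|sI] := boolP (s \in _).
    have s01 : 0 <= s <= 1 by move: sI; rewrite inE/= in_itv/=.
    rewrite fineK.
      by apply: eq_integral => y _; rewrite /F/= indicE sI mulr1.
    exact: (integrable_fin_num measurableT (gm_integrable (gk s s01))).
  rewrite (_ : (fun _ => _) = cst 0%E).
    by rewrite integral_cst ?mul0e.
  by apply/funext => y; rewrite /F/= indicE (negbTE sI) mulr0.
have mind : measurable_fun setT (\1_(`[0%R, 1%R]%classic : set R) : R -> R) by [].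
have mF : measurable_fun setT F.
  apply/measurable_EFinP; apply: measurable_funM.
    apply: measurable_funM => //.
    exact: (measurableT_comp mp measurable_snd).
  exact: (measurableT_comp mind measurable_fst).
have iF : (mu \x mu)%E.-integrable setT F.
  apply/(integrable12ltyP _) => //.
  apply: (@le_lt_trans _ _ (\int[mu]_s ((A * Kp) * \1_(`[0%R, 1%R]%classic : set R) s)%:E)%E).
    apply: ge0_le_integral => //=.
    - by move=> s _; apply: integral_ge0.
    - apply: (@measurable_fun_fubini_tonelli_F _ _ _ _ _ mu (abse \o F)).
        by apply: measurableT_comp.
      by move=> x; exact: abse_ge0.
    - by apply/measurable_EFinP; exact: measurable_funM.
    - move=> s _; rewrite indicE; case: (boolP (s \in _)) => [|sN]; last first.
        rewrite mulr0 (eq_integral (cst 0%E)) ?integral_cst ?mul0e// => y _.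
        by rewrite mulr0 normr0.
      rewrite inE/= in_itv/= => s01; rewrite mulr1.
      have -> : (A * Kp)%:E = (\int[mu]_y (A * Kp * p2 y)%:E)%E.
        under eq_integral do rewrite EFinM.
        rewrite integralZl//; last exact: integrable_normal_pdf.
        by rewrite integral_normal_pdf mule1.
      apply: ge0_le_integral => //=.
      + apply/measurable_EFinP; apply: measurableT_comp => //.
        apply: measurable_funM => //; apply: measurable_funM => //.
        by apply: (measurableT_comp mk); exact: measurable_pair1.
      + by apply/measurable_EFinP; apply: measurable_funM => //; exact: measurable_normal_pdf.
      + by move=> y _; rewrite lee_fin mulr1; exact: (@gm_dom (fun y => k (s, y)) A y A0 (kA s y s01)).
  under eq_integral do rewrite EFinM.
  rewrite integralZl//; last first.
    apply/integrableP; split; first by apply/measurable_EFinP.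
    under eq_integral do rewrite gee0_abs ?lee_fin//.
    by rewrite integral_indic//= setIT lebesgue_measure_itv/= lte_fin ltr01 -EFinB ltry.
  by rewrite integral_indic//= setIT lebesgue_measure_itv/= lte_fin ltr01 -EFinB -EFinM ltry.
by rewrite E1 E2; congr fine; rewrite (Fubini iF).
Qed.

(** From [e^(- x ^ 2) <= 1 / (1 + x ^ 2)]: the integral is at most an arctangent over [k], and
    [pi / 2 < 2]. *)
Lemma I01_gauss_le (k : R) : 0 < k -> I01 (fun s => expR (- (k * s) ^+ 2)) <= 2 / k.
Proof.
move=> k0.
have dk (s : R) : is_derive s 1 (fun s : R => k * s) k.
  by apply: is_derive_eq; rewrite /GRing.scale/=; ring.
have dat (s : R) : is_derive s 1 (fun s : R => atan (k * s)) ((1 + (k * s) ^+ 2)^-1 * k).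
  exact: (@is_derive1_comp R atan (fun s => k * s) s _ _ (is_derive1_atan _) (dk s)).
have pos (s : R) : 0 < 1 + (k * s) ^+ 2 by have := sqr_ge0 (k * s); lra.
have H1 (s : R) : 0 <= s <= 1 ->
    is_derive s 1 (fun s : R => atan (k * s) * k^-1) ((1 + (k * s) ^+ 2)^-1).
  move=> _; have ? := dat s; apply: is_derive_eq; rewrite /GRing.scale/=.
  have := pos s; move: ((k * s) ^+ 2) => w w0; field; rewrite !gt_eqF//.
have H2 (s : R) : 0 <= s <= 1 ->
    {for s, continuous (fun s : R => (1 + (k * s) ^+ 2)^-1)}.
  move=> _; have d2 : is_derive s 1 (fun s : R => 1 + (k * s) ^+ 2) (2 * k ^+ 2 * s).
    by apply: is_derive_eq; rewrite /GRing.scale/=; ring.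
  have n0 : 1 + (k * s) ^+ 2 != 0 by rewrite gt_eqF.
  exact: is_derive_continuous (@is_deriveV R (fun s : R => 1 + (k * s) ^+ 2) s _ 1 n0 d2).
have mks : measurable_fun setT (fun s : R => (k * s) ^+ 2).
  by apply: measurable_funX; exact: measurable_funM.
apply: (@le_trans _ _ (I01 (fun s => (1 + (k * s) ^+ 2)^-1))).
  apply: I01_le.
  - apply: (@bm_mfun _ _ 1).
      by apply: measurableT_comp => //; exact: measurableT_comp.
    by move=> s _; rewrite ger0_norm ?expR_ge0// expR_le1 oppr_le0 sqr_ge0.
  - apply: (@bm_mfun _ _ 1).
      apply: (measurableT_comp measurable_inv); exact: measurable_funD.
    move=> s _; rewrite ger0_norm ?invr_ge0 ?(ltW (pos _))//.
    by rewrite invf_le1// lerDl sqr_ge0.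
  - move=> s _; rewrite expRN lef_pV2 ?posrE ?expR_gt0//; exact: expR_ge1Dx.
rewrite (I01_FTC H1 H2) mulr1 mulr0 atan0 mul0r subr0 ler_wpM2r ?invr_ge0 ?(ltW k0)//.
exact: le_trans (ltW (atan_ltpi2 _)) (ltW (@pihalf_lt2 R)).
Qed.

Let gm_kernel (g : R -> R) (K : R) (d b v : R) : measurable_fun setT g ->
  (forall z, `|g z| <= K * (1 + `|z|)) -> gm (fun y => g (d * (b - v * y))).
Proof.
move=> mg gK; have K0 : 0 <= K.
  by have := gK 0; rewrite normr0 addr0 mulr1; apply: le_trans.
split.
  by apply: (measurableT_comp mg); apply: measurable_funM => //; apply: measurable_funB => //; exact: measurable_funM.
exists (K * (1 + `|d| * `|b| + `|d| * `|v|)).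
  by rewrite mulr_ge0// !addr_ge0// mulr_ge0.
move=> y; apply: le_trans (gK _) _; rewrite -mulrA ler_wpM2l//.
have h1 : `|d * (b - v * y)| <= `|d| * `|b| + `|d| * `|v| * `|y|.
  rewrite normrM -mulrA -mulrDr ler_wpM2l// (le_trans (ler_normB _ _))// normrM.
  exact: lexx.
have h2 : `|y| <= 1 + y ^+ 2.
  rewrite -(real_normK (num_real y)); have := normr_ge0 y; nra.
have : `|d| * `|v| * `|y| <= `|d| * `|v| * (1 + y ^+ 2) by rewrite ler_wpM2l ?mulr_ge0.
have : 0 <= `|d| * `|b| * y ^+ 2 := mulr_ge0 (mulr_ge0 (normr_ge0 _) (normr_ge0 _)) (sqr_ge0 y).
have := sqr_ge0 y; lra.
Qed.

(** The kernel inequality is integrated at [z = d (b - v Y)] with [Y] standard normal. Exchanging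
    integrals leaves only Gaussian characteristic functions at frequencies up to [d]; in the error
    term the oscillating factor is bounded by 1. *)
Lemma gaussian_smoothing (L C : R) : 0 < L -> 0 <= C ->
  (forall z : R, `|(if 0 <= z then 1 else 0) - 2^-1 - kQ z / (2 * L)| <= C * kpsi z) ->
  forall d v b : R, 0 < d -> 0 < v ->
  `|Phi (b / v) - 2^-1 - I01 (fun s => (1 - s ^+ 2) *
      (expR (- ((d * v * s) ^+ 2 / 2)) * sin (s * (d * b)) / s)) / (2 * L)|
  <= C * (2 * I01 (fun s => expR (- ((d * v * s) ^+ 2 / 2)))).
Proof.
move=> L0 C0 ker d v b d0 v0.
have msn (k : R * R -> R) : measurable_fun setT k -> measurable_fun setT (fun q => sin (k q)).
  exact: (measurableT_comp measurable_sin).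
have mcs (k : R * R -> R) : measurable_fun setT k -> measurable_fun setT (fun q => cos (k q)).
  exact: (measurableT_comp measurable_cos).
have marg : measurable_fun setT (fun q : R * R => q.1 * (d * (b - v * q.2))).
  apply: measurable_funM => //; apply: measurable_funM => //.
  by apply: measurable_funB => //; exact: measurable_funM.
have e0 s : 0 <= expR (- ((d * v * s) ^+ 2 / 2)) by exact: expR_ge0.
have e1 s : expR (- ((d * v * s) ^+ 2 / 2)) <= 1.
  by rewrite expR_le1 oppr_le0 divr_ge0// sqr_ge0.
have mE : measurable_fun setT (fun s : R => expR (- ((d * v * s) ^+ 2 / 2))).
  apply: measurableT_comp => //; apply: measurableT_comp => //.
  by apply: measurable_funM => //; apply: measurable_funX; exact: measurable_funM.
have bE : bm (fun s : R => expR (- ((d * v * s) ^+ 2 / 2))).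
  by apply: (@bm_mfun _ _ 1) => // s _; rewrite ger0_norm.
have mkQ : measurable_fun setT (@kQ R).
  apply: continuous_measurable_fun => z; exact: is_derive_continuous (kQ_derive z).
have kF1 z : `|kF z| <= 1 :> R.
  rewrite -[leRHS]I01_cst; apply: I01_norm; [exact: kF_bm|exact: bm_cst|].
  move=> s /andP[s0 s1]; rewrite normrM -[leRHS]mulr1 ler_pM//.
    by rewrite ler_norml; apply/andP; split; lra.
  by rewrite ler_norml cos_geN1 cos_le1.
have mkF : measurable_fun setT (@kF R).
  rewrite (_ : @kF R = (fun z => if z == 0 then kF 0 else (1 - cos z) / z ^+ 2)).
    apply: measurable_fun_ifT => //; first exact: measurable_fun_eqr.
    apply: measurable_funM.
      by apply: measurable_funB => //; exact: measurable_cos.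
    by apply: (measurableT_comp measurable_inv); exact: measurable_funX.
  apply/funext => z; case: eqP => [->//|/eqP z0].
  by rewrite -kFE mulrAC divff ?mul1r// expf_neq0.
have argE s y w : s * (d * (b - v * y) + w) = - (d * v * s) * y + s * (d * b + w) by ring.
have EF w : EG (fun y => kF (d * (b - v * y) + w)) <=
    I01 (fun s => expR (- ((d * v * s) ^+ 2 / 2))).
  have -> : EG (fun y => kF (d * (b - v * y) + w)) =
      I01 (fun s => (1 - s) * (expR (- ((d * v * s) ^+ 2 / 2)) * cos (s * (d * b + w)))).
    rewrite /kF.
    rewrite (@EG_I01 (fun q => (1 - q.1) * cos (q.1 * (d * (b - v * q.2) + w))) 1)//.
    - apply: I01_eq => s s01.
      rewrite /= EGZ; last first.
        apply: (@gm_bounded _ 1); last by move=> y; rewrite ler_norml cos_geN1 cos_le1.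
        apply: (measurableT_comp measurable_cos); apply: measurable_funM => //.
        apply: measurable_funD => //; apply: measurable_funM => //.
        by apply: measurable_funB => //; exact: measurable_funM.
      congr (_ * _); rewrite -[(d * v * s) ^+ 2]sqrrN -EG_cos; congr EG.
      by apply/funext => y; rewrite argE.
    - apply: measurable_funM; first by apply: measurable_funB.
      apply: mcs; apply: measurable_funM => //; apply: measurable_funD => //.
      by apply: measurable_funM => //; apply: measurable_funB => //; exact: measurable_funM.
    - move=> s y /andP[s0 s1]; rewrite mul1r normrM.
      apply: (@le_trans _ _ (1 * 1)); last by rewrite mulr1 lerDl sqr_ge0.
      apply: ler_pM => //=; last by rewrite ler_norml cos_geN1 cos_le1.
      by rewrite ler_norml; apply/andP; split; lra.
  apply: I01_le => //.
    by apply: bmM; [exact: bm_onem|apply: bmM => //; exact: bm_cos].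
  move=> s /andP[s0 s1]; apply: (@le_trans _ _ (1 * (expR (- ((d * v * s) ^+ 2 / 2)) * 1))).
    apply: (@le_trans _ _ ((1 - s) * (expR (- ((d * v * s) ^+ 2 / 2)) * 1))).
      by apply: ler_wpM2l; [lra|apply: ler_wpM2l => //; exact: cos_le1].
    by apply: ler_wpM2r; [rewrite mulr1|lra].
  by rewrite mul1r mulr1.
have EQ : EG (fun y => kQ (d * (b - v * y))) = I01 (fun s => (1 - s ^+ 2) *
      (expR (- ((d * v * s) ^+ 2 / 2)) * sin (s * (d * b)) / s)).
  rewrite /kQ (@EG_I01 (fun q => (1 - q.1 ^+ 2) * (sin (q.1 * (d * (b - v * q.2))) / q.1))
    (`|d * b| + `|d * v|)).
  - apply: I01_eq => s s01.
    have gs : gm (fun y => sin (s * (d * (b - v * y)))).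
      apply: (@gm_bounded _ 1); last by move=> y; rewrite ler_norml sin_geN1 sin_le1.
      apply: (measurableT_comp measurable_sin); apply: measurable_funM => //.
      apply: measurable_funM => //.
      by apply: measurable_funB => //; exact: measurable_funM.
    rewrite (_ : (fun _ => _) = (fun y => ((1 - s ^+ 2) / s) * sin (s * (d * (b - v * y))))); last first.
      by apply/funext => y /=; ring.
    rewrite EGZ// -[(d * v * s) ^+ 2]sqrrN -EG_sin.
    have -> : (fun y => sin (s * (d * (b - v * y)))) = (fun y => sin (- (d * v * s) * y + s * (d * b))).
      by apply/funext => y; congr sin; ring.
    by ring.
  - by rewrite addr_ge0.
  - apply: measurable_funM; first by apply: measurable_funB => //; apply: measurable_funX.
    apply: measurable_funM; first exact: msn.
    exact: (measurableT_comp measurable_inv).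
  - move=> s y /andP[s0 s1]; rewrite normrM.
    apply: (@le_trans _ _ (1 * `|d * (b - v * y)|)).
      apply: ler_pM => //=; last exact: sin_div_le.
      by rewrite ler_norml; apply/andP; split; nra.
    rewrite mul1r mulrBr (le_trans (ler_normB _ _))// mulrA (normrM (d * v)).
    have h2 : `|y| <= 1 + y ^+ 2.
      rewrite -(real_normK (num_real y)); have := normr_ge0 y; nra.
    rewrite mulrDl lerD//; last by rewrite ler_wpM2l.
    by rewrite ler_peMr// lerDl sqr_ge0.
have g1 : gm (fun y => if 0 <= d * (b - v * y) then 1 else 0 : R).
  apply: (@gm_bounded _ 1); last by move=> y; case: ifP; rewrite ?normr1 ?normr0.
  apply: measurable_fun_ifT => //; apply: measurable_fun_ler => //.
  by apply: measurable_funM => //; apply: measurable_funB => //; exact: measurable_funM.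
have gQ : gm (fun y => kQ (d * (b - v * y))).
  apply: (@gm_kernel _ 1) => // z; rewrite mul1r.
  by apply: le_trans (kQ_le z) _; rewrite lerDr.
have gQ2 : gm (fun y => kQ (d * (b - v * y)) / (2 * L)).
  by under eq_fun do rewrite mulrC; exact: gmZ.
have gF w : gm (fun y => kF (d * (b - v * y) + w)).
  apply: (@gm_bounded _ 1) => // .
  apply: (measurableT_comp mkF); apply: measurable_funD => //; apply: measurable_funM => //.
  by apply: measurable_funB => //; exact: measurable_funM.
have gc : gm (fun=> 2^-1 : R) by apply: (@gm_bounded _ 2^-1) => // y; rewrite ger0_norm.
have gp : gm (fun y => kpsi (d * (b - v * y))).
  rewrite /kpsi; apply: gmD => //; by have := gF 0; under eq_fun do rewrite addr0.
have main := EG_norm (gmB (gmB g1 gc) gQ2) (gmZ C gp) (fun y => ker (d * (b - v * y))).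
move: main; rewrite (EGB (gmB g1 gc) gQ2) (EGB g1 gc) EG_cst (EGZ C gp).
have -> : EG (fun y => kQ (d * (b - v * y)) / (2 * L)) =
    EG (fun y => kQ (d * (b - v * y))) / (2 * L).
  by rewrite [RHS]mulrC -EGZ//; congr EG; apply/funext => y; rewrite mulrC.
have -> : EG (fun y => if 0 <= d * (b - v * y) then 1 else 0) = Phi (b / v).
  rewrite Phi_EG; congr EG; apply/funext => y.
  by rewrite pmulr_rge0// subr_ge0 ler_pdivlMr// mulrC.
rewrite EQ => /le_trans; apply; rewrite ler_wpM2l//.
have -> : EG (fun y => kpsi (d * (b - v * y))) =
    EG (fun y => kF (d * (b - v * y) + 0)) + EG (fun y => kF (d * (b - v * y) + 1)).
  by rewrite -(EGD (gF 0) (gF 1)); congr EG; apply/funext => y; rewrite addr0.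
rewrite [leRHS]mulr_natl mulr2n; exact: lerD.
Qed.

End gaussian.

(** * Conditioning on the past *)

Section filtration.
Context {R : realType} {d : measure_display} {T : measurableType d}.
Variables (P : probability T R) (U : nat -> {RV P >-> R}).
Hypothesis hind : mutually_independent P (fun n => (U n : T -> R)).
Hypothesis hunif : forall n (B : set R), measurable B ->
  P (U n @^-1` B) = uniform_prob (@ltr01 R) B.

(** Events specified coordinatewise by the [U i] with [i < n]. They are stable under intersection
    and generate the past at time [n], denoted [TF n]. *)
Definition cylinder (n : nat) : set (set T) :=
  [set A | exists2 B : nat -> set R, (forall i, measurable (B i)) &
     A = \bigcap_(i in [set` iota 0 n]) (U i @^-1` B i)].

Notation TF n := (g_sigma_algebraType (cylinder n)).

Let in_iota0 n i : [set` iota 0 n] i <-> (i < n)%N.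
Proof. by rewrite /mkset mem_iota add0n. Qed.

Lemma measurable_RV (n : nat) (B : set R) : measurable B -> measurable (U n @^-1` B).
Proof. by move=> mB; rewrite -[X in measurable X]setTI; exact: measurable_funP. Qed.

Lemma cylinder_measurable n : cylinder n `<=` measurable.
Proof.
move=> A [B mB ->]; apply: fin_bigcap_measurable; first exact: finite_seq.
by move=> i _; exact: measurable_RV.
Qed.

Lemma cylinder_setI n : setI_closed (cylinder n).
Proof.
move=> _ _ [B mB ->] [C mC ->]; exists (fun i => B i `&` C i).
  by move=> i; exact: measurableI.
by rewrite -bigcapI; apply: eq_bigcapr => i _; rewrite preimage_setI.
Qed.

Lemma cylinder_setT n : cylinder n setT.
Proof.
exists (fun=> setT) => //; apply/esym; rewrite -subTset => x _ i _.
by rewrite preimage_setT.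
Qed.

Lemma sigma_cylinder_measurable n : <<s cylinder n >> `<=` measurable.
Proof.
apply: smallest_sub; last exact: cylinder_measurable.
exact: sigma_algebra_measurable.
Qed.

Lemma cylinder_subS n : cylinder n `<=` cylinder n.+1.
Proof.
move=> A [B mB ->]; exists (fun i => if i == n then setT else B i).
  by move=> i; case: ifP.
apply/seteqP; split => w wB i /in_iota0 i_n.
  case: eqP => [_|/eqP ni]; first by rewrite preimage_setT.
  by apply: wB; apply/in_iota0; rewrite ltn_neqAle ni -ltnS.
have /wB : [set` iota 0 n.+1] i by apply/in_iota0; exact: ltn_trans i_n (ltnSn n).
by rewrite (ltn_eqF i_n).
Qed.

Lemma measurable_TF_S n (D : measure_display) (Y : measurableType D) (f : T -> Y) :
  measurable_fun [set: TF n] (f : TF n -> Y) ->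
  measurable_fun [set: TF n.+1] (f : TF n.+1 -> Y).
Proof.
move=> mf _ B mB; have := mf measurableT B mB; apply: sub_sigma_algebra2.
exact: cylinder_subS.
Qed.

Lemma measurable_TF_U n : measurable_fun [set: TF n.+1] (U n : TF n.+1 -> R).
Proof.
move=> _ B mB; apply: sub_sigma_algebra; exists (fun i => if i == n then B else setT).
  by move=> i; case: ifP.
rewrite setTI; apply/seteqP; split => w.
  by move=> wB i _; case: eqP => [->//|_]; rewrite preimage_setT.
have nn : [set` iota 0 n.+1] n by apply/in_iota0.
by move=> /(_ n nn); rewrite eqxx.
Qed.

Lemma measurable_TF n (D : measure_display) (Y : measurableType D) (f : T -> Y) :
  measurable_fun [set: TF n] (f : TF n -> Y) -> measurable_fun [set: T] f.
Proof.
move=> mf _ B mB; have := mf measurableT B mB; exact: sigma_cylinder_measurable.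
Qed.

(** For fixed [B] both sides are finite measures in [A] that agree on cylinders by independence,
    hence on the generated sigma-algebra. *)
Lemma independent_next n (A : set T) (B : set R) : <<s cylinder n >> A -> measurable B ->
  P (A `&` U n @^-1` B) = (P A * uniform_prob (@ltr01 R) B)%E.
Proof.
move=> sA mB; have mC := measurable_RV n mB.
pose q : {nonneg R} := NngNum (fine_ge0 (measure_ge0 P (U n @^-1` B))).
have qE : q%:num%:E = P (U n @^-1` B) by rewrite /= fineK ?fin_num_measure.
have key : mrestr P mC A = mscale q P A; last first.
  by rewrite -[LHS]/(mrestr P mC A) key /mscale/= [X in (X * _)%E]qE hunif// muleC.
have agree : forall A, cylinder n A -> mrestr P mC A = mscale q P A.
  move=> _ [C mC' ->]; rewrite /mrestr /mscale/= [X in (X * _)%E]qE.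
  pose C' i := if i == n then B else C i.
  have mCC i : measurable (C' i) by rewrite /C'; case: ifP.
  have := hind (iota_uniq 0 n.+1) mCC; have := hind (iota_uniq 0 n) mC'.
  have iS : iota 0 n.+1 = rcons (iota 0 n) n by rewrite -addn1 iotaD cats1.
  have CnE : C' n = B by rewrite /C' eqxx.
  move=> h1; rewrite iS -cats1 big_cat big_seq1 CnE.
  have -> : (\big[*%E/1%E]_(i <- iota 0 n) P (U i @^-1` C' i))%E =
            (\big[*%E/1%E]_(i <- iota 0 n) P (U i @^-1` C i))%E.
    rewrite !big_seq; apply: eq_bigr => i; rewrite mem_iota add0n /= => i_n.
    by rewrite /C' (ltn_eqF i_n).
  rewrite -h1 muleC => <-; congr (P _).
  apply/seteqP; split => w.
    move=> [wC wB] i /=; rewrite cats1 mem_rcons inE /C' => /orP[/eqP ->|i_n].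
      by rewrite eqxx.
    case: eqP => [->//|_]; exact: wC.
  move=> wC; split.
    move=> i /= i_n; have := wC i; rewrite /= cats1 mem_rcons inE i_n orbT => /(_ isT).
    by move: i_n; rewrite mem_iota add0n /= => i_n; rewrite /C' (ltn_eqF i_n).
  have := wC n; rewrite /= cats1 mem_rcons inE eqxx => /(_ isT).
  by rewrite /C' eqxx.
have fin (k : nat) : (mrestr P mC ((fun=> setT) k : set T) < +oo)%E.
  by rewrite ltey_eq /mrestr fin_num_measure//; exact: measurableI.
have cover : \bigcup_(k : nat) (setT : set T) = setT.
  by rewrite -subTset => x _; exists 0%N.
exact: (@g_sigma_algebra_measure_unique _ _ _ (cylinder n) (@cylinder_measurable n)
  (fun=> setT) (fun=> cylinder_setT n) cover (mrestr P mC) (mscale q P)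
  (@cylinder_setI n) agree fin A sA).
Qed.

Let idF n : T -> TF n := id.

Let idF_measurable n : measurable_fun [set: T] (idF n).
Proof. by move=> _ B mB; rewrite setTI; exact: (@sigma_cylinder_measurable n B mB). Qed.

Let pairF n (w : T) : TF n * measurableTypeR R := (idF n w, U n w).

Let pairF_measurable n : measurable_fun [set: T] (pairF n).
Proof.
apply: measurable_fun_pair; first exact: idF_measurable.
exact: (measurable_funPT (U n)).
Qed.

(** The pair formed by the identity into [TF n] and [U n] has a product law, so Tonelli integrates
    out the next variable. Equipping [T] with the smaller sigma-algebra takes the place of
    conditional expectations. *)
Lemma integral_next_ge0 n (h : TF n * measurableTypeR R -> \bar R) :
  measurable_fun setT h -> (forall q, 0 <= h q)%E ->
  (\int[P]_w h (w, U n w) = \int[P]_w \int[lebesgue_measure]_(u in `[0%R, 1%R]) h (w, u))%E.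
Proof.
move=> mh h0.
pose X : {mfun T >-> TF n} := mfun_Sub (mem_set (@idF_measurable n)).
pose J : {mfun T >-> (TF n * measurableTypeR R)%type} := mfun_Sub (mem_set (@pairF_measurable n)).
have JE := @ge0_integral_distribution _ _ _ _ _ P J h mh h0.
have -> : (\int[P]_w h (w, U n w) = \int[distribution P J]_q h q)%E by rewrite JE.
have -> : (\int[distribution P J]_q h q =
    \int[distribution P X \x uniform_prob (@ltr01 R)]_q h q)%E.
  apply: eq_measure_integral => A mA _; apply/esym.
  apply: (@product_measure_unique _ _ _ _ _ (distribution P X) (uniform_prob (@ltr01 R))
    (distribution P J)) => // B C mB mC.
  by rewrite /= /distribution /pushforward/= -(@independent_next n).
rewrite fubini_tonelli1//.
have mF := @measurable_fun_fubini_tonelli_F _ _ _ _ _ (uniform_prob (@ltr01 R)) h mh h0.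
rewrite (@ge0_integral_distribution _ _ _ _ _ P X _ mF); last first.
  by move=> y; apply: integral_ge0.
apply: eq_integral => w _ /=.
rewrite /fubini_F integral_uniform//.
  by rewrite subr0 invr1 mul1e.
by apply: (measurableT_comp mh); exact: measurable_pair1.
Qed.

Definition EP (h : T -> R) : R := (\int[P]_w h w)%R.

Lemma bounded_integrable (h : T -> R) (M : R) : measurable_fun setT h ->
  (forall w, `|h w| <= M) -> P.-integrable setT (EFin \o h).
Proof.
move=> mh hM; apply: measurable_bounded_integrable => //.
  by rewrite ltey_eq fin_num_measure.
exists M; split; first exact: num_real.
by move=> x Mx w _; apply: le_trans (hM w) (ltW Mx).
Qed.

Lemma EP_cst (k : R) : EP (fun=> k) = k.
Proof. by rewrite /EP Rintegral_cst//= (probability_setT P) mulr1. Qed.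

Lemma EP_next n (h : T -> R -> R) (M : R) :
  measurable_fun [set: TF n * R] (fun q : TF n * R => h q.1 q.2) ->
  (forall w u, `|h w u| <= M) ->
  EP (fun w => h w (U n w)) = EP (fun w => I01 (h w)).
Proof.
move=> mh hM.
(* The shift by [M] reduces the bounded case to the nonnegative one. *)
pose g (q : TF n * R) : \bar R := (h q.1 q.2 + M)%:E.
have mg : measurable_fun setT g.
  by apply/measurable_EFinP; exact: measurable_funD.
have g0 q : (0 <= g q)%E.
  by rewrite lee_fin; have := hM q.1 q.2; rewrite ler_norml => /andP[+ _]; lra.
have := integral_next_ge0 mg g0; rewrite /g/=.
have mhw w : measurable_fun setT (h w).
  exact: (measurableT_comp mh (measurable_pair1 (w : TF n))).
have bh w : bm (h w) by apply: (@bm_mfun _ _ M).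
have mU : measurable_fun [set: T] (fun w => h w (U n w)).
  exact: (measurableT_comp mh (@pairF_measurable n)).
have i1 : P.-integrable setT (EFin \o (fun w => h w (U n w))).
  by apply: (bounded_integrable mU) => w; exact: hM.
have icst : P.-integrable setT (EFin \o (fun=> M)).
  by apply: (@bounded_integrable _ `|M|).
have e1 : (\int[P]_w (h w (U n w) + M)%:E = (EP (fun w => h w (U n w)) + M)%:E)%E.
  rewrite -{2}[M]EP_cst /EP -RintegralD// /Rintegral fineK//.
  by apply: integrable_fin_num => //; exact: integrableD i1 icst.
have I01E w : (\int[lebesgue_measure]_(u in `[0%R, 1%R]) (h w u + M)%:E = (I01 (h w) + M)%:E)%E.
  rewrite -{2}[M]I01_cst -I01D//; last exact: bm_cst.
  rewrite /I01 /Rintegral fineK//; apply: integrable_fin_num => //.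
  by apply: bm_integrable; apply: bmD => //; exact: bm_cst.
rewrite e1; under eq_integral do rewrite I01E.
have mI : measurable_fun [set: T] (fun w => I01 (h w)).
  apply: (@measurable_TF n).
  have := @measurable_fun_fubini_tonelli_F _ _ _ _ _ (uniform_prob (@ltr01 R)) g mg g0.
  move=> mF.
  rewrite (_ : (fun w => I01 (h w)) = (fun w => fine (fubini_F (uniform_prob (@ltr01 R)) g w) - M)).
    apply: measurable_funB => //.
    exact: (measurableT_comp (@fine_measurable R setT measurableT) mF).
  apply/funext => w; rewrite /fubini_F integral_uniform//.
    by rewrite subr0 invr1 mul1e /g/= I01E/= addrK.
  exact: (measurableT_comp mg (measurable_pair1 (w : TF n))).
have IM w : `|I01 (h w)| <= M.
  by rewrite -[leRHS]I01_cst; apply: I01_norm => //; exact: bm_cst.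
have i2 := bounded_integrable mI IM.
have -> : (\int[P]_w (I01 (h w) + M)%:E = (EP (fun w => I01 (h w)) + M)%:E)%E.
  rewrite -{2}[M]EP_cst /EP -RintegralD// /Rintegral fineK//.
  by apply: integrable_fin_num => //; exact: integrableD i2 icst.
by move=> [] /addIr.
Qed.

End filtration.

(** * The splitting process *)

Section sequences.
Context {R : realType}.
Implicit Types (s : seq R) (u : nat -> R).

Lemma seqmax_ge s x : x \in s -> x <= seqmax s.
Proof.
rewrite /seqmax; elim: s => // y s IH; rewrite inE big_cons le_max => /orP[/eqP ->|/IH ->].
  by rewrite lexx.
by rewrite orbT.
Qed.

Lemma seqmax_mem s : (0 < size s)%N -> (forall x, x \in s -> 0 <= x) -> seqmax s \in s.
Proof.
elim: s => // y s IH _ pos.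
have y0 : 0 <= y by apply: pos; rewrite inE eqxx.
have [s0|s0] := posnP (size s).
  by move/size0nil: s0 => ->; rewrite /seqmax big_cons big_nil max_l// inE eqxx.
have /(IH s0) {}IH : forall x, x \in s -> 0 <= x.
  by move=> x xs; apply: pos; rewrite inE xs orbT.
rewrite {1}/seqmax big_cons -/(seqmax s) inE; case: leP => _; first by rewrite IH orbT.
by rewrite eqxx.
Qed.

Definition unit_valued u := forall n, 0 <= u n <= 1.

Lemma kak_lengths_inv u n : unit_valued u ->
  [/\ size (kak_lengths u n) = n.+1, (forall x, x \in kak_lengths u n -> 0 <= x) &
      \sum_(x <- kak_lengths u n) x = 1].
Proof.
move=> u01; elim: n => [|n [IH1 IH2 IH3]].
  by split => [//|x|]; [rewrite inE => /eqP -> | rewrite /= big_seq1].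
have mem : seqmax (kak_lengths u n) \in kak_lengths u n by apply: seqmax_mem; rewrite ?IH1.
have /andP[u0 u1] := u01 n.
rewrite [kak_lengths u n.+1]/=; set s := kak_lengths u n in IH1 IH2 IH3 mem *.
set m := seqmax s in mem *; set j := index m s.
have js : (j < size s)%N by rewrite index_mem.
have nj : nth 0 s j = m by rewrite nth_index.
have m0 : 0 <= m by exact: IH2.
have sE : s = take j s ++ m :: drop j.+1 s by rewrite -nj -drop_nth// cat_take_drop.
split.
- rewrite size_cat/= size_take js size_drop -IH1.
  by rewrite -[in RHS](subnKC js) addSn !addnS.
- move=> x; rewrite mem_cat !inE => /orP[/mem_take/IH2//|/orP[/eqP ->|/orP[/eqP ->|/mem_drop/IH2//]]].
    exact: mulr_ge0.
  by rewrite mulr_ge0// subr_ge0.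
- rewrite big_cat/= !big_cons.
  have E3 : \sum_(x <- take j s) x + (m + \sum_(x <- drop j.+1 s) x) = 1.
    by rewrite -IH3 [in RHS]sE big_cat/= big_cons.
  by rewrite -[RHS]E3; ring.
Qed.

Lemma kak_max_mem u n : unit_valued u -> kak_max u n \in kak_lengths u n.
Proof.
by move=> u01; have [h1 h2 _] := kak_lengths_inv n u01; apply: seqmax_mem; rewrite ?h1.
Qed.

Lemma kak_max_bound u n : unit_valued u -> 0 <= kak_max u n <= 1.
Proof.
move=> u01; have [_ h2 h3] := kak_lengths_inv n u01.
have mem := kak_max_mem n u01.
rewrite h2//=; move: h3; rewrite (perm_big _ (perm_to_rem mem)) big_cons/= => <-.
rewrite lerDl big_seq sumr_ge0// => x /mem_rem; exact: h2.
Qed.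

Lemma prod_del {A : comPzRingType} (w : R -> A) s j : (j < size s)%N ->
  \prod_(l <- take j s ++ drop j.+1 s) w l =
  \prod_(i < size s) (if (i : nat) == j then 1 else w (nth 0 s i)).
Proof.
elim: s j => // a s IH [|j] js.
  rewrite take0 drop1/= big_ord_recl/= mul1r (big_nth 0) big_mkord.
  by apply: eq_bigr => i _.
rewrite /= big_cons big_ord_recl/= IH//.
Qed.

(** The product over all intervals except the one to be split. Putting 1 at the random index keeps
    the number of factors fixed, so measurability can be checked factor by factor. *)
Definition kak_del {A : comPzRingType} (w : R -> A) u n : A :=
  \prod_(i < n.+1) (if (i : nat) == index (kak_max u n) (kak_lengths u n) then 1
                    else w (nth 0 (kak_lengths u n) i)).

Lemma kak_delE {A : comPzRingType} (w : R -> A) u n : unit_valued u ->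
  kak_del w u n = let j := index (kak_max u n) (kak_lengths u n) in
  \prod_(l <- take j (kak_lengths u n)) w l * \prod_(l <- drop j.+1 (kak_lengths u n)) w l.
Proof.
move=> u01; have [h1 _ _] := kak_lengths_inv n u01.
have mem := kak_max_mem n u01.
by rewrite /= -big_cat prod_del ?index_mem// h1.
Qed.

Lemma kak_prod {A : comPzRingType} (w : R -> A) u n : unit_valued u ->
  \prod_(l <- kak_lengths u n) w l = w (kak_max u n) * kak_del w u n.
Proof.
move=> u01; have mem := kak_max_mem n u01; rewrite kak_delE//=.
set s := kak_lengths u n in mem *; set m := kak_max u n in mem *; set j := index m s.
have js : (j < size s)%N by rewrite index_mem.
have nj : nth 0 s j = m by rewrite nth_index.
by rewrite -{1}(cat_take_drop j s) (drop_nth 0)// nj !big_cat/= big_cons mulrCA.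
Qed.

Lemma kak_prodS {A : comPzRingType} (w : R -> A) u n : unit_valued u ->
  \prod_(l <- kak_lengths u n.+1) w l =
  w (u n * kak_max u n) * w ((1 - u n) * kak_max u n) * kak_del w u n.
Proof.
move=> u01; rewrite kak_delE//= -/(kak_max u n) big_cat/= !big_cons.
by rewrite mulrCA -[RHS]mulrA; congr (_ * _); rewrite mulrCA.
Qed.

(** This expresses the position of the maximum by finitely many equalities between measurable
    quantities. *)
Lemma index_lt_has (x : R) s k : x \in s ->
  (index x s < k)%N = has (fun i => nth 0 s i == x) (iota 0 k).
Proof.
move=> xs; apply/idP/hasP => [ik| [k']].
  by exists (index x s); rewrite ?mem_iota ?add0n// nth_index.
rewrite mem_iota add0n /= => ik /eqP nx.
apply: leq_ltn_trans ik; rewrite leqNgt; apply/negP => ii.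
by have := before_find 0 ii; rewrite /= nx eqxx.
Qed.

End sequences.

(** * Complex-valued random variables and their expectations *)

Section complex_measurable.
Context {R : realType} {D : measure_display} {Y : measurableType D}.
Implicit Types F G : Y -> R[i].

Definition cmY F :=
  measurable_fun setT (fun w => Re (F w)) /\ measurable_fun setT (fun w => Im (F w)).

Lemma cmY_mul F G : cmY F -> cmY G -> cmY (fun w => F w * G w).
Proof.
move=> [F1 F2] [G1 G2]; split.
  rewrite (_ : (fun _ => _) =
    (fun w => Re (F w) * Re (G w) - Im (F w) * Im (G w))).
    by apply: measurable_funB; exact: measurable_funM.
  by apply/funext => w; case: (F w) (G w) => ? ? [].
rewrite (_ : (fun _ => _) =
    (fun w => Re (F w) * Im (G w) + Im (F w) * Re (G w))).
  by apply: measurable_funD; exact: measurable_funM.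
by apply/funext => w; case: (F w) (G w) => ? ? [].
Qed.

Lemma cmY_cst (z : R[i]) : cmY (fun=> z).
Proof. by split; exact: measurable_cst. Qed.

Lemma cmY_prod m (F : nat -> Y -> R[i]) : (forall i, cmY (F i)) ->
  cmY (fun w => \prod_(i < m) F i w).
Proof.
move=> mF; elim: m => [|m IH].
  by under eq_fun do rewrite big_ord0; exact: cmY_cst.
by under eq_fun do rewrite big_ord_recr/=; exact: cmY_mul.
Qed.

Lemma cmY_if (b : Y -> bool) F G : measurable_fun setT b ->
  cmY F -> cmY G -> cmY (fun w => if b w then F w else G w).
Proof.
move=> mb [F1 F2] [G1 G2]; split.
  rewrite (_ : (fun _ => _) = (fun w => if b w then Re (F w) else Re (G w))).
    exact: measurable_fun_ifT.
  by apply/funext => w; case: ifP.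
rewrite (_ : (fun _ => _) = (fun w => if b w then Im (F w) else Im (G w))).
  exact: measurable_fun_ifT.
by apply/funext => w; case: ifP.
Qed.

Lemma cmY_comp (f : R -> R[i]) (h : Y -> R) : cmeas f -> measurable_fun setT h ->
  cmY (fun w => f (h w)).
Proof.
move=> [f1 f2] mh; split.
  exact: (measurableT_comp f1 mh).
exact: (measurableT_comp f2 mh).
Qed.

End complex_measurable.

Section expectation.
Context {R : realType} {d : measure_display} {T : measurableType d}.
Variable P : probability T R.

Definition bT (h : T -> R) := measurable_fun setT h /\ exists K, forall w, `|h w| <= K.

Lemma bT_integrable h : bT h -> P.-integrable setT (EFin \o h).
Proof. by move=> [mh [K hK]]; exact: bounded_integrable mh hK. Qed.

Lemma EPD g h : bT g -> bT h -> EP P (fun w => g w + h w) = EP P g + EP P h.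
Proof. by move=> /bT_integrable ? /bT_integrable ?; exact: RintegralD. Qed.

Lemma EPB g h : bT g -> bT h -> EP P (fun w => g w - h w) = EP P g - EP P h.
Proof. by move=> /bT_integrable ? /bT_integrable ?; exact: RintegralB. Qed.

Lemma EPZl k h : bT h -> EP P (fun w => k * h w) = k * EP P h.
Proof. by move=> /bT_integrable ?; exact: RintegralZl. Qed.

Lemma EP_le g h : bT g -> bT h -> (forall w, g w <= h w) -> EP P g <= EP P h.
Proof. by move=> /bT_integrable ? /bT_integrable ? gh; exact: le_Rintegral. Qed.

Lemma bTD g h : bT g -> bT h -> bT (fun w => g w + h w).
Proof.
move=> [mg [K gK]] [mh [N hN]]; split; first exact: measurable_funD.
by exists (K + N) => w; rewrite (le_trans (ler_normD _ _))// lerD.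
Qed.

Lemma bTB g h : bT g -> bT h -> bT (fun w => g w - h w).
Proof.
move=> [mg [K gK]] [mh [N hN]]; split; first exact: measurable_funB.
by exists (K + N) => w; rewrite (le_trans (ler_normB _ _))// lerD.
Qed.

Lemma bT_cst k : bT (fun=> k).
Proof. by split => //; exists `|k|. Qed.

Lemma bTM g h : bT g -> bT h -> bT (fun w => g w * h w).
Proof.
move=> [mg [K gK]] [mh [N hN]]; split; first exact: measurable_funM.
by exists (K * N) => w; rewrite normrM ler_pM.
Qed.

Lemma bT_bool (b : T -> bool) : measurable_fun setT b -> bT (fun w => (b w)%:R).
Proof.
move=> mb; split; last by exists 1 => w; case: (b w); rewrite ?normr1 ?normr0.
rewrite (_ : (fun _ => _) = (fun w => if b w then 1 else 0)).
  exact: measurable_fun_ifT.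
by apply/funext => w; case: (b w).
Qed.

Definition EPc (F : T -> R[i]) : R[i] :=
  (EP P (fun w => Re (F w)) +i* EP P (fun w => Im (F w)))%C.

Lemma EPc_norm F g : cmY F -> bT g -> (forall w, normc (F w) <= g w) ->
  normc (EPc F) <= EP P g.
Proof.
move=> [m1 m2] bg Fg; have [mg [K gK]] := bg.
have FK w : normc (F w) <= K by apply: le_trans (Fg w) (le_trans (ler_norm _) (gK w)).
have b1 : bT (fun w => Re (F w)).
  by split => //; exists K => w; apply: le_trans (normc_Re _) _.
have b2 : bT (fun w => Im (F w)).
  by split => //; exists K => w; apply: le_trans (normc_Im _) _.
have g0 w : 0 <= g w by apply: le_trans (Fg w); exact: normc_ge0.
apply: normc_le_rot.
  by have := EP_le (bT_cst 0) bg g0; rewrite EP_cst.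
move=> a b ab /=; rewrite -!EPZl// -EPD//; last 2 first.
- by apply: bTM => //; exact: bT_cst.
- by apply: bTM => //; exact: bT_cst.
apply: EP_le => //.
  by apply: bTD; apply: bTM => //; exact: bT_cst.
by move=> w; apply: le_trans (Fg w); exact: normc_ge_rot.
Qed.

Lemma EPcD F G (K : R) : cmY F -> cmY G -> (forall w, normc (F w) <= K) ->
  (forall w, normc (G w) <= K) -> EPc (fun w => F w + G w) = EPc F + EPc G.
Proof.
move=> [F1 F2] [G1 G2] FK GK; apply/eqP; rewrite eq_complex/=.
have bb (H : T -> R[i]) (H1 : measurable_fun setT (fun w => Re (H w)))
    (H2 : measurable_fun setT (fun w => Im (H w))) : (forall w, normc (H w) <= K) ->
    bT (fun w => Re (H w)) /\ bT (fun w => Im (H w)).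
  by move=> HK; split; split => //; exists K => w; [apply: le_trans (normc_Re _) _|apply: le_trans (normc_Im _) _].
have [f1 f2] := bb F F1 F2 FK; have [g1 g2] := bb G G1 G2 GK.
rewrite -!EPD//; apply/andP; split; apply/eqP; congr EP; apply/funext => w;
  by case: (F w) (G w) => ? ? [].
Qed.

Lemma EPcZ (z : R[i]) (h : T -> R) : bT h ->
  EPc (fun w => ((h w)%:C)%C * z) = ((EP P h)%:C)%C * z.
Proof.
move=> bh; apply/eqP; rewrite eq_complex/=; case: z => a b /=.
rewrite !mul0r !subr0 !addr0.
have e k : EP P (fun w => h w * k) = EP P h * k.
  by rewrite mulrC -EPZl//; congr EP; apply/funext => w; rewrite mulrC.
by rewrite -!e; apply/andP; split; apply/eqP; congr EP; apply/funext => w; rewrite ?mul0r ?subr0 ?addr0.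
Qed.

End expectation.

Lemma normc_prod_le {R : realType} m (F : nat -> R[i]) (B : R) : 1 <= B ->
  (forall i, normc (F i) <= B) -> normc (\prod_(i < m) F i) <= B ^+ m.
Proof.
move=> B1 FB; elim: m => [|m IH]; first by rewrite big_ord0 normc1 expr0.
rewrite big_ord_recr/= normcM exprSr ler_pM ?normc_ge0//.
Qed.

Lemma cIZ {R : realType} (z : R[i]) (F : R -> R[i]) : cbm F -> cI (fun u => z * F u) = z * cI F.
Proof.
move=> [F1 F2]; apply/eqP; rewrite eq_complex; case: z => a b; rewrite /cI/=.
have Z (k : R) h : bm h -> bm (fun u => k * h u).
  by move=> bh; apply: bmM => //; exact: bm_cst.
rewrite -!I01Zl// -I01B -?I01D//; try exact: Z.
by apply/andP; split; apply/eqP; apply: I01_eq => u _; case: (F u).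
Qed.

(** * Products over the current intervals, stopped at the threshold time *)

Section process.
Context {R : realType} {d : measure_display} {T : measurableType d}.
Variables (P : probability T R) (U : nat -> {RV P >-> R}).
Hypothesis hind : mutually_independent P (fun n => (U n : T -> R)).
Hypothesis hunif : forall n (B : set R), measurable B ->
  P (U n @^-1` B) = uniform_prob (@ltr01 R) B.
Hypothesis U01 : forall n w, 0 <= U n w <= 1.

Notation TF n := (g_sigma_algebraType (cylinder U n)).

Let u (w : T) : nat -> R := fun k => U k w.

Let u01 w : unit_valued (u w). Proof. by move=> n; exact: U01. Qed.

Let L n i (w : T) : R := nth 0 (kak_lengths (u w) n) i.
Let M n (w : T) : R := kak_max (u w) n.

Let seqmax_nth (s : seq R) : seqmax s = \big[Num.max/0]_(i < size s) nth 0 s i.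
Proof. by rewrite /seqmax (big_nth 0) big_mkord. Qed.

Let ME n w : M n w = \big[Num.max/0]_(i < n.+1) L n i w.
Proof.
have [h _ _] := kak_lengths_inv n (u01 w).
by rewrite /M /kak_max seqmax_nth h.
Qed.

Lemma measurable_bigmax (D : measure_display) (Y : measurableType D) n (F : nat -> Y -> R) :
  (forall i, measurable_fun setT (F i)) ->
  measurable_fun setT (fun y => \big[Num.max/0]_(i < n) F i y).
Proof.
elim: n F => [|n IH] F mF.
  by under eq_fun do rewrite big_ord0; exact: measurable_cst.
under eq_fun do rewrite big_ord_recl/=.
by apply: measurable_maxr => //; exact: (IH (fun i => F i.+1)).
Qed.

Let idx n w : nat := index (M n w) (kak_lengths (u w) n).

Let idx_lt n k w : (idx n w < k)%N = has (fun i => L n i w == M n w) (iota 0 k).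
Proof. by rewrite /idx index_lt_has//; exact: kak_max_mem. Qed.

Let LS n i w : L n.+1 i w =
  if (i < idx n w)%N then L n i w else
  if (i < (idx n w).+1)%N then U n w * M n w else
  if (i < (idx n w).+2)%N then (1 - U n w) * M n w else L n i.-1 w.
Proof.
have [h _ _] := kak_lengths_inv n (u01 w).
have js : (idx n w < size (kak_lengths (u w) n))%N by rewrite index_mem kak_max_mem.
rewrite /L [kak_lengths _ n.+1]/= -/(kak_max _ n) -/(M n w) -/(idx n w).
rewrite nth_cat size_take js; case: ltnP => [ij|ji]; first by rewrite nth_take.
case: ltnP => [ij|ij].
  have -> : (i - idx n w = 0)%N by apply/eqP; rewrite subn_eq0.
  by [].
case: ltnP => [ij2|ij2].
  have -> : i = (idx n w).+1 by apply/eqP; rewrite eqn_leq -ltnS ij2.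
  by rewrite subSnn.
have -> : (i - idx n w = (i - (idx n w).+2).+2)%N by rewrite -!subSn ?subSS// ltnW.
rewrite /= nth_drop; congr (nth _ _ _).
by rewrite -[in RHS](subnKC ij2) !addSn.
Qed.

Let measurable_idx n : (forall i, measurable_fun [set: TF n] (L n i : TF n -> R)) ->
  measurable_fun [set: TF n] (M n : TF n -> R) ->
  forall k, measurable_fun [set: TF n] (fun w : TF n => (idx n w < k)%N).
Proof.
move=> mL mM k; rewrite (_ : (fun _ => _) = (fun w => has (fun i => L n i w == M n w) (iota 0 k))).
  elim: k => [|k IH]; first exact: measurable_cst.
  rewrite (_ : (fun _ => _) = (fun w => has (fun i => L n i w == M n w) (iota 0 k) || (L n k w == M n w))).
    by apply: measurable_or => //; exact: measurable_fun_eqr.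
  by apply/funext => w; rewrite -addn1 iotaD has_cat/= orbF add0n.
by apply/funext => w; exact: idx_lt.
Qed.

Lemma measurable_kak_length n :
  (forall i, measurable_fun [set: TF n] (L n i : TF n -> R)) /\
  measurable_fun [set: TF n] (M n : TF n -> R).
Proof.
have LM n' : (forall i, measurable_fun [set: TF n'] (L n' i : TF n' -> R)) ->
    measurable_fun [set: TF n'] (M n' : TF n' -> R).
  move=> mL; rewrite (_ : M n' = (fun w => \big[Num.max/0]_(i < n'.+1) L n' i w)).
    exact: measurable_bigmax.
  by apply/funext => w; exact: ME.
suff mL : forall i, measurable_fun [set: TF n] (L n i : TF n -> R) by split => //; exact: LM.
elim: n => [|n IH] i.
  rewrite (_ : L 0 i = fun=> nth 0 [:: 1] i); first exact: measurable_cst.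
  by apply/funext => w; rewrite /L.
have mM := LM _ IH; have mi := measurable_idx IH mM.
have mI k := measurable_TF_S (mi k); have mL' j := measurable_TF_S (IH j).
have mM' := measurable_TF_S mM; have mU := @measurable_TF_U R d T P U n.
(* The tests are rewritten in the form [idx < k] with [k] deterministic. At [i = 0] the predecessor
   in the third test is harmless, since one of the first two tests already succeeds. *)
rewrite (_ : L n.+1 i = (fun w =>
  if ~~ (idx n w < i.+1)%N then L n i w else
  if ~~ (idx n w < i)%N then U n w * M n w else
  if ~~ (idx n w < i.-1)%N then (1 - U n w) * M n w else L n i.-1 w)).
  apply: measurable_fun_ifT => //; first exact: (measurable_neg (mI _)).
  apply: measurable_fun_ifT => //; first exact: (measurable_neg (mI _)).
    exact: measurable_funM.
  apply: measurable_fun_ifT => //; first exact: (measurable_neg (mI _)).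
  by apply: measurable_funM => //; exact: measurable_funB.
apply/funext => w; rewrite LS -!leqNgt.
by case: i => [|i] //=; rewrite ?ltnS.
Qed.

Let cmT_del n (f : R -> R[i]) : cmeas f -> cmY (fun w : TF n => kak_del f (u w) n).
Proof.
move=> mf; have [mL mM] := measurable_kak_length n.
apply: (@cmY_prod _ _ _ n.+1 (fun i (w : TF n) => if i == idx n w then 1 else f (L n i w))) => i.
apply: cmY_if; [|exact: cmY_cst|exact: cmY_comp].
have mi := measurable_idx mL mM.
rewrite (_ : (fun _ => _) = (fun w => ~~ (idx n w < i)%N && (idx n w < i.+1)%N)).
  by apply: measurable_and => //; exact: (measurable_neg (mi _)).
by apply/funext => w; rewrite -leqNgt ltnS -eqn_leq.
Qed.

(** The event [N_t >= n]. For [m <= n + 1] the event [alive t m] only involves [M k] with [k <= n],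
    so it belongs to the past at time [n]. *)
Let alive (t : R) n (w : T) : bool := all (fun k => t < M k w) (iota 0 n).

Let measurable_TF_le m n (h : T -> R) : (m <= n)%N ->
  measurable_fun [set: TF m] (h : TF m -> R) -> measurable_fun [set: TF n] (h : TF n -> R).
Proof.
move=> mn mh; rewrite -(subnKC mn); elim: (n - m)%N => [|k IH]; first by rewrite addn0.
by rewrite addnS; exact: measurable_TF_S.
Qed.

Let measurable_alive t m n : (m <= n.+1)%N ->
  measurable_fun [set: TF n] (alive t m : TF n -> bool).
Proof.
elim: m => [_|m IH mn]; first exact: measurable_cst.
rewrite (_ : alive t m.+1 = (fun w => alive t m w && (t < M m w))).
  apply: measurable_and; first by apply: IH; exact: ltnW.
  apply: measurable_fun_ltr => //; apply: (@measurable_TF_le m) => //.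
  by have [] := measurable_kak_length m.
by apply/funext => w; rewrite /alive -addn1 iotaD all_cat/= andbT add0n.
Qed.

Let alive_measurable t n : measurable_fun [set: T] (alive t n).
Proof. by apply: (@measurable_TF _ _ _ P U n); exact: measurable_alive. Qed.

Let M_measurable n : measurable_fun [set: T] (M n).
Proof. by apply: (@measurable_TF _ _ _ P U n); have [] := measurable_kak_length n. Qed.

Let Z (f : R -> R[i]) n (w : T) : R[i] := \prod_(l <- kak_lengths (u w) n) f l.

Let Z_cm f n : cmeas f -> cmY (Z f n).
Proof.
move=> mf.
have : cmY (fun w : TF n => f (M n w) * kak_del f (u w) n).
  apply: cmY_mul; last exact: cmT_del.
  by apply: cmY_comp => //; have [] := measurable_kak_length n.
move=> [m1 m2]; rewrite (_ : Z f n = (fun w => f (M n w) * kak_del f (u w) n)).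
  split; exact: (@measurable_TF _ _ _ P U n).
by apply/funext => w; exact: kak_prod.
Qed.

Let del_bound (f : R -> R[i]) (B : R) n w : 1 <= B -> (forall x, normc (f x) <= B) ->
  normc (kak_del f (u w) n) <= B ^+ n.+1.
Proof.
move=> B1 fB.
apply: (@normc_prod_le _ n.+1 (fun i => if i == idx n w then 1 else f (L n i w))) => // i.
by case: ifP => _ //; rewrite normc1.
Qed.

Let Z_bound (f : R -> R[i]) (B : R) n w : 1 <= B -> (forall x, normc (f x) <= B) ->
  normc (Z f n w) <= B ^+ n.+2.
Proof.
move=> B1 fB; rewrite /Z kak_prod// normcM exprS ler_pM ?normc_ge0//.
exact: del_bound.
Qed.

(** On [N_t > n], an event of the past, only the two factors of the split interval involve [U n],
    and these are integrated out. The general bound [B] allows a second use with the weights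
    [exp (l ^ 2)]. *)
Lemma kak_step (f : R -> R[i]) (B t : R) n : cmeas f -> 1 <= B -> (forall x, normc (f x) <= B) ->
  EPc P (fun w => if alive t n.+1 w then Z f n.+1 w else 0) =
  EPc P (fun w => if alive t n.+1 w then kak_del f (u w) n *
      cI (fun v => f (v * M n w) * f ((1 - v) * M n w)) else 0).
Proof.
move=> mf B1 fB.
have [mL mM] := measurable_kak_length n.
have ma : measurable_fun [set: TF n] (alive t n.+1 : TF n -> bool) by exact: measurable_alive.
pose H (w : T) (v : R) : R[i] := (if alive t n.+1 w then kak_del f (u w) n else 0) *
   (f (v * M n w) * f ((1 - v) * M n w)).
have Hb w v : normc (H w v) <= B ^+ n.+1 * (B * B).
  rewrite !normcM; apply: ler_pM; rewrite ?mulr_ge0 ?normc_ge0//.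
    case: ifP => _; first exact: del_bound.
    by rewrite normc0 exprn_ge0// (le_trans _ B1).
  by apply: ler_pM; rewrite ?normc_ge0.
have mH : cmY (fun q : TF n * R => H q.1 q.2).
  have m1 : measurable_fun setT (fun q : TF n * R => M n q.1).
    exact: (measurableT_comp mM measurable_fst).
  apply: cmY_mul.
    have [c1 c2] : cmY (fun w : TF n => if alive t n.+1 w then kak_del f (u w) n else 0).
      by apply: cmY_if => //; exact: cmT_del.
    split.
      exact: (measurableT_comp c1 measurable_fst).
    exact: (measurableT_comp c2 measurable_fst).
  apply: cmY_mul; apply: cmY_comp => //.
    by apply: measurable_funM => //; exact: measurable_snd.
  by apply: measurable_funM => //; apply: measurable_funB => //; exact: measurable_snd.
have lhs w : (if alive t n.+1 w then Z f n.+1 w else 0) = H w (U n w).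
  rewrite /H; case: ifP => _; last by rewrite mul0r.
  by rewrite /Z kak_prodS// mulrC.
have bF w : cbm (fun v => f (v * M n w) * f ((1 - v) * M n w)).
  have bf (g : R -> R) : measurable_fun setT g -> cbm (fun v => f (g v)).
    move=> mg; have [k1 k2] := cmeas_comp mf mg.
    split; apply: (@bm_mfun _ _ B) => // v _.
      exact: le_trans (normc_Re _) (fB _).
    exact: le_trans (normc_Im _) (fB _).
  apply: cbmM; apply: bf; first exact: measurable_funM.
  by apply: measurable_funM => //; exact: measurable_funB.
have rhs w : (if alive t n.+1 w then kak_del f (u w) n *
      cI (fun v => f (v * M n w) * f ((1 - v) * M n w)) else 0) = cI (H w).
  rewrite /H cIZ//; case: ifP => _ //; by rewrite mul0r.
have next (h : R[i] -> R) : (forall z, `|h z| <= normc z) ->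
    measurable_fun setT (fun q : TF n * R => h (H q.1 q.2)) ->
    EP P (fun w => h (H w (U n w))) = EP P (fun w => I01 (fun v => h (H w v))).
  move=> hN mhH; apply: (EP_next hind hunif (h := fun w v => h (H w v))
    (M := B ^+ n.+1 * (B * B))) => // w v; exact: le_trans (hN _) (Hb _ _).
have [mR mI] := mH.
rewrite /EPc; congr Complex.
  transitivity (EP P (fun w => Re (H w (U n w)))).
    by congr EP; apply/funext => w; rewrite lhs.
  rewrite next//; last exact: normc_Re.
  by congr EP; apply/funext => w; rewrite rhs.
transitivity (EP P (fun w => Im (H w (U n w)))).
  by congr EP; apply/funext => w; rewrite lhs.
rewrite next//; last exact: normc_Im.
by congr EP; apply/funext => w; rewrite rhs.
Qed.

Let aliveS t n w : alive t n.+1 w = alive t n w && (t < M n w).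
Proof. by rewrite /alive -addn1 iotaD all_cat/= andbT add0n. Qed.

Let stop t n w : bool := alive t n w && (M n w <= t).

Let stop_measurable t n : measurable_fun [set: T] (stop t n).
Proof. by apply: measurable_and => //; exact: measurable_fun_ler. Qed.

(** At the threshold time all lengths are at most [t], so every factor is a pure phase; there are
    [n + 1] lengths and their sum is 1. *)
Let cis_prod s t n w : 0 < t -> M n w <= t -> forall f, kak_fun s f ->
  Z (fun l => f (l / t)) n w = cis (s * (n.+1%:R - 2 / t)).
Proof.
move=> t0 Mt f [_ _ f1 _]; have [h1 _ h3] := kak_lengths_inv n (u01 w).
have le_t l : l \in kak_lengths (u w) n -> l <= t.
  by move=> /seqmax_ge lm; apply: le_trans lm Mt.
rewrite /Z -h1 -[2]mulr1 -[X in 2 * X / t]h3.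
move: (kak_lengths (u w) n) le_t {h1 h3}; elim=> [|l r IH] le_t.
  by rewrite !big_nil mulr0 mul0r subrr mulr0 /cis cos0 sin0.
rewrite !big_cons f1; last by rewrite ler_pdivrMr// mul1r le_t// inE eqxx.
rewrite IH -?cisD; last by move=> x xr; rewrite le_t// inE xr orbT.
congr cis; rewrite /= -natr1; field; exact: lt0r_neq0.
Qed.

(** Optional stopping at [min(N_t, n)]: one step separates the paths stopping at time [k] from those
    still running, and after [n] steps the running part has modulus at most its probability. *)
Lemma kak_martingale s t f n : 0 < t -> t < 1 -> kak_fun s f ->
  normc (f t^-1 - \sum_(k < n)
    ((EP P (fun w => (stop t k w)%:R))%:C)%C * cis (s * (k.+1%:R - 2 / t))) <=
  EP P (fun w => (alive t n w)%:R).
Proof.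
move=> t0 t1 kf; have [mf f1 fx fI] := kf.
pose g l := f (l / t).
have mg : cmeas g by apply: (cmeas_comp mf); exact: measurable_funM.
have g1 x : normc (g x) <= 1 by exact: f1.
pose a n := EPc P (fun w => if alive t n w then Z g n w else 0).
have Z1 m w : normc (Z g m w) <= 1.
  by rewrite -[leRHS](expr1n _ m.+2); exact: Z_bound.
have cma m m' : cmY (fun w => if alive t m w then Z g m' w else 0).
  by apply: cmY_if => //; exact: Z_cm.
have a1 m m' w : normc (if alive t m w then Z g m' w else 0) <= (alive t m w)%:R.
  by case: ifP => _; rewrite ?normc0.
have aS m : a m = ((EP P (fun w => (stop t m w)%:R))%:C)%C * cis (s * (m.+1%:R - 2 / t)) + a m.+1.
  rewrite -EPcZ; last exact: bT_bool.
  rewrite /a (kak_step t m mg (lexx 1) g1).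
  have E w : kak_del g (u w) m * cI (fun v => g (v * M m w) * g ((1 - v) * M m w)) =
      if t < M m w then Z g m w else kak_del g (u w) m * cI (fun v => g (v * M m w) * g ((1 - v) * M m w)).
    case: ifPn => // tM; rewrite /Z kak_prod// mulrC; congr (_ * _).
    rewrite [RHS]fI; last by rewrite ltr_pdivlMr// mul1r.
    by apply: cI_eq => v _; rewrite /g !mulrA.
  have -> : EPc P (fun w => if alive t m.+1 w then kak_del g (u w) m *
      cI (fun v => g (v * M m w) * g ((1 - v) * M m w)) else 0) =
      EPc P (fun w => if alive t m.+1 w then Z g m w else 0).
    congr EPc; apply/funext => w; rewrite E aliveS.
    by case: (alive t m w) => //=; case: (t < M m w).
  have bz w : normc (((stop t m w)%:R%:C)%C * cis (s * (m.+1%:R - 2 / t))) <= 1.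
    rewrite normcM normc_cis mulr1 normc_real; case: (stop _ _ _); by rewrite ?normr0 ?normr1.
  have cz : cmY (fun w => ((stop t m w)%:R%:C)%C * cis (s * (m.+1%:R - 2 / t))).
    apply: cmY_mul; last exact: cmY_cst.
    split => /=; last exact: measurable_cst.
    by have [] := @bT_bool R _ _ _ (stop_measurable t m).
  have bz' w : normc (if alive t m.+1 w then Z g m w else 0) <= 1.
    by apply: le_trans (a1 _ _ _) _; case: alive.
  rewrite -(EPcD P cz (cma _ _) bz bz').
  congr EPc; apply/funext => w; rewrite aliveS /stop leNgt.
  case: (alive t m w) => /=; last by rewrite !mul0r addr0.
  case: (ltP t (M m w)) => tM /=; first by rewrite mul0r add0r.
  by rewrite mul1r addr0 (cis_prod t0 tM kf).
have a0 : a 0%N = f t^-1.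
  rewrite /a /EPc; rewrite (_ : (fun w => _) = fun=> Re (f t^-1)); last first.
    by apply/funext => w; rewrite /Z/= big_seq1 /g mul1r.
  rewrite (_ : (fun w => Im _) = fun=> Im (f t^-1)); last first.
    by apply/funext => w; rewrite /Z/= big_seq1 /g mul1r.
  by rewrite !EP_cst; case: (f t^-1).
have -> : f t^-1 - \sum_(k < n) ((EP P (fun w => (stop t k w)%:R))%:C)%C *
    cis (s * (k.+1%:R - 2 / t)) = a n.
  rewrite -a0; elim: n => [|m IH]; first by rewrite big_ord0 subr0.
  by rewrite big_ord_recr/= opprD addrA IH aS addrC addKr.
by apply: EPc_norm => //; exact: bT_bool.
Qed.

(** Equal to [exp (l ^ 2)] for lengths in the unit interval; the truncation provides the global
    bound that [kak_step] asks for. *)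
Let h (l : R) : R := expR (Num.min 1 (l ^+ 2)).

Let mh : measurable_fun setT h.
Proof.
apply: measurableT_comp; first exact: measurable_expR.
by apply: measurable_minr => //; exact: exprn_measurable.
Qed.

Let h_ge1 l : 1 <= h l.
Proof. by rewrite -expR0 ler_expR le_min ler01 sqr_ge0. Qed.

Let h_le l : h l <= expR 1.
Proof. by rewrite ler_expR ge_min lexx. Qed.

Let h_in l : 0 <= l <= 1 -> h l = expR (l ^+ 2).
Proof. by move=> /andP[l0 l1]; rewrite /h min_r// expr_le1. Qed.

Let bm_h (g : R -> R) : measurable_fun setT g -> bm (fun v => h (g v)).
Proof.
move=> mg; apply: (@bm_mfun _ _ (expR 1)); first exact: (measurableT_comp mh).
by move=> v _; rewrite ger0_norm// ltW// expR_gt0.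
Qed.

(** Splitting lowers the sum of squares by [2 m ^ 2 (v - v ^ 2)]. For small exponents
    [e^(- 2 y) <= 1 - y], and [v - v ^ 2] has mean [1 / 6]. *)
Let h_contract t m : 0 < t -> t < m -> m <= 1 ->
  I01 (fun v => h (v * m) * h ((1 - v) * m)) <= (1 - t ^+ 2 / 6) * h m.
Proof.
move=> t0 tm m1; have m0 := lt_trans t0 tm.
apply: (@le_trans _ _ (I01 (fun v => h m * (1 - m ^+ 2 * (v - v ^+ 2))))); last first.
  have bq : bm (fun v : R => v - v ^+ 2) by apply: bmB; [exact: bm_id|apply: bmX; exact: bm_id].
  have bq' : bm (fun v : R => m ^+ 2 * (v - v ^+ 2)) by apply: bmM => //; exact: bm_cst.
  rewrite I01Zl; last by apply: bmB => //; exact: bm_cst.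
  rewrite I01B//; last exact: bm_cst.
  rewrite I01Zl// I01B; [|exact: bm_id|by apply: bmX; exact: bm_id].
  rewrite I01_cst I01_pow -[I01 id](@I01_eq _ (fun v => v ^+ 1)); last by move=> v _; rewrite expr1.
  rewrite I01_pow mulrC ler_wpM2r//; first by rewrite (le_trans _ (h_ge1 _)).
  have : t ^+ 2 <= m ^+ 2 by rewrite lerXn2r ?nnegrE ?ltW.
  by lra.
apply: I01_le.
- apply: bmM; apply: bm_h; first exact: measurable_funM.
  by apply: measurable_funM => //; exact: measurable_funB.
- apply: bmM; first exact: bm_cst.
  apply: bmB; first exact: bm_cst.
  apply: bmM; first exact: bm_cst.
  by apply: bmB; [exact: bm_id|apply: bmX; exact: bm_id].
move=> v /andP[v0 v1].
have vm0 : 0 <= v * m by rewrite mulr_ge0// ltW.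
have vm1 : v * m <= 1 by rewrite mulr_ile1// ltW.
have wm0 : 0 <= (1 - v) * m by rewrite mulr_ge0 ?subr_ge0// ltW.
have wm1 : (1 - v) * m <= 1 by rewrite mulr_ile1 ?subr_ge0//; lra.
rewrite !h_in ?vm0 ?wm0 ?(ltW m0)// -expRD.
have -> : (v * m) ^+ 2 + ((1 - v) * m) ^+ 2 = m ^+ 2 + - (2 * (m ^+ 2 * (v - v ^+ 2))) by ring.
rewrite expRD ler_wpM2l ?expR_ge0//.
have m20 : 0 <= m ^+ 2 <= 1 by rewrite sqr_ge0 expr_le1// ltW.
have vv : 0 <= v - v ^+ 2 <= 4^-1 by have := sqr_ge0 (v - 2^-1); nra.
move: (m ^+ 2) (v - v ^+ 2) m20 vv => A B /andP[A0 A1] /andP[B0 B1].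
have AB0 : 0 <= A * B by exact: mulr_ge0.
have AB1 : A * B <= 1 * 4^-1 by exact: ler_pM.
by apply: le_trans (expRN_le _) _; lra.
Qed.

(** The product of the [h l] starts at [e], shrinks in mean by [1 - t ^ 2 / 6] at each step before
    the threshold time, and is always at least 1, so it dominates the indicator of survival. *)
Lemma kak_alive_le t n : 0 < t -> t < 1 ->
  EP P (fun w => (alive t n w)%:R) <= expR 1 * (1 - t ^+ 2 / 6) ^+ n.
Proof.
move=> t0 t1; pose q := 1 - t ^+ 2 / 6.
have t21 : t ^+ 2 <= 1 by rewrite expr_le1// ltW.
have q0 : 0 <= q by rewrite /q; lra.
pose hc l : R[i] := ((h l)%:C)%C.
have mhc : cmeas hc by split => //=; exact: measurable_cst.
have hcB x : normc (hc x) <= expR 1.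
  by rewrite /hc normc_real ger0_norm// (le_trans _ (h_ge1 _)).
have B1 : (1 : R) <= expR 1 by rewrite -expR0 ler_expR.
pose D n w : R := kak_del h (u w) n.
pose A n w : R := if alive t n w then \prod_(l <- kak_lengths (u w) n) h l else 0.
pose b n := EP P (A n).
have ZE m w : Z hc m w = ((\prod_(l <- kak_lengths (u w) m) h l)%:C)%C.
  by rewrite /Z rmorph_prod.
have DE m w : kak_del hc (u w) m = ((D m w)%:C)%C.
  by rewrite /D /kak_del rmorph_prod; apply: eq_bigr => k _; case: ifP.
have D0 m w : 0 <= D m w.
  by apply: prodr_ge0 => k _; case: ifP => // _; rewrite (le_trans _ (h_ge1 _)).
have DB m w : D m w <= expR 1 ^+ m.+1.
  have := @del_bound hc _ m w B1 hcB.
  by rewrite DE normc_real ger0_norm.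
have mD m : measurable_fun setT (D m).
  have [+ _] := @cmT_del m hc mhc.
  under eq_fun do rewrite DE/=.
  exact: measurable_TF.
have AE m w : A m w = if alive t m w then h (M m w) * D m w else 0.
  by rewrite /A kak_prod.
have bA m : bT (A m).
  split.
    rewrite (_ : A m = (fun w => if alive t m w then h (M m w) * D m w else 0)).
      apply: measurable_fun_ifT => //; apply: measurable_funM => //.
      exact: (measurableT_comp mh).
    by apply/funext.
  exists (expR 1 * expR 1 ^+ m.+1) => w; rewrite AE; case: ifP => _.
    rewrite normrM ler_pM// ger0_norm//.
    by rewrite (le_trans _ (h_ge1 _)).
  by rewrite normr0 mulr_ge0 ?exprn_ge0 ?expR_ge0.
have bE m : EPc P (fun w => if alive t m w then Z hc m w else 0) = ((b m)%:C)%C.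
  rewrite /EPc /b /A; congr Complex.
    by congr EP; apply/funext => w; case: ifP => // _; rewrite ZE.
  rewrite (_ : (fun w => _) = fun=> 0) ?EP_cst//.
  by apply/funext => w; case: ifP => // _; rewrite ZE.
have bS m : b m.+1 <= q * b m.
  have := kak_step t m mhc B1 hcB; rewrite bE /EPc => -[-> _].
  rewrite -EPZl//.
  have cE w : cI (fun v => hc (v * M m w) * hc ((1 - v) * M m w)) =
      ((I01 (fun v => h (v * M m w) * h ((1 - v) * M m w)))%:C)%C.
    rewrite /cI; congr Complex; first by apply: I01_eq => v _; rewrite /= mulr0 subr0.
    by rewrite -[RHS](I01_cst (0 : R)); apply: I01_eq => v _; rewrite /= mulr0 mul0r addr0.
  have rE w : Re (if alive t m.+1 w then kak_del hc (u w) m *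
      cI (fun v => hc (v * M m w) * hc ((1 - v) * M m w)) else 0) =
      if alive t m.+1 w then D m w * I01 (fun v => h (v * M m w) * h ((1 - v) * M m w)) else 0.
    by case: ifP => // _; rewrite DE cE/= mul0r subr0.
  have le w : (if alive t m.+1 w then D m w * I01 (fun v => h (v * M m w) * h ((1 - v) * M m w)) else 0)
      <= q * A m w.
    rewrite AE aliveS; case: (alive t m w) => /=; last by rewrite mulr0.
    case: ifPn => tM; last by rewrite !mulr_ge0// (le_trans _ (h_ge1 _)).
    rewrite mulrA [leRHS]mulrC ler_wpM2l//; apply: h_contract => //.
    by have /andP[] := kak_max_bound m (u01 w).
  rewrite (_ : (fun w => Re _) = fun w => if alive t m.+1 w then
      D m w * I01 (fun v => h (v * M m w) * h ((1 - v) * M m w)) else 0); last exact/funext.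
  apply: EP_le => //; last by apply: bTM => //; exact: bT_cst.
  have I0 w : 0 <= I01 (fun v => h (v * M m w) * h ((1 - v) * M m w)).
    by apply: I01_ge0 => v _; rewrite mulr_ge0// (le_trans _ (h_ge1 _)).
  have I2 w : I01 (fun v => h (v * M m w) * h ((1 - v) * M m w)) <= expR 1 * expR 1.
    rewrite -[leRHS]I01_cst; apply: I01_le; last 2 first.
    - exact: bm_cst.
    - by move=> v _; rewrite ler_pM// (le_trans _ (h_ge1 _)).
    apply: bmM; apply: bm_h; first exact: measurable_funM.
    by apply: measurable_funM => //; exact: measurable_funB.
  split.
    apply: measurable_fun_ifT => //; apply: measurable_funM => //.
    apply: (measurableT_comp (f := fun x : R => I01 (fun v => h (v * x) * h ((1 - v) * x)))
      _ (M_measurable m)).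
    apply: (@measurable_I01 R (fun p => h (p.2 * p.1) * h ((1 - p.2) * p.1)) (expR 1 * expR 1)).
      apply: measurable_funM; apply: (measurableT_comp mh).
        by apply: measurable_funM; [exact: measurable_snd|exact: measurable_fst].
      apply: measurable_funM; last exact: measurable_fst.
      by apply: measurable_funB => //; exact: measurable_snd.
    by move=> p; rewrite normrM ler_pM// ger0_norm// (le_trans _ (h_ge1 _)).
  exists (expR 1 ^+ m.+1 * (expR 1 * expR 1)) => w; case: ifP => _.
    by rewrite normrM ler_pM// ger0_norm.
  by rewrite normr0 !mulr_ge0 ?exprn_ge0 ?expR_ge0.
apply: (@le_trans _ _ (b n)).
  apply: EP_le => //; first exact: bT_bool.
  move=> w; rewrite AE; case: ifP => // _.
  rewrite -kak_prod//; elim: (kak_lengths _ _) => [|l r IH]; first by rewrite big_nil.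
  by rewrite big_cons -[leLHS](mulr1 1) ler_pM.
elim: n => [|n IH].
  rewrite expr0 mulr1 /b (_ : A 0%N = fun=> expR 1) ?EP_cst//.
  by apply/funext => w; rewrite /A/= big_seq1 h_in ?ler01 ?lexx// expr1n.
apply: le_trans (bS n) _; rewrite exprS mulrCA ler_wpM2l//.
Qed.

Let stopE t k w : stop t k w <-> kak_threshold_is (u w) t k.
Proof.
rewrite /stop /kak_threshold_is; split => [/andP[/allP al Mt]|[Mt al]].
  by split => // j jk; apply: al; rewrite mem_iota add0n.
rewrite Mt andbT; apply/allP => j; rewrite mem_iota add0n; exact: al.
Qed.

Let threshold_uniq t j k w : kak_threshold_is (u w) t j -> kak_threshold_is (u w) t k -> j = k.
Proof.
move=> [j1 j2] [k1 k2]; apply/eqP; rewrite eqn_leq; apply/andP; split; rewrite leqNgt;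
  apply/negP; [move=> /j2|move=> /k2]; by rewrite ltNge ?j1 ?k1.
Qed.

(** At most one term of the sum is nonzero, and the sum misses only the paths that are still running
    at time [n]. *)
Let sum_stop t (c : nat -> bool) n w :
  if alive t n w then \sum_(k < n) (c k)%:R * (stop t k w)%:R = 0 :> R
  else exists2 k, stop t k w & \sum_(k < n) (c k)%:R * (stop t k w)%:R = (c k)%:R :> R.
Proof.
elim: n => [|n]; first by rewrite /= big_ord0.
have sE : stop t n w = alive t n w && ~~ (t < M n w) by rewrite -leNgt.
rewrite aliveS big_ord_recr/=; case al : (alive t n w); last first.
  by move=> [k ks ->]; exists k => //; rewrite sE al mulr0 addr0.
move=> ->; rewrite add0r; case tM : (t < M n w) => /=; first by rewrite sE al tM mulr0.
have sn : stop t n w by rewrite sE al tM.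
by exists n => //; rewrite sn mulr1.
Qed.

Lemma kak_event_approx t (c : nat -> bool) n :
  measurable [set w | exists k, kak_threshold_is (u w) t k /\ c k] ->
  `|fine (P [set w | exists k, kak_threshold_is (u w) t k /\ c k]) -
    \sum_(k < n) (c k)%:R * EP P (fun w => (stop t k w)%:R)| <=
  EP P (fun w => (alive t n w)%:R).
Proof.
set E := [set w | _] => mE.
have PE : fine (P E) = EP P (\1_E).
  by rewrite /EP /Rintegral integral_indic// setIT.
have bE : bT (\1_E : T -> R).
  split; first exact: measurable_indic.
  by exists 1 => w; rewrite indicE; case: (w \in E); rewrite ?normr0 ?normr1.
have bs k : bT (fun w => (c k)%:R * (stop t k w)%:R : R).
  by apply: bTM; [exact: bT_cst|exact: bT_bool].
have bS m : bT (fun w => \sum_(k < m) (c k)%:R * (stop t k w)%:R : R).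
  elim: m => [|m IH]; first by under eq_fun do rewrite big_ord0; exact: bT_cst.
  by under eq_fun do rewrite big_ord_recr/=; exact: bTD.
have -> : \sum_(k < n) (c k)%:R * EP P (fun w => (stop t k w)%:R) =
    EP P (fun w => \sum_(k < n) (c k)%:R * (stop t k w)%:R).
  elim: n => [|m IH].
    by rewrite big_ord0 -[LHS](EP_cst P); apply: eq_Rintegral => w _; rewrite big_ord0.
  rewrite big_ord_recr/= IH -EPZl; last exact: bT_bool.
  rewrite -EPD//; apply: eq_Rintegral => w _; by rewrite big_ord_recr.
rewrite PE -EPB// /EP.
have key w : `|\1_E w - \sum_(k < n) (c k)%:R * (stop t k w)%:R| <= (alive t n w)%:R :> R.
  have := sum_stop t c n w; case: ifP => _ /=.
    by move=> ->; rewrite subr0 indicE; case: (w \in E); rewrite ?normr0 ?normr1.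
  move=> [k /stopE kt ->]; rewrite indicE.
  have -> : (w \in E) = c k.
    apply/idP/idP; first by rewrite inE => -[j [/threshold_uniq/(_ kt) ->]].
    by move=> ck; rewrite inE; exists k.
  by rewrite subrr normr0.
have bal := @bT_bool R _ _ _ (alive_measurable t n).
have bd := bTB bE (bS n).
rewrite ler_norml; apply/andP; split.
  rewrite -mulN1r -EPZl//; apply: EP_le => //.
    by apply: bTM => //; exact: bT_cst.
  by move=> w; have := key w; rewrite ler_norml mulN1r => /andP[].
apply: EP_le => // w; by have := key w; rewrite ler_norml => /andP[].
Qed.

Lemma kak_law_unit t : 0 < t -> t < 1 -> exists2 p : nat -> R, (forall k, 0 <= p k) &
  (forall s f n, kak_fun s f ->
     normc (f t^-1 - \sum_(k < n) ((p k)%:C)%C * cis (s * (k.+1%:R - 2 / t))) <=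
     expR 1 * (1 - t ^+ 2 / 6) ^+ n) /\
  (forall (c : nat -> bool) n,
     measurable [set w | exists k, kak_threshold_is (u w) t k /\ c k] ->
     `|fine (P [set w | exists k, kak_threshold_is (u w) t k /\ c k]) -
       \sum_(k < n) (c k)%:R * p k| <= expR 1 * (1 - t ^+ 2 / 6) ^+ n).
Proof.
move=> t0 t1; exists (fun k => EP P (fun w => (stop t k w)%:R)).
  by move=> k; apply: Rintegral_ge0 => w _.
split=> [s f n kf|c n mE].
  exact: le_trans (kak_martingale n t0 t1 kf) (kak_alive_le n t0 t1).
exact: le_trans (kak_event_approx n mE) (kak_alive_le n t0 t1).
Qed.

End process.

(** * Measurability of the event, and reduction to variables in the unit interval *)

Section event.
Context {R : realType} {d : measure_display} {T : measurableType d}.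
Variable U : nat -> T -> R.
Hypothesis mU : forall n, measurable_fun setT (U n).

Let ev (gs : seq (T -> R)) (w : T) : seq R := [seq g w | g <- gs].
Let mall (gs : seq (T -> R)) := forall g, List.In g gs -> measurable_fun setT g.

Let mall_cat g1 g2 : mall g1 -> mall g2 -> mall (g1 ++ g2).
Proof. by move=> h1 h2 g gi; have [/h1|/h2] := List.in_app_or _ _ _ gi. Qed.

Let mall_cons g gs : measurable_fun setT g -> mall gs -> mall (g :: gs).
Proof. by move=> mg ms k [<-|/ms]. Qed.

Let mall_behead g gs : mall (g :: gs) -> mall gs.
Proof. by move=> ms k kg; apply: ms; right. Qed.

Let mall_take k gs : mall gs -> mall (take k gs).
Proof.
elim: gs k => [|g gs IH] [|k] ms //= x []; last by apply: IH; exact: mall_behead ms.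
by move=> <-; apply: ms; left.
Qed.

Let mall_drop k gs : mall gs -> mall (drop k gs).
Proof. by elim: gs k => [|g gs IH] [|k] // /mall_behead; exact: IH. Qed.

Let measurable_seqmax gs : mall gs -> measurable_fun setT (fun w => seqmax (ev gs w)).
Proof.
elim: gs => [|g gs IH] ms.
  by under eq_fun do rewrite /seqmax big_nil; exact: measurable_cst.
under eq_fun do rewrite /seqmax /= big_cons.
by apply: measurable_maxr; [apply: ms; left|apply: IH; exact: mall_behead ms].
Qed.

Let measurable_index (h : T -> R) gs k : measurable_fun setT h -> mall gs ->
  measurable [set w | index (h w) (ev gs w) = k].
Proof.
move=> mh; elim: gs k => [|g gs IH] k ms.
  case: k => [|k]; last by rewrite (_ : [set w | _] = set0)//; apply/seteqP; split.
  by rewrite (_ : [set w | _] = setT)//; apply/seteqP; split.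
have mgh : measurable [set w | g w = h w].
  have meq : measurable_fun setT (fun w => g w == h w).
    by apply: measurable_fun_eqr => //; apply: ms; left.
  have mt : measurable [set true] by [].
  by have := meq measurableT _ mt; rewrite setTI;
  congr measurable; apply/seteqP; split => w /= /eqP.
case: k => [|k].
  rewrite (_ : [set w | _] = [set w | g w = h w])//.
  by apply/seteqP; split => w /=; case: eqP.
rewrite (_ : [set w | _] = ~` [set w | g w = h w] `&` [set w | index (h w) (ev gs w) = k]).
  by apply: measurableI; [exact: measurableC|apply: IH; exact: mall_behead ms].
apply/seteqP; split => w /=; first by case: eqP => // gh -[].
by move=> [/eqP/negPf -> ->].
Qed.

(* [S] is tested on arbitrary lists of measurable functions: without [0 <= U n <= 1] the
   number of intervals is itself random. *)
Let good (S : T -> set (seq R)) := forall gs, mall gs -> measurable [set w | S w (ev gs w)].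

(** The induction moves one splitting step from the process into the test: testing the list at time
    [n + 1] is testing the list at time [n] against the preimage of [S] under the step. *)
Let good_kak n (S : T -> set (seq R)) : good S ->
  measurable [set w | S w (kak_lengths (fun k => U k w) n)].
Proof.
elim: n S => [|n IH] S gS.
  by apply: (gS [:: fun=> 1]) => g [<-|//]; exact: measurable_cst.
pose step (w : T) (s : seq R) := let m := seqmax s in let i := index m s in
  take i s ++ [:: U n w * m; (1 - U n w) * m] ++ drop i.+1 s.
apply: (IH (fun w s => S w (step w s))) => gs ms.
pose m w := seqmax (ev gs w).
have mm : measurable_fun setT m by exact: measurable_seqmax.
pose new k := take k gs ++ [:: (fun w => U n w * m w); (fun w => (1 - U n w) * m w)] ++ drop k.+1 gs.
have mnew k : mall (new k).
  apply: mall_cat; first exact: mall_take.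
  apply: mall_cons; first exact: measurable_funM.
  apply: mall_cons; last exact: mall_drop.
  by apply: measurable_funM => //; exact: measurable_funB.
(* Once the position of the maximum is fixed to [k], the new list is again a fixed list of
   measurable functions. *)
rewrite (_ : [set w | _] = \bigcup_k
    ([set w | index (m w) (ev gs w) = k] `&` [set w | S w (ev (new k) w)])).
  by apply: bigcupT_measurable => k; apply: measurableI; [exact: measurable_index|exact: gS].
have evE k w : ev (new k) w = take k (ev gs w) ++ [:: U n w * m w; (1 - U n w) * m w] ++ drop k.+1 (ev gs w).
  by rewrite /new /ev !map_cat map_take map_drop.
apply/seteqP; split => w /=.
  by move=> Sw; exists (index (m w) (ev gs w)) => //; split => //=; rewrite evE.
by move=> [k _ [kE]] /=; rewrite evE -kE.
Qed.

Lemma measurable_kak_event t (c : nat -> bool) :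
  measurable [set w | exists k, kak_threshold_is (fun k => U k w) t k /\ c k].
Proof.
have mM n : measurable [set w | kak_max (fun k => U k w) n <= t].
  apply: (@good_kak n (fun=> [set s | seqmax s <= t])) => gs ms.
  have ml : measurable_fun setT (fun w => seqmax (ev gs w) <= t).
    by apply: measurable_fun_ler => //; exact: measurable_seqmax.
  have mt : measurable [set true] by [].
  by have := ml measurableT _ mt; rewrite setTI.
rewrite (_ : [set w | _] = \bigcup_k (if c k then [set w | kak_max (fun k => U k w) k <= t] `&`
   \bigcap_j (if (j < k)%N then ~` [set w | kak_max (fun k => U k w) j <= t] else setT) else set0)).
  apply: bigcupT_measurable => k; case: (c k) => //; apply: measurableI => //.
  by apply: bigcapT_measurable => j; case: ifP => // _; exact: measurableC.
apply/seteqP; split => w /=.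
  move=> [k [[h1 h2] ck]]; exists k => //; rewrite ck; split => // j _.
  by case: ifP => // /h2; rewrite ltNge => /negP.
move=> [k _]; case ck : (c k) => // -[h1 h2]; exists k; split => //; split => // j jk.
by have := h2 j Logic.I; rewrite jk => /negP; rewrite ltNge.
Qed.

End event.

Section clipping.
Context {R : realType} {d : measure_display} {T : measurableType d}.
Variables (P : probability T R) (U : nat -> {RV P >-> R}).
Hypothesis hind : mutually_independent P (fun n => (U n : T -> R)).
Hypothesis hunif : forall n (B : set R), measurable B ->
  P (U n @^-1` B) = uniform_prob (@ltr01 R) B.

(** The law of [U n] only places it in the unit interval almost surely. Clipping keeps law and
    independence, makes the constraint hold everywhere, and changes the process only on a null
    set. *)
Let clip (x : R) : R := Num.min 1 (Num.max 0 x).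

Let clip_in x : 0 <= clip x <= 1.
Proof. by rewrite /clip le_min ler01 le_max lexx/= ge_min lexx. Qed.

Let clip_id x : 0 <= x <= 1 -> clip x = x.
Proof. by move=> /andP[x0 x1]; rewrite /clip max_r// min_r. Qed.

Let mclip : measurable_fun setT clip.
Proof. by apply: measurable_minr => //; exact: measurable_maxr. Qed.

Let mclipU n : measurable_fun setT (fun w => clip (U n w)).
Proof. exact: (measurableT_comp mclip (measurable_funPT (U n))). Qed.

Let V n : {RV P >-> R} := mfun_Sub (mem_set (mclipU n)).

Let mpre (B : set R) : measurable B -> measurable (clip @^-1` B).
Proof. by move=> mB; rewrite -[X in measurable X]setTI; exact: mclip. Qed.

Let uniform_eq (A B : set R) : measurable A -> measurable B ->
  (forall x, 0 <= x <= 1 -> A x <-> B x) ->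
  uniform_prob (@ltr01 R) A = uniform_prob (@ltr01 R) B.
Proof.
move=> mA mB AB.
have uE (C : set R) : measurable C -> uniform_prob (@ltr01 R) C =
    (\int[uniform_prob (@ltr01 R)]_x (\1_C x)%:E)%E.
  by move=> mC; rewrite integral_indic// setIT.
have mind (C : set R) : measurable C -> measurable_fun setT (fun x => (\1_C x)%:E : \bar R).
  by move=> mC; apply/measurable_EFinP; exact: measurable_indic.
rewrite !uE// !integral_uniform//; try exact: mind.
congr (_ * _)%E; apply: eq_integral => x; rewrite inE/= in_itv/= => x01.
congr (_%:E); rewrite !indicE; congr (_ %:R).
by have [AtoB BtoA] := AB x x01; congr nat_of_bool; apply/idP/idP; rewrite !inE.
Qed.

Lemma kak_law t : 0 < t -> t < 1 -> exists2 p : nat -> R, (forall k, 0 <= p k) &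
  (forall s f n, kak_fun s f ->
     normc (f t^-1 - \sum_(k < n) ((p k)%:C)%C * cis (s * (k.+1%:R - 2 / t))) <=
     expR 1 * (1 - t ^+ 2 / 6) ^+ n) /\
  (forall (c : nat -> bool) n,
     `|fine (P [set w | exists k, kak_threshold_is (fun k => U k w) t k /\ c k]) -
       \sum_(k < n) (c k)%:R * p k| <= expR 1 * (1 - t ^+ 2 / 6) ^+ n).
Proof.
move=> t0 t1.
have Vind : mutually_independent P (fun n => (V n : T -> R)).
  by move=> F uF B mB; exact: (hind uF (fun i => mpre (mB i))).
have Vunif n (B : set R) : measurable B -> P (V n @^-1` B) = uniform_prob (@ltr01 R) B.
  move=> mB; rewrite -[LHS]/(P (U n @^-1` (clip @^-1` B))) hunif; last exact: mpre.
  by apply: uniform_eq => //; [exact: mpre|move=> x x01; rewrite /= clip_id].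
have V01 n w : 0 <= V n w <= 1 by exact: clip_in.
have [p p0 [pf pc]] := kak_law_unit Vind Vunif V01 t0 t1.
exists p => //; split => // c n.
set E := [set w | _].
have mE : measurable E by apply: measurable_kak_event => k; exact: measurable_funPT.
set F := [set w | exists k, kak_threshold_is (fun k => V k w) t k /\ c k].
have mF : measurable F by apply: measurable_kak_event => k; exact: measurable_funPT.
suff -> : P E = P F by exact: pc.
pose N := \bigcup_k (U k @^-1` ~` `[0%R, 1%R]%classic).
have mN1 k : measurable (U k @^-1` ~` `[0%R, 1%R]%classic).
  by apply: measurable_RV; apply: measurableC; exact: measurable_itv.
have mN : measurable N by exact: bigcupT_measurable.
have PN : P N = 0%E.
  have PN1 k : P (U k @^-1` ~` `[0%R, 1%R]%classic) = 0%E.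
    rewrite hunif; last by apply: measurableC; exact: measurable_itv.
    rewrite (@uniform_eq _ set0) ?measure0//.
      by apply: measurableC; exact: measurable_itv.
  have /(_ mN) [+ _] := negligibleP P (A := N); apply; apply: negligible_bigcup => k.
  have /(_ (mN1 k)) [_] := negligibleP P (A := U k @^-1` ~` `[0%R, 1%R]%classic); apply.
  exact: PN1.
have null A : measurable A -> P A = P (A `\` N).
  move=> mA; apply: etrans (measureDI P mA mN) _; rewrite -[RHS]adde0; congr (_ + _)%E.
  apply: (@subset_measure0 _ _ _ P (A `&` N) N) => //; first exact: measurableI.
rewrite (null E)// (null F)//; congr (P _).
have VU w : ~ N w -> (fun k => V k w) = (fun k => U k w).
  move=> Nw; apply/funext => k; apply: clip_id.
  by apply: contrapT => h; apply: Nw; exists k => //=; rewrite in_itv.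
by apply/seteqP; split => w [[k hk] Nw]; split => //; exists k; move: hk; rewrite VU.
Qed.

End clipping.

(** * Comparison of the distribution functions *)

Section assembly.
Context {R : realType}.

Lemma bm_sum n (h : nat -> R -> R) : (forall k, bm (h k)) -> bm (fun s => \sum_(k < n) h k s).
Proof.
move=> bh; elim: n => [|n IH]; first by under eq_fun do rewrite big_ord0; exact: bm_cst.
by under eq_fun do rewrite big_ord_recr/=; exact: bmD.
Qed.

Lemma I01_sum n (h : nat -> R -> R) : (forall k, bm (h k)) ->
  I01 (fun s => \sum_(k < n) h k s) = \sum_(k < n) I01 (h k).
Proof.
move=> bh; elim: n => [|n IH].
  by rewrite big_ord0 -[RHS](I01_cst (0 : R)); apply: I01_eq => s _; rewrite big_ord0.
rewrite big_ord_recr/= -IH -I01D//; last exact: bm_sum.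
by apply: I01_eq => s _; rewrite big_ord_recr.
Qed.

Section exponential_sum.
Variables (n : nat) (p th : nat -> R).
Let S : R[i] := \sum_(k < n) ((p k)%:C)%C * cis (th k).

Let Re_S : Re S = \sum_(k < n) p k * cos (th k).
Proof.
rewrite /S; elim: n => [|m IH]; first by rewrite !big_ord0.
by rewrite !big_ord_recr/= -IH; case: (\sum_(i < m) _) => a b /=; rewrite mul0r subr0.
Qed.

Let Im_S : Im S = \sum_(k < n) p k * sin (th k).
Proof.
rewrite /S; elim: n => [|m IH]; first by rewrite !big_ord0.
by rewrite !big_ord_recr/= -IH; case: (\sum_(i < m) _) => a b /=; rewrite mul0r addr0.
Qed.

Lemma sum_cos_le al : \sum_(k < n) p k * cos (al - th k) <= normc S.
Proof.
apply: le_trans (normc_ge_rot S (cos2Dsin2 al)).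
rewrite Re_S Im_S !mulr_sumr -big_split/= ler_sum// => k _.
by rewrite cosB mulrDr !mulrA ![_ * p k]mulrC.
Qed.

Lemma sum_sin_le al (g : R) :
  `|\sum_(k < n) p k * sin (al - th k) - g * sin al| <= normc (S - (g%:C)%C).
Proof.
have -> : \sum_(k < n) p k * sin (al - th k) - g * sin al =
    sin al * Re (S - (g%:C)%C) + - cos al * Im (S - (g%:C)%C).
  have -> : Re (S - (g%:C)%C) = Re S - g by case: (S).
  have -> : Im (S - (g%:C)%C) = Im S by case: (S) => a b /=; rewrite oppr0 addr0.
  have -> : \sum_(k < n) p k * sin (al - th k) = sin al * Re S - cos al * Im S.
    rewrite Re_S Im_S !mulr_sumr -sumrB; apply: eq_bigr => k _.
    by rewrite sinB; ring.
  by ring.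
have e : sin al ^+ 2 + (- cos al) ^+ 2 = 1 by rewrite sqrrN addrC cos2Dsin2.
have e' : (- sin al) ^+ 2 + (cos al) ^+ 2 = 1 by rewrite sqrrN addrC cos2Dsin2.
rewrite ler_norml; apply/andP; split; last exact: normc_ge_rot.
by have := normc_ge_rot (S - (g%:C)%C) e'; lra.
Qed.

End exponential_sum.

(** It yields [n * r ^ n <= 1 / (1 - r)] uniformly in [n], to control first moments of a truncated
    law supported on [n] points. *)
Lemma geometric_linear_le (r : R) n : 0 <= r <= 1 -> n%:R * r ^+ n * (1 - r) <= 1 - r ^+ n.
Proof.
move=> /andP[r0 r1]; elim: n => [|n IH]; first by rewrite expr0 !mul0r subrr.
have rn : 0 <= r ^+ n.+1 <= 1 by rewrite exprn_ge0 ?exprn_ile1.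
have := ler_wpM2l r0 IH; move: rn; rewrite exprS -natr1.
by move: (r ^+ n) (n%:R : R) => x y; nra.
Qed.

Lemma le_geometric_limit (a b K r : R) : 0 <= K -> 0 <= r < 1 ->
  (forall n, a <= b + K * r ^+ n) -> a <= b.
Proof.
move=> K0 /andP[r0 r1] H; apply/ler_addgt0Pr => e e0.
have : (fun n => K * r ^+ n) @ \oo --> 0.
  rewrite -[X in _ --> X](mulr0 K); apply: cvgM; first exact: cvg_cst.
  by apply: cvg_expr; rewrite ger0_norm.
move=> /cvgrPdist_lt /(_ e e0) [N _ /(_ N (leqnn N))] /=.
rewrite sub0r normrN ger0_norm ?mulr_ge0 ?exprn_ge0// => Ke.
by apply: le_trans (H N) _; rewrite lerD2l ltW.
Qed.

Lemma Phi_lip (x y : R) : x <= y -> `|Phi y - Phi x| <= y - x.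
Proof.
move=> xy.
pose h (a : R) : R -> R := fun u => if u <= a then 1 else 0.
have gh a : gm (h a).
  apply: (@gm_bounded _ _ 1); last by move=> u; rewrite /h; case: ifP; rewrite ?normr0 ?normr1.
  by apply: measurable_fun_ifT => //; exact: measurable_fun_ler.
pose J : R -> R := \1_(`]x, y]%classic : set R).
have hJ u : h y u - h x u = J u.
  rewrite /h /J indicE; have [/=|/=] := boolP (u \in _).
    by rewrite inE/= in_itv/= => /andP[xu ->]; rewrite (lt_geF xu) subr0.
  rewrite notin_setE/= in_itv/=; case: (leP u y) => uy; case: (leP u x) => ux //=; rewrite ?subrr//.
  by have := le_lt_trans (le_trans ux xy) uy; rewrite ltxx.
have JE : (\int[lebesgue_measure]_u (J u)%:E = (y - x)%:E)%E.
  rewrite integral_indic//= setIT lebesgue_measure_itv/= lte_fin.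
  by move: xy; rewrite le_eqVlt => /orP[/eqP ->|->//]; rewrite ltxx subrr.
have iJ : lebesgue_measure.-integrable [set: R] (EFin \o J).
  apply/integrableP; split; first by apply/measurable_EFinP; exact: measurable_indic.
  apply: (@le_lt_trans _ _ (\int[lebesgue_measure]_u (J u)%:E)%E); last by rewrite JE ltry.
  rewrite le_eqVlt; apply/orP; left; apply/eqP; apply: eq_integral => u _.
  by rewrite gee0_abs// lee_fin /J indicE.
have {}JE : (\int[lebesgue_measure]_u J u)%R = y - x by rewrite /Rintegral JE.
have peak1 : normal_peak 1 <= 1 :> R.
  have h1 : 1 <= Num.sqrt (1 ^+ 2 * pi *+ 2) :> R.
    have pi2 : 1 <= 1 ^+ 2 * pi *+ 2 :> R by rewrite expr1n mul1r mulr2n; have := @pi_ge2 R; lra.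
    by rewrite -[leLHS]sqrtr1 ler_sqrt//; apply: le_trans pi2.
  by rewrite /normal_peak invf_le1//; exact: lt_le_trans h1.
rewrite !Phi_EG -(EGB (gh y) (gh x)) ger0_norm.
  rewrite -JE; apply: le_Rintegral => //; first exact: (gm_integrable (gmB (gh y) (gh x))).
  move=> u _; rewrite hJ -[leRHS]mulr1; apply: ler_wpM2l.
    by rewrite /J indicE.
  apply: le_trans (@normal_pdf_ub R 0 1 u (oner_neq0 _)) _.
  exact: peak1.
have g0 : gm (fun=> 0 : R) by apply: (@gm_bounded _ _ 0) => // u; rewrite normr0.
rewrite -[leLHS](EG_cst 0); apply: EG_le => //; first exact: gmB.
by move=> u; rewrite hJ /J indicE.
Qed.

Lemma Phi_bound (x : R) : 0 <= Phi x <= 1.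
Proof.
rewrite /Phi fine_ge0//= -lee_fin fineK ?fin_num_measure//; exact: probability_le1.
Qed.

Lemma bm_gauss (k : R) : bm (fun s => expR (- (k * s) ^+ 2)).
Proof.
apply: (@bm_mfun _ _ 1).
  apply: measurableT_comp => //; apply: measurableT_comp => //.
  by apply: measurable_funX; exact: measurable_funM.
by move=> s _; rewrite ger0_norm ?expR_ge0// expR_le1 oppr_le0 sqr_ge0.
Qed.

(** Here [p] is a law truncated to [n] atoms and [eps] bounds the truncation errors. The Fejer terms
    use the decay of its transform, the [kQ] terms its distance to the Gaussian. Dividing the
    constant error [eps] by [s] is not integrable at 0, so below [s0] the bound
    [|sin (s z)| <= s |z|] is used instead. *)
Lemma smoothed_distance (L C : R) : 0 < L -> 0 <= C ->
  (forall z : R, `|(if 0 <= z then 1 else 0) - 2^-1 - kQ z / (2 * L)| <= C * kpsi z) ->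
  forall (n : nat) (p W : nat -> R) (d v D eps s0 b : R),
  0 < d -> 0 < v -> 0 <= D -> 0 <= eps -> 0 < s0 <= 1 -> (forall k, 0 <= p k) ->
  `|1 - \sum_(k < n) p k| <= eps ->
  (forall s, 0 <= s <= d ->
     normc (\sum_(k < n) ((p k)%:C)%C * cis (s * W k)) <= expR (- (v / 2 * s) ^+ 2) + eps) ->
  (forall s, 0 < s <= d ->
     normc (\sum_(k < n) ((p k)%:C)%C * cis (s * W k) - ((expR (- ((v * s) ^+ 2 / 2)))%:C)%C) <=
     D * s ^+ 3 * v ^+ 2 * expR (- (v / 2 * s) ^+ 2) + eps) ->
  `|\sum_(k < n) (W k <= b)%R%:R * p k - Phi (b / v)| <=
  (16 * C / d + 24 * D / L) / v + (2 * C + 1) * eps +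
  (eps / s0 + (\sum_(k < n) p k * `|d * (b - W k)| + `|d * b|) * s0) / (2 * L).
Proof.
move=> L0 C0 ker n p W d v D eps s0 b d0 v0 D0 eps0 /andP[s00 s01] p0 h0 hm hg.
have dv0 : 0 < d * v by exact: mulr_gt0.
pose z k := d * (b - W k).
pose g s : R := expR (- ((d * v * s) ^+ 2 / 2)).
pose G := I01 (fun s => (1 - s ^+ 2) * (g s * sin (s * (d * b)) / s)).
pose B := \sum_(k < n) p k * `|z k| + `|d * b|.
pose I4 := I01 (fun s => expR (- (d * v / 2 * s) ^+ 2)).
have I4le : I4 <= 4 / (d * v).
  have dv2 : 0 < d * v / 2 by rewrite divr_gt0.
  apply: le_trans (I01_gauss_le dv2) _; rewrite le_eqVlt; apply/orP; left; apply/eqP.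
  by field; rewrite !gt_eqF.
have indE k : (W k <= b)%R%:R = (if 0 <= z k then 1 else 0) :> R.
  by rewrite /z pmulr_rge0// subr_ge0; case: (W k <= b).
have argE s k : s * z k = s * (d * b) - (d * s) * W k by rewrite /z; ring.
have ds s : 0 <= s <= 1 -> 0 <= d * s <= d.
  by move=> /andP[s_0 s_1]; rewrite mulr_ge0 ?(ltW d0)//= ler_piMr// ltW.
have kFsum w : \sum_(k < n) p k * kF (z k + w) <= I4 + eps.
  have -> : \sum_(k < n) p k * kF (z k + w) =
      I01 (fun s => \sum_(k < n) p k * ((1 - s) * cos (s * (z k + w)))).
    rewrite (I01_sum n (h := fun k s => p k * ((1 - s) * cos (s * (z k + w))))); last first.
      by move=> k; apply: bmM; [exact: bm_cst|exact: kF_bm].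
    by apply: eq_bigr => k _; rewrite I01Zl//; exact: kF_bm.
  rewrite /I4 -[eps]I01_cst -I01D; [|exact: bm_gauss|exact: bm_cst].
  apply: I01_le.
  - apply: (bm_sum n (h := fun k s => p k * ((1 - s) * cos (s * (z k + w))))) => k.
    by apply: bmM; [exact: bm_cst|exact: kF_bm].
  - by apply: bmD; [exact: bm_gauss|exact: bm_cst].
  move=> s s_01; have := s_01 => /andP[s_0 s_1].
  have -> : \sum_(k < n) p k * ((1 - s) * cos (s * (z k + w))) =
      (1 - s) * \sum_(k < n) p k * cos (s * (d * b + w) - d * s * W k).
    rewrite mulr_sumr; apply: eq_bigr => k _; rewrite mulrCA; do 2 congr (_ * _).
    by congr cos; rewrite mulrDr argE; ring.
  have h := le_trans (@sum_cos_le n p (fun k => d * s * W k) (s * (d * b + w))) (hm _ (ds _ s_01)).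
  have e : v / 2 * (d * s) = d * v / 2 * s by ring.
  rewrite e in h.
  have E0 : 0 <= expR (- (d * v / 2 * s) ^+ 2) + eps by rewrite addr_ge0 ?expR_ge0.
  apply: le_trans (ler_wpM2l _ h) _; first by rewrite subr_ge0.
  by rewrite ler_piMl//; lra.
have T1 : `|\sum_(k < n) p k * ((if 0 <= z k then 1 else 0) - 2^-1 - kQ (z k) / (2 * L))| <=
    C * (2 * (I4 + eps)).
  apply: le_trans (ler_norm_sum _ _ _) _.
  apply: (@le_trans _ _ (C * \sum_(k < n) (p k * kF (z k) + p k * kF (z k + 1)))).
    rewrite mulr_sumr ler_sum// => k _; rewrite normrM (ger0_norm (p0 k)).
    by rewrite -mulrDr -/(kpsi _) [leRHS]mulrCA ler_wpM2l.
  rewrite ler_wpM2l// big_split/=.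
  have := kFsum 0; rewrite (eq_bigr (fun k : 'I_n => p k * kF (z k))); last by move=> k _; rewrite addr0.
  by have := kFsum 1; lra.
have bg : bm g.
  apply: (@bm_mfun _ _ 1).
    apply: measurableT_comp => //; apply: measurableT_comp => //.
    by apply: measurable_funM => //; apply: measurable_funX; exact: measurable_funM.
  by move=> s _; rewrite ger0_norm ?expR_ge0// expR_le1 oppr_le0 divr_ge0 ?sqr_ge0.
have T3 : `|Phi (b / v) - 2^-1 - G / (2 * L)| <= C * (2 * I4).
  apply: le_trans (gaussian_smoothing L0 C0 ker b d0 v0) _.
  rewrite ler_wpM2l// ler_wpM2l//; apply: I01_le => //; first exact: bm_gauss.
  move=> s _; rewrite ler_expR lerN2 [leLHS](_ : _ = (d * v * s) ^+ 2 / 4); last by field.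
  by have := sqr_ge0 (d * v * s); lra.
pose H := \sum_(k < n) p k * kQ (z k).
pose bound s := 8 * D * d * expR (- (d * v / 3 * s) ^+ 2) + eps / s0 +
  B * (if 0 <= s <= s0 then 1 else 0).
have T2 : `|H - G| <= 48 * D / v + eps / s0 + B * s0.
  have bk k : bm (fun s => p k * ((1 - s ^+ 2) * (sin (s * z k) / s))).
    by apply: bmM; [exact: bm_cst|exact: kQ_bm].
  have bG : bm (fun s => (1 - s ^+ 2) * (g s * sin (s * (d * b)) / s)).
    rewrite (_ : (fun s => _) = fun s => g s * ((1 - s ^+ 2) * (sin (s * (d * b)) / s))).
      by apply: bmM => //; exact: kQ_bm.
    by apply/funext => s; ring.
  have bI : bm (fun s : R => if 0 <= s <= s0 then 1 else 0).
    apply: bm_if; [|exact: bm_cst|exact: bm_cst].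
    by apply: measurable_and; exact: measurable_fun_ler.
  have bb1 : bm (fun s => 8 * D * d * expR (- (d * v / 3 * s) ^+ 2)).
    by apply: bmM; [exact: bm_cst|exact: bm_gauss].
  have bb2 : bm (fun s => B * (if 0 <= s <= s0 then 1 else 0)).
    by apply: bmM => //; exact: bm_cst.
  have bbe : bm (fun s => 8 * D * d * expR (- (d * v / 3 * s) ^+ 2) + eps / s0).
    by apply: bmD => //; exact: bm_cst.
  have -> : H = I01 (fun s => \sum_(k < n) p k * ((1 - s ^+ 2) * (sin (s * z k) / s))).
    rewrite (I01_sum n bk); apply: eq_bigr => k _; rewrite I01Zl//; exact: kQ_bm.
  rewrite -I01B//; last exact: (bm_sum n bk).
  apply: (@le_trans _ _ (I01 bound)).
    apply: I01_norm; [by apply: bmB => //; exact: (bm_sum n bk)|by apply: bmD|].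
    move=> s s_01; have := s_01 => /andP[s_0 s_1].
    have B0 : 0 <= B by rewrite addr_ge0// sumr_ge0// => k _; rewrite mulr_ge0.
    have first0 : 0 <= 8 * D * d * expR (- (d * v / 3 * s) ^+ 2).
      by rewrite !mulr_ge0 ?expR_ge0// ltW.
    have eps1 : 0 <= eps / s0 by rewrite divr_ge0// ltW.
    pose N := \sum_(k < n) p k * sin (s * z k) - g s * sin (s * (d * b)).
    have -> : \sum_(k < n) p k * ((1 - s ^+ 2) * (sin (s * z k) / s)) -
        (1 - s ^+ 2) * (g s * sin (s * (d * b)) / s) = (1 - s ^+ 2) * (N / s).
      rewrite /N [X in _ = _ * X]mulrBl [RHS]mulrBr; congr (_ - _); rewrite mulr_suml mulr_sumr.
      by apply: eq_bigr => k _; ring.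
    have s21 : 0 <= 1 - s ^+ 2 <= 1.
      have : s ^+ 2 <= 1 by rewrite expr_le1.
      by have := sqr_ge0 s; lra.
    have := s21 => /andP[s2a s2b].
    rewrite normrM (ger0_norm s2a); apply: (@le_trans _ _ `|N / s|); first by rewrite ler_piMl.
    rewrite normrM normfV (ger0_norm s_0) /bound.
    have [ss0|ss0] := leP s s0.
      rewrite s_0/= mulr1; apply: (@le_trans _ _ B); last by lra.
      have [->|sn0] := eqVneq s 0; first by rewrite invr0 mulr0.
      have s_gt0 : 0 < s by rewrite lt_def sn0.
      rewrite ler_pdivrMr//; apply: le_trans (ler_normB _ _) _.
      rewrite mulrDl; apply: lerD.
        rewrite mulr_suml; apply: le_trans (ler_norm_sum _ _ _) _.
        apply: ler_sum => k _; rewrite normrM (ger0_norm (p0 k)) -mulrA ler_wpM2l//.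
        by apply: le_trans (sin_norm_le _) _; rewrite normrM (ger0_norm s_0) mulrC.
      rewrite normrM; apply: (@le_trans _ _ (1 * `|sin (s * (d * b))|)).
        by apply: ler_wpM2r => //; rewrite ger0_norm ?expR_ge0// expR_le1 oppr_le0 divr_ge0 ?sqr_ge0.
      by rewrite mul1r; apply: le_trans (sin_norm_le _) _; rewrite normrM (ger0_norm s_0) mulrC.
    rewrite andbF mulr0 addr0.
    have s_gt0 : 0 < s by exact: lt_trans ss0.
    have ds1 : 0 < d * s <= d by rewrite mulr_gt0//=; have /andP[] := ds _ s_01.
    have hN : `|N| <= D * (d * s) ^+ 3 * v ^+ 2 * expR (- (v / 2 * (d * s)) ^+ 2) + eps.
      apply: le_trans (hg _ ds1).
      have := @sum_sin_le n p (fun k => d * s * W k) (s * (d * b)) (g s).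
      have -> : v * (d * s) = d * v * s by ring.
      rewrite -/(g s); apply: le_trans; rewrite /N le_eqVlt; apply/orP; left; apply/eqP.
      by congr (`|_ - _|); apply: eq_bigr => k _; rewrite argE.
    rewrite ler_pdivrMr//; apply: le_trans hN _.
    rewrite mulrDl; apply: lerD; last first.
      by rewrite -mulrA ler_peMr// mulrC ler_pdivlMr// mul1r ltW.
    (* The polynomial factor is absorbed by half of the exponential, [y e^(- y) <= 1]; the remaining
       [e^(- y)] is at most the Gaussian with rate [d v / 3], whose integral is at most
       [6 / (d v)]. *)
    pose y := (d * v * s) ^+ 2 / 8.
    have y0 : 0 <= y by rewrite divr_ge0 ?sqr_ge0.
    have -> : D * (d * s) ^+ 3 * v ^+ 2 * expR (- (v / 2 * (d * s)) ^+ 2) =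
        8 * D * d * (y * expR (- (y + y))) * s.
      have -> : (v / 2 * (d * s)) ^+ 2 = y + y by rewrite /y; field.
      by rewrite /y; field.
    apply: ler_wpM2r => //; apply: ler_wpM2l; first by rewrite !mulr_ge0// ltW.
    have ye : y * expR (- y) <= 1.
      rewrite expRN ler_pdivrMr ?expR_gt0// mul1r.
      by apply: le_trans (expR_ge1Dx _); lra.
    rewrite opprD expRD mulrA; apply: (@le_trans _ _ (1 * expR (- y))).
      by apply: ler_wpM2r => //; exact: expR_ge0.
    rewrite mul1r ler_expR lerN2 /y.
    have -> : (d * v / 3 * s) ^+ 2 = (d * v * s) ^+ 2 / 9 by field.
    by have := sqr_ge0 (d * v * s); lra.
  rewrite /bound I01D// I01D//; last exact: bm_cst.
  rewrite I01Zl; last exact: bm_gauss.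
  rewrite I01_cst I01Zl// (_ : I01 (fun s => if 0 <= s <= s0 then 1 else 0) = s0); last first.
    rewrite -[RHS]subr0; apply: (@I01_cc_FTC _ 0 s0 (fun=> 1) id) => //; first exact: ltW.
    by move=> u _; exact: cvg_cst.
  rewrite !lerD2r.
  have dv3 : 0 < d * v / 3 by rewrite divr_gt0.
  apply: le_trans (ler_wpM2l _ (I01_gauss_le dv3)) _; first by rewrite !mulr_ge0// ltW.
  rewrite le_eqVlt; apply/orP; left; apply/eqP; field; by rewrite !gt_eqF.
have T0 : `|2^-1 * (\sum_(k < n) p k - 1)| <= 2^-1 * eps.
  by rewrite normrM (ger0_norm (_ : 0 <= 2^-1))// ler_wpM2l// distrC.
have decomp : \sum_(k < n) (W k <= b)%R%:R * p k - Phi (b / v) =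
    \sum_(k < n) p k * ((if 0 <= z k then 1 else 0) - 2^-1 - kQ (z k) / (2 * L)) +
    2^-1 * (\sum_(k < n) p k - 1) + (H - G) / (2 * L) - (Phi (b / v) - 2^-1 - G / (2 * L)).
  have -> : \sum_(k < n) p k * ((if 0 <= z k then 1 else 0) - 2^-1 - kQ (z k) / (2 * L)) =
     \sum_(k < n) (W k <= b)%R%:R * p k - 2^-1 * \sum_(k < n) p k - H / (2 * L).
    rewrite /H mulr_suml mulr_sumr -!sumrB; apply: eq_bigr => k _; rewrite indE.
    by move: (if 0 <= z k then 1 else 0) => j; ring.
  by ring.
have T2' : `|(H - G) / (2 * L)| <= (48 * D / v + eps / s0 + B * s0) / (2 * L).
  have L2 : 0 < (2 * L)^-1 by rewrite invr_gt0 mulr_gt0.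
  by rewrite normrM (gtr0_norm L2) ler_wpM2r// ltW.
rewrite decomp; apply: le_trans (ler_normB _ _) _.
apply: le_trans (lerD (ler_normD _ _) T3) _.
apply: le_trans (lerD (lerD (ler_normD _ _) T2') (lexx _)) _.
apply: le_trans (lerD (lerD (lerD T1 T0) (lexx _)) (lexx _)) _.
have CI : C * I4 <= C * (4 / (d * v)) by exact: ler_wpM2l.
have -> : (16 * C / d + 24 * D / L) / v = 4 * (C * (4 / (d * v))) + 48 * D / v / (2 * L).
  by field; rewrite !gt_eqF.
rewrite -/B !(mulrDl _ _ (2 * L)^-1); lra.
Qed.


(** The case [s = 0] of the transform identity; it controls the mass lost by truncation. *)
Lemma kak_fun0 : kak_fun 0 (fun=> 1 : R[i]).
Proof.
split=> [|x|x _|x _].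
- by split; exact: measurable_cst.
- by rewrite normc1.
- by rewrite mul0r /cis cos0 sin0.
- by rewrite /cI mulr1 !I01_cst.
Qed.

(** Every truncation at [n] gives the bound up to a multiple of [r ^ n], and then [n] tends to
    infinity. The rate [r ^ (4 n)] in the hypotheses leaves room for a division by [s0] and for a
    moment growing linearly in [n]. *)
Lemma kak_berry_esseen : exists2 C : R, 0 <= C &
  forall (X b r A : R) (p : nat -> R) (Pe : R), 2 <= X -> 0 < r < 1 -> 0 <= A ->
  (forall k, 0 <= p k) ->
  (forall s f n, kak_fun s f ->
     normc (f X - \sum_(k < n) ((p k)%:C)%C * cis (s * (k.+1%:R - 2 * X))) <= A * r ^+ (4 * n)) ->
  (forall n, `|Pe - \sum_(k < n) (k.+1%:R - 2 * X <= b)%R%:R * p k| <= A * r ^+ (4 * n)) ->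
  `|Pe - Phi (b / Num.sqrt (kc * X))| <= C / Num.sqrt (kc * X).
Proof.
have [d /andP[d0 d20] dmod] := @kak_modulus R.
have [K K0 Kg] := @kak_gaussian R.
have [L L0 [C C0 ker]] := @kernel_bound R.
have c0 := @kc_gt0 R.
(* Since [v ^ 2 = kc * X], this makes [K s ^ 3 X] equal to [D s ^ 3 v ^ 2]. *)
pose D := K / kc; have D0 : 0 <= D by rewrite divr_ge0 ?ltW.
exists (16 * C / d + 24 * D / L); first by apply: addr_ge0; apply: divr_ge0; try exact: mulr_ge0; exact: ltW.
move=> X b r A p Pe X2 /andP[r0 r1] A0 p0 hf hP.
have X0 : 0 < X by lra.
have cX : 0 < kc * X by exact: mulr_gt0.
set v := Num.sqrt (kc * X).
have v0 : 0 < v by rewrite sqrtr_gt0.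
have v2 : v ^+ 2 = kc * X by rewrite sqr_sqrtr// ltW.
pose W k : R := k.+1%:R - 2 * X.
have h0 n : `|1 - \sum_(k < n) p k| <= A * r ^+ (4 * n).
  have := hf 0 _ n kak_fun0; rewrite (_ : 1 - _ = ((1 - \sum_(k < n) p k)%:C)%C) ?normc_real//.
  rewrite rmorphB rmorph1 rmorph_sum; congr (_ - _); apply: eq_bigr => k _.
  by rewrite mul0r /cis cos0 sin0 mulr1.
pose Mz : R := `|b| + 2 * X.
have Mz0 : 0 <= Mz by rewrite addr_ge0// mulr_ge0// ltW.
have r01 : 0 <= r <= 1 by rewrite !ltW.
have rn1 n : 0 <= r ^+ n <= 1 by rewrite exprn_ge0 ?exprn_ile1// ltW.
have pw n m : (n <= m)%N -> r ^+ m <= r ^+ n.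
  by move=> nm; rewrite ler_wiXn2l// ltW.
pose K1 := A + (2 * C + 1) * A +
  (A + ((1 + A) * (d * (Mz + (1 - r)^-1)) + `|d * b|)) / (2 * L).
have or0 : 0 < 1 - r by lra.
have K10 : 0 <= K1.
  have k1 : 0 <= (2 * C + 1) * A by apply: mulr_ge0 => //; apply: addr_ge0 => //; exact: mulr_ge0.
  have k2 : 0 <= (1 + A) * (d * (Mz + (1 - r)^-1)).
    apply: mulr_ge0; first exact: addr_ge0.
    by apply: mulr_ge0; [exact: ltW|apply: addr_ge0 => //; rewrite invr_ge0 ltW].
  have k3 : 0 <= (2 * L)^-1 by rewrite invr_ge0 mulr_ge0// ltW.
  by apply: addr_ge0; [exact: addr_ge0|apply: mulr_ge0 => //; rewrite !addr_ge0].
apply: (@le_geometric_limit _ _ K1 r) => //; first by rewrite ltW.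
move=> n; set eps := A * r ^+ (4 * n).
have eps0 : 0 <= eps by rewrite mulr_ge0//; have /andP[] := rn1 (4 * n)%N.
(* Half of the available exponent: [eps / s0] is still of order [r ^ (2 n)], and [n * s0] is at most
   [r ^ n / (1 - r)]. *)
pose s0 := r ^+ (2 * n).
have s00 : 0 < s0 by rewrite exprn_gt0.
have s01 : 0 < s0 <= 1 by rewrite s00; have /andP[] := rn1 (2 * n)%N.
pose S s : R[i] := \sum_(k < n) ((p k)%:C)%C * cis (s * W k).
have hm s : 0 <= s <= d -> normc (S s) <= expR (- (v / 2 * s) ^+ 2) + eps.
  have -> : (v / 2 * s) ^+ 2 = kc / 4 * s ^+ 2 * X.
    by rewrite exprMn exprMn v2; field.
  move=> /andP[s_0 s_1]; have [->|sn0] := eqVneq s 0.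
    rewrite expr0n/= mulr0 mul0r oppr0 expR0 /S.
    under eq_bigr do rewrite mul0r /cis cos0 sin0 mulr1.
    rewrite -rmorph_sum normc_real; have := h0 n; rewrite -/eps ler_norml => /andP[h1 h2].
    by rewrite ger0_norm ?sumr_ge0//; lra.
  have sp : 0 < s <= d by rewrite lt_def sn0 s_0.
  have [f kf] := kak_fun_exists s.
  have := normcD (S s - f X) (f X); rewrite subrK => /le_trans; apply.
  rewrite addrC; apply: lerD; last by rewrite normcB; exact: hf.
  apply: le_trans (dmod _ _ _ sp kf X2) _; rewrite ler_expR lerN2.
  by rewrite ler_wpM2l ?mulr_ge0 ?sqr_ge0 ?divr_ge0 ?(ltW c0)//; lra.
have hg s : 0 < s <= d ->
    normc (S s - ((expR (- ((v * s) ^+ 2 / 2)))%:C)%C) <=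
    D * s ^+ 3 * v ^+ 2 * expR (- (v / 2 * s) ^+ 2) + eps.
  move=> sp; have [f kf] := kak_fun_exists s.
  have -> : (v / 2 * s) ^+ 2 = kc / 4 * s ^+ 2 * X by rewrite exprMn exprMn v2; field.
  have -> : (v * s) ^+ 2 / 2 = kc / 2 * s ^+ 2 * X by rewrite exprMn v2; field.
  have -> : D * s ^+ 3 * v ^+ 2 = K * s ^+ 3 * X by rewrite v2 /D; field; rewrite gt_eqF.
  apply: le_trans (normc_tri _ (f X) _) _; rewrite addrC; apply: lerD.
    apply: Kg => //; last by move=> x x2; exact: dmod.
    by case/andP: sp => -> /= sd; exact: le_trans sd d20.
  by rewrite normcB; exact: hf.
have main := smoothed_distance L0 C0 ker b d0 v0 D0 eps0 s01 p0 (h0 n) hm hg.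
have tri : `|Pe - Phi (b / v)| <= eps + `|\sum_(k < n) (W k <= b)%R%:R * p k - Phi (b / v)|.
  have -> : Pe - Phi (b / v) = (Pe - \sum_(k < n) (W k <= b)%R%:R * p k) +
    (\sum_(k < n) (W k <= b)%R%:R * p k - Phi (b / v)) by ring.
  by apply: le_trans (ler_normD _ _) _; rewrite lerD2r; exact: hP.
apply: le_trans tri _; apply: le_trans (lerD (lexx _) main) _.
set T := (16 * C / d + 24 * D / L) / v.
have e1 : eps <= A * r ^+ n by rewrite ler_wpM2l// pw// leq_pmull.
have e2 : eps / s0 <= A * r ^+ n.
  have -> : eps / s0 = A * r ^+ (2 * n).
    by rewrite /eps /s0 -[4%N]/(2 + 2)%N mulnDl exprD mulrA mulfK// gt_eqF.
  by rewrite ler_wpM2l// pw// leq_pmull.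
have sp1 : \sum_(k < n) p k <= 1 + A.
  have := h0 n; rewrite ler_norml => /andP[+ _].
  have : A * r ^+ (4 * n) <= A by rewrite ler_piMr//; have /andP[] := rn1 (4 * n)%N.
  by lra.
have zk (k : 'I_n) : `|d * (b - W k)| <= d * (Mz + n%:R).
  rewrite normrM (gtr0_norm d0) ler_wpM2l ?(ltW d0)//.
  have kn : (k.+1%:R : R) <= n%:R by rewrite ler_nat.
  have k0 : 0 <= k.+1%:R :> R by [].
  rewrite /W /Mz opprB addrA; apply: le_trans (ler_normB _ _) _; apply: lerD; last by rewrite ger0_norm.
  by apply: le_trans (ler_normD _ _) _; rewrite lerD2l ger0_norm// mulr_ge0// ltW.
have sz : \sum_(k < n) p k * `|d * (b - W k)| <= (1 + A) * (d * (Mz + n%:R)).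
  apply: (@le_trans _ _ (\sum_(k < n) p k * (d * (Mz + n%:R)))).
    by apply: ler_sum => k _; rewrite ler_wpM2l.
  rewrite -mulr_suml; apply: ler_wpM2r => //.
  by apply: mulr_ge0; [exact: ltW|exact: addr_ge0].
have nr : n%:R * r ^+ n <= (1 - r)^-1.
  rewrite -[leRHS]mul1r ler_pdivlMr//; apply: le_trans (geometric_linear_le n r01) _.
  by have /andP[] := rn1 n; lra.
have e3 : (\sum_(k < n) p k * `|d * (b - W k)| + `|d * b|) * s0 <=
    ((1 + A) * (d * (Mz + (1 - r)^-1)) + `|d * b|) * r ^+ n.
  have -> : s0 = r ^+ n * r ^+ n by rewrite /s0 mul2n -addnn exprD.
  rewrite mulrA; apply: ler_wpM2r; first by have /andP[] := rn1 n.
  have /andP[a0 a1] := rn1 n.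
  rewrite mulrDl; apply: lerD; last by rewrite ler_piMr.
  apply: le_trans (ler_wpM2r a0 sz) _.
  rewrite -mulrA; apply: ler_wpM2l; first by rewrite addr_ge0.
  rewrite -mulrA; apply: ler_wpM2l; first exact: ltW.
  by rewrite mulrDl; apply: lerD => //; rewrite ler_piMr.
have L20 : 0 <= (2 * L)^-1 by rewrite invr_ge0 mulr_ge0// ltW.
have e4 := ler_wpM2r L20 (lerD e2 e3).
have e5 : (2 * C + 1) * eps <= (2 * C + 1) * (A * r ^+ n).
  by rewrite ler_wpM2l// addr_ge0// mulr_ge0.
have -> : K1 * r ^+ n = A * r ^+ n + (2 * C + 1) * (A * r ^+ n) +
  (A * r ^+ n + ((1 + A) * (d * (Mz + (1 - r)^-1)) + `|d * b|) * r ^+ n) / (2 * L).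
  by rewrite /K1; ring.
move: e1 e4 e5; rewrite -/W; clear; lra.
Qed.

End assembly.

Theorem theorem1p8 (R : realType) (d : measure_display) (T : measurableType d)
  (P : probability T R) (U : nat -> {RV P >-> R})
  (hind : mutually_independent P (fun n => (U n : T -> R)))
  (hunif : forall n (B : set R), measurable B ->
     P (U n @^-1` B) = uniform_prob (@ltr01 R) B) :
  exists C : R, 0 <= C /\
    forall t : R, 0 < t -> forall x : R,
      `| fine (P [set w | exists n : nat,
                   kak_threshold_is (fun k => U k w) t n /\
                   Num.sqrt (2 * t / kak_sigma2) * (n%:R - 2 / t) <= x])
         - Phi x | <= C * Num.sqrt t.
Proof.
have [C C0 CB] := @kak_berry_esseen R.
have c0 := @kc_gt0 R.
have sc0 : 0 < Num.sqrt (kc : R) by rewrite sqrtr_gt0.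
have C1 : 0 <= (C + 1) / Num.sqrt kc by rewrite divr_ge0 ?addr_ge0 ?sqrtr_ge0.
(* The 2 serves [t >= 1 / 2], where [2 * sqrt t >= 1] exceeds any difference of probabilities; this
   range contains [t >= 1], where nothing is split. The added 1 is the Lipschitz cost of a shift. *)
exists (2 + (C + 1) / Num.sqrt kc); split; first by rewrite addr_ge0.
move=> t t0 x; have st0 : 0 <= Num.sqrt t by exact: sqrtr_ge0.
set E := [set w | _].
have [t2|t2] := leP 2^-1 t.
  have mE : measurable E.
    apply: (@measurable_kak_event R d T (fun k => U k) _ t
      (fun n => Num.sqrt (2 * t / kak_sigma2) * (n%:R - 2 / t) <= x)) => k.
    exact: measurable_funPT.
  have P01 : 0 <= fine (P E) <= 1.
    rewrite fine_ge0//= -lee_fin fineK ?fin_num_measure//; exact: probability_le1.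
  have h1 : 2^-1 <= Num.sqrt t.
    rewrite -[leLHS]gtr0_norm// -sqrtr_sqr ler_sqrt//; apply: le_trans t2; lra.
  have := Phi_bound x; have := mulr_ge0 C1 st0; rewrite mulrDl ler_norml.
  by move: P01 h1; clear; lra.
have t1 : t < 1 by lra.
have [p p0 [pf pP]] := kak_law hind hunif t0 t1.
(* By Bernoulli's inequality [r ^ 4] is at least [1 - t ^ 2 / 6], the decay rate of [kak_law]. *)
pose r := 1 - t ^+ 2 / 24; pose X := t^-1.
have X2 : 2 <= X by rewrite -[2]invrK lef_pV2 ?posrE ?invr_gt0// ltW.
have tt : 0 < t ^+ 2 < 1 by rewrite exprn_gt0//= expr_lt1// ltW.
have r01 : 0 < r < 1 by rewrite /r; lra.
have q0 : 0 <= 1 - t ^+ 2 / 6 by lra.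
have qr n : expR 1 * (1 - t ^+ 2 / 6) ^+ n <= expR 1 * r ^+ (4 * n).
  rewrite ler_wpM2l ?expR_ge0// exprM lerXn2r ?nnegrE ?exprn_ge0//.
    by case/andP: r01 => /ltW.
  rewrite /r; move: tt; move: (t ^+ 2) => y /andP[y0 y1].
  have -> : (1 - y / 24) ^+ 4 = ((1 - y / 24) ^+ 2) ^+ 2 by rewrite -exprM.
  have h1 : 1 - y / 12 <= (1 - y / 24) ^+ 2 by have := sqr_ge0 y; nra.
  have : (1 - y / 12) ^+ 2 <= ((1 - y / 24) ^+ 2) ^+ 2.
    by rewrite lerXn2r ?nnegrE ?sqr_ge0//; lra.
  by have := sqr_ge0 y; nra.
pose v : R := Num.sqrt (kc * X).
have v0 : 0 < v by rewrite sqrtr_gt0 mulr_gt0// invr_gt0.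
have vE : Num.sqrt (2 * t / kak_sigma2) = v^-1.
  rewrite /v -sqrtrV ?mulr_ge0 ?invr_ge0 ?(ltW c0) ?(ltW t0)//; congr Num.sqrt.
  have -> : kak_sigma2 = 2 * kc :> R by rewrite /kak_sigma2 /kc; ring.
  by rewrite /X; field; rewrite !gt_eqF.
(* The 1 accounts for [W] counting intervals, one more than [N_t]; it moves the argument of [Phi] by
   [1 / v], which is of the order of the error. *)
pose b := x * v + 1.
have cE n : (Num.sqrt (2 * t / kak_sigma2) * (n%:R - 2 / t) <= x) = (n.+1%:R - 2 * X <= b).
  by rewrite vE mulrC ler_pdivrMr// /b /X -natr1 -lerBlDr; congr (_ <= _); ring.
have key := CB X b r (expR 1) p (fine (P E)) X2 r01 (expR_ge0 1) p0.
have {}key : `|fine (P E) - Phi (b / v)| <= C / v.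
  apply: key => [s f n kf|n]; first exact: le_trans (pf s f n kf) (qr n).
  apply: le_trans (qr n).
  have := pP (fun n => Num.sqrt (2 * t / kak_sigma2) * (n%:R - 2 / t) <= x) n.
  by under eq_bigr do rewrite cE.
have bv : b / v = x + v^-1 by rewrite /b mulrDl mul1r mulfK// gt_eqF.
have lip : `|Phi (b / v) - Phi x| <= v^-1.
  rewrite bv; have := @Phi_lip R x (x + v^-1); rewrite (addrAC x) subrr add0r; apply.
  by rewrite lerDl invr_ge0 ltW.
have vt : v^-1 = Num.sqrt t / Num.sqrt kc.
  rewrite /v sqrtrM ?(ltW c0)// invfM mulrC /X sqrtrV ?(ltW t0)// invrK//.
apply: le_trans (ler_distD (Phi (b / v)) _ _) _.
apply: le_trans (lerD key lip) _.
have -> : C / v + v^-1 = (C + 1) / Num.sqrt kc * Num.sqrt t by rewrite vt; ring.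
by rewrite [leRHS]mulrDl lerDr mulr_ge0.
Qed.
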